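(* Let $n\ge1$, $a>0$, $I\subseteq\mathbb R$ an open interval, and $\Omega\subseteq\mathbb C^m$ ($m\ge1$) a connected open set. Assume that $\Lambda\in\mathscr O(\mathbb H_{I,a}\times\Omega;\mathfrak h(n,\mathbb C))$ satisfies both the uniform integrability condition and the uniform $L$-condition on $I$, and that $R\in\mathscr O(\mathbb H_{I,a}\times\Omega;\mathfrak{gl}(n,\mathbb C))$ satisfies the uniform good decay condition on $I$. Then the differential equation $$\frac{dY}{dz}=\left(\Lambda(z,\omega)+R(z,\omega)\right)Y$$ admits a unique holomorphic fundamental matrix solution $Y\colon\mathbb H_{I,a}\times\Omega\to GL(n,\mathbb C)$ which, for any closed interval $J\subset I$ and $z\to\infty$ in $\mathbb H_{J,a}$, behaves as $$Y(z,\omega)=\left(I_n+o(1)\right)\exp\left(\int_{z_o}^z\Lambda(t,\omega)\,dt\right)\quad\text{uniformly in }\Omega,$$ where $z_o$ is an arbitrary point of $\mathbb H_{I,a}$.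
   Context: Notation. $\widetilde{\mathbb C^*}$ is the universal cover of $\mathbb C^*$; its points have modulus $|z|>0$ and argument $\arg z\in\mathbb R$. For $\phi\in\mathbb R$, $a>0$, $\mathbb H_{\phi,a}:=\{z\in\widetilde{\mathbb C^*}:\arg z\in\left]\phi-\frac\pi2;\phi+\frac\pi2\right[,\ |z|\ge\frac{a}{\cos(\phi-\arg z)}\}$ and $\ell_{\phi,a}:=\partial\mathbb H_{\phi,a}$, oriented as a boundary, i.e. with direction of angle $\phi-\pi/2$; $w\le z$ on $\ell_{\phi,a}$ means $w$ precedes $z$. For an interval $I$, $\mathbb H_{I,a}:=\bigcup_{\phi\in I}\mathbb H_{\phi,a}$. Closed intervals are of the form $J=[c,d]$. $\mathfrak h(n,\mathbb C)\subset\mathfrak{gl}(n,\mathbb C)$ are the diagonal matrices; $\mathfrak{gl}(n,\mathbb C)$ carries an arbitrary norm $|\cdot|$. $\mathscr O(C;V)$ is the space of $V$-valued holomorphic functions on $C$ (if $C$ is not open: on some open neighbourhood). $\|\cdot\|_1$ is the $L^1$-norm on a line with respect to arc length. Uniform integrability condition for $\Lambda$: there exist positive functions $g_i:\mathbb H_{I,a}\to\mathbb R_{\ge0}$, $i=1,\dots,n$, which are $L^1$-integrable along the segments joining any two points of $\mathbb H_{I,a}$, with $|\Lambda_{ii}(z,\omega)|\le g_i(z)$ for any $\omega\in\Omega$. Uniform $L$-condition for $\Lambda$ on $I$: for each $\omega$, closed $J\subseteq I$, and $i,j$, let $\mathfrak S^{ij}_{J,a}$, resp. $\mathfrak I^{ij}_{J,a}$,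 be the supremum, resp. infimum, over $\phi\in J$, $b\ge a$, $w\le z$ in $\ell_{\phi,b}$, of $\operatorname{Re}\int_{w,\ell_{\phi,b}}^z(\Lambda_{ii}(t,\omega)-\Lambda_{jj}(t,\omega))dt$ (integral along $\ell_{\phi,b}$). The condition requires that for any $i,j\in\{1,\dots,n\}$ and any closed interval $J\subseteq I$ there exist $K_1,K_2\in\mathbb R$, depending on $J$, such that one of the following mutually exclusive conditions holds: either $\sup_{\omega\in\Omega}\mathfrak S^{ij}_{J,a}\le K_1$ and $\sup_{\omega\in\Omega}\mathfrak I^{ij}_{J,a}=-\infty$; or $\inf_{\omega\in\Omega}\mathfrak I^{ij}_{J,a}\ge K_2$. Uniform good decay condition for $R$ on $I$: there is a positive function $g$ which, for any closed interval $J\subseteq I$, is $L^1$-integrable along any line $\ell_{\phi,b}$, $b\ge a$, $\phi\in J$, such that $|R(z,\omega)|\le g(z)$ almost everywhere on $\ell_{\phi,b}$ for any $\omega\in\Omega$, and moreover $\lim_{b\to+\infty}\big(\sup_{\omega\in\Omega}\sup_{\phi\in J}\|R(\cdot,\omega)|_{\ell_{\phi,b}}\|_1\big)=0$. *)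

(* Defs.v *)
From HB Require Import structures.
From mathcomp Require Import all_boot all_order all_algebra.
From mathcomp Require Import complex.
From mathcomp Require Import all_classical all_reals all_analysis.
From mathcomp Require Import ring lra.

Set Implicit Arguments.
Unset Strict Implicit.
Unset Printing Implicit Defensive.

Import Order.TTheory GRing.Theory Num.Theory.
Import numFieldNormedType.Exports.
Import ComplexField.Normc.

Local Notation Re := (@complex.Re _).
Local Notation Im := (@complex.Im _).

Local Open Scope classical_set_scope.
Local Open Scope ring_scope.

(* The complex numbers, as a numFieldType, so that MathComp-Analysis equips
   them, and the matrices over them, with their topology and norm. *)
Definition Cx (R : realType) : numFieldType := R[i].

(* K = Cx R gives holomorphy: in finite dimension, complex (Frechet)
   differentiability at each point of an open set.  If A is not open, this is
   holomorphy on some open neighbourhood of A. *)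
Definition holomorphic_on (K : numFieldType) (V W : normedModType K)
    (A : set V) (f : V -> W) : Prop :=
  exists U : set V, [/\ open U, A `<=` U & forall p, U p -> differentiable f p].

Definition expC (R : realType) (z : Cx R) : Cx R :=
  Complex (expR (Re z) * cos (Im z)) (expR (Re z) * sin (Im z)).

(* The universal cover of C^* is realized as exp : C -> C^*.  An element of
   [ucover R] is thus the logarithm of a point, i.e. ln |z| + i arg z, and
   holomorphy on the cover is holomorphy in this logarithmic coordinate. *)
Notation ucover R := (Cx R) (only parsing).

Section Cover.
Variable R : realType.
Implicit Types (z : ucover R) (phi a b s t : R) (I : set R).

Definition proj z : Cx R := expC z.
Definition umod z : R := expR (Re z).
Definition uarg z : R := Im z.

Definition halfplane phi a : set (ucover R) :=
  [set z | phi - pi / 2 < uarg z < phi + pi / 2 /\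
           a / cos (phi - uarg z) <= umod z].

Definition sector I a : set (ucover R) := \bigcup_(phi in I) halfplane phi a.

(* Arc-length parametrization, by s : R, of the boundary of halfplane phi b,
   in the direction of angle phi - pi/2: ell phi b s is the lift of
   e^{i phi} (b - i s); see proj_ell and range_ell below. *)
Definition ell phi b s : ucover R :=
  Complex (ln (Num.sqrt (b ^+ 2 + s ^+ 2))) (phi - atan (s / b)).

Definition dpath (gamma : R -> Cx R) (u : R) : Cx R :=
  Complex (derive1 (fun s => Re (gamma s)) u) (derive1 (fun s => Im (gamma s)) u).

Definition C_integral (D : set R) (f : R -> Cx R) : Cx R :=
  Complex (\int[lebesgue_measure]_(u in D) Re (f u))
          (\int[lebesgue_measure]_(u in D) Im (f u)).

(* The line integral of f dz along gamma from gamma s to gamma t, for s <= t;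
   z is the coordinate of C^*, whence the derivative of proj \o gamma. *)
Definition path_integral (f : ucover R -> Cx R) (gamma : R -> ucover R) s t
    : Cx R :=
  C_integral `[s, t] (fun u => f (gamma u) * dpath (proj \o gamma) u).

Definition C1_on01 (f : R -> R) : Prop :=
  (forall t, t \in `[0, 1] -> derivable f t 1) /\
  {within `[0, 1], continuous (derive1 f)}.

Definition C1_path_in (D : set (ucover R)) (z w : ucover R)
    (gamma : R -> ucover R) : Prop :=
  [/\ C1_on01 (fun t => Re (gamma t)), C1_on01 (fun t => Im (gamma t)),
      gamma 0 = z, gamma 1 = w & forall t, t \in `[0, 1] -> D (gamma t)].

(* gamma lifts to the cover the straight segment of C^* from proj z to proj w,
   with constant speed. *)
Definition segment_in (D : set (ucover R)) (z w : ucover R)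
    (gamma : R -> ucover R) : Prop :=
  [/\ {within `[0, 1], continuous gamma},
      gamma 0 = z, gamma 1 = w &
      forall t, t \in `[0, 1] -> D (gamma t) /\
        proj (gamma t) = (1 - t)%:C%C * proj z + t%:C%C * proj w].

Definition closed_itv_in I (J : set R) : Prop :=
  exists c d : R, [/\ c <= d, J = `[c, d]%classic & J `<=` I].

(* dF/dz = e^{- zeta} dF/dzeta, where zeta is the logarithmic coordinate. *)
Definition d_dz (V : normedModType (Cx R)) (F : ucover R -> V) (z : ucover R)
    : V :=
  (proj z)^-1 *: derive1 F z.

End Cover.

Section Matrices.
Variables (R : realType) (n : nat).

Definition is_mx_norm (N : 'M[Cx R]_n -> R) : Prop :=
  [/\ forall A B, N (A + B) <= N A + N B,
      forall (c : Cx R) A, N (c *: A) = normc c * N A &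
      forall A, N A = 0 -> A = 0].

(* The exponential of the diagonal matrix with diagonal v. *)
Definition exp_diag (v : 'rV[Cx R]_n) : 'M[Cx R]_n :=
  diag_mx (\row_i expC (v 0 i)).

End Matrices.

Section Conditions.
Variables (R : realType) (n m : nat).
Variables (a : R) (I : set R) (Omega : set 'rV[Cx R]_m).
Implicit Types (J : set R) (omega : 'rV[Cx R]_m).

Definition family := (ucover R * 'rV[Cx R]_m)%type -> 'M[Cx R]_n.

Definition uniform_integrability (Lam : family) : Prop :=
  exists g : 'I_n -> ucover R -> R,
    [/\ forall i z, sector I a z -> 0 <= g i z,
        forall i z w gamma, segment_in (sector I a) z w gamma ->
          lebesgue_measure.-integrable `[0, 1] (EFin \o (g i \o gamma)) &
        forall i z omega, sector I a z -> Omega omega ->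
          normc (Lam (z, omega) i i) <= g i z].

Definition L_values (Lam : family) (i j : 'I_n) J omega : set (\bar R) :=
  [set x | exists phi b s t : R, [/\ J phi, a <= b, s <= t &
     x = (Re (path_integral
            (fun z => Lam (z, omega) i i - Lam (z, omega) j j)
            (ell phi b) s t))%:E]].

Definition L_sup (Lam : family) i j J omega : \bar R :=
  ereal_sup (L_values Lam i j J omega).

Definition L_inf (Lam : family) i j J omega : \bar R :=
  ereal_inf (L_values Lam i j J omega).

Definition uniform_L_condition (Lam : family) : Prop :=
  forall (i j : 'I_n) J, closed_itv_in I J ->
    exists K1 K2 : R,
      ((ereal_sup [set L_sup Lam i j J omega | omega in Omega] <= K1%:E)%E /\
       ereal_sup [set L_inf Lam i j J omega | omega in Omega] = -oo%E) \/
      (K2%:E <= ereal_inf [set L_inf Lam i j J omega | omega in Omega])%E.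

Definition L1_norm_ell (N : 'M[Cx R]_n -> R) (Rm : family) omega phi b
    : \bar R :=
  (\int[lebesgue_measure]_s (N (Rm (ell phi b s, omega)))%:E)%E.

Definition uniform_good_decay (N : 'M[Cx R]_n -> R) (Rm : family) : Prop :=
  exists2 g : ucover R -> R, forall z, sector I a z -> 0 <= g z &
    forall J, closed_itv_in I J ->
      [/\ forall phi b, J phi -> a <= b ->
            lebesgue_measure.-integrable setT (EFin \o (g \o ell phi b)),
          forall phi b omega, J phi -> a <= b -> Omega omega ->
            {ae lebesgue_measure, forall s,
               N (Rm (ell phi b s, omega)) <= g (ell phi b s)} &
          ereal_sup [set ereal_sup [set L1_norm_ell N Rm omega phi b
                                   | phi in J] | omega in Omega]
            @[b --> +oo%R] --> 0%E].

Definition fundamental_solution (A Y : family) : Prop :=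
  holomorphic_on (sector I a `*` Omega) Y /\
  forall z omega, sector I a z -> Omega omega ->
    Y (z, omega) \in unitmx /\
    d_dz (fun z => Y (z, omega)) z = A (z, omega) *m Y (z, omega).

(* The line integral of Lam from zo to z is independent of the path in
   sector I a, which is simply connected; every C^1 path is allowed. *)
Definition has_asymptotics (N : 'M[Cx R]_n -> R) (Lam : family)
    (zo : ucover R) (Y : family) : Prop :=
  forall J, closed_itv_in I J ->
    exists2 E : family,
      (forall eps : R, 0 < eps -> exists M : R,
         forall z omega, sector J a z -> Omega omega -> M <= umod z ->
           N (E (z, omega)) <= eps) &
      forall z omega gamma, sector J a z -> Omega omega ->
        C1_path_in (sector I a) zo z gamma ->
        Y (z, omega) = (1%:M + E (z, omega)) *m
          exp_diag (\row_i path_integral (fun t => Lam (t, omega) i i)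
                                         gamma 0 1).

End Conditions.

Section EllFacts.
Variable R : realType.
Implicit Types phi b s : R.

Lemma umod_ell phi b s : 0 < b ->
  umod (ell phi b s) = Num.sqrt (b ^+ 2 + s ^+ 2).
Proof.
move=> b0; rewrite /umod /ell /= lnK// posrE sqrtr_gt0.
by rewrite ltr_wpDr ?sqr_ge0// exprn_gt0.
Qed.

Lemma cos_atan_div b s : 0 < b ->
  Num.sqrt (b ^+ 2 + s ^+ 2) * cos (atan (s / b)) = b.
Proof.
move=> b0; have bn0 : b != 0 by rewrite gt_eqF.
have -> : b ^+ 2 + s ^+ 2 = b ^+ 2 * (1 + (s / b) ^+ 2) by field.
rewrite sqrtrM ?sqr_ge0// sqrtr_sqr gtr0_norm// cos_atan mulfK//.
by rewrite gt_eqF// sqrtr_gt0 ltr_wpDr ?sqr_ge0.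
Qed.

Lemma sin_atan_div b s : 0 < b ->
  Num.sqrt (b ^+ 2 + s ^+ 2) * sin (atan (s / b)) = s.
Proof.
move=> b0; have bn0 : b != 0 by rewrite gt_eqF.
have cn0 : cos (atan (s / b)) != 0.
  by rewrite gt_eqF// cos_gt0_pihalf// atan_gtNpi2 atan_ltpi2.
have -> : sin (atan (s / b)) = s / b * cos (atan (s / b)).
  by rewrite -{2}[s / b]atanK /tan divfK.
by rewrite mulrCA cos_atan_div// divfK.
Qed.

Lemma proj_ell phi b s : 0 < b ->
  proj (ell phi b s) = expC (Complex 0 phi) * Complex b (- s).
Proof.
move=> b0; have := umod_ell phi s b0; rewrite /umod /ell /= => e.
rewrite /proj /expC /ell /= e expR0 !mul1r cosB sinB.
have Hc := cos_atan_div s b0; have Hs := sin_atan_div s b0.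
have Ere r c c' u v :
    r * c = b -> r * c' = s -> r * (u * c + v * c') = u * b - v * - s.
  by move=> <- <-; ring.
have Eim r c c' u v :
    r * c = b -> r * c' = s -> r * (v * c - u * c') = u * - s + v * b.
  by move=> <- <-; ring.
by apply/eqP; rewrite eq_complex /= (Ere _ _ _ _ _ Hc Hs)
  (Eim _ _ _ _ _ Hc Hs) !eqxx.
Qed.

Lemma range_ell phi b : 0 < b ->
  range (ell phi b) =
  [set z | phi - pi / 2 < uarg z < phi + pi / 2 /\
           umod z = b / cos (phi - uarg z)].
Proof.
move=> b0; have bn0 : b != 0 by rewrite gt_eqF.
apply/seteqP; split=> [_ [s _ <-]|z [zphi zb]] /=.
  have at1 := atan_gtNpi2 (s / b); have at2 := atan_ltpi2 (s / b).
  split; first by rewrite /uarg /=; apply/andP; split; lra.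
  rewrite umod_ell// /uarg /= subKr -{2}(cos_atan_div s b0) mulfK//.
  by rewrite gt_eqF// cos_gt0_pihalf// at1 at2.
have zI : phi - uarg z \in `](- (pi / 2)), (pi / 2)[.
  by rewrite in_itv/=; move/andP: zphi => [? ?]; apply/andP; split; lra.
have cn0 : cos (phi - uarg z) != 0.
  by rewrite gt_eqF// cos_gt0_pihalf//; move: zI; rewrite in_itv.
exists (b * tan (phi - uarg z)) => //.
have at_eq : atan (b * tan (phi - uarg z) / b) = phi - uarg z.
  by rewrite mulrAC divff// mul1r tanK.
have := cos_atan_div (b * tan (phi - uarg z)) b0; rewrite at_eq => sq.
rewrite /ell at_eq subKr.
have -> : Num.sqrt (b ^+ 2 + (b * tan (phi - uarg z)) ^+ 2) = umod z.
  by apply: (mulIf cn0); rewrite sq zb divfK.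
by rewrite /umod expRK; case: z {zphi zb zI cn0 at_eq sq}.
Qed.

End EllFacts.

(* Main.v *)
Require Import Defs.
From HB Require Import structures.
From mathcomp Require Import all_boot all_order all_algebra.
From mathcomp Require Import complex.
From mathcomp Require Import all_classical all_reals all_analysis measurable_realfun.
From mathcomp Require Import ring lra.

(** In the logarithmic coordinate zeta, z = e^zeta, the sector is convex, and the
    equation reads Y' = e^zeta (Lambda + R) Y; let L be the primitive of
    e^zeta Lambda which vanishes at the base point.  The columns y_j of the solution
    are found one by one: along a line ell, the L-condition splits the components i
    into those for which exp (L_i - L_j) is bounded forwards, and those for which it
    is bounded backwards.  On a finite piece of ell far from the origin, where the
    L^1-norm of R is small, the boundary value problem which prescribes the
    components of y e^(- L_j) to be delta_ij, at the initial or at the final point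
    accordingly, is an invertible linear system for the coordinates of y in a
    fundamental solution.  Its solution is therefore holomorphic in omega, stays
    within O(|R|_1) of delta_j, and changes little when the piece is prolonged: as
    the piece fills the line, it converges to a solution which does not depend on the
    line, because the far ends of two lines can be joined by pieces of lines far from
    the origin.  Turning the lines gives the asymptotics in the sector.  The a priori
    estimate of the boundary value problem shows that a solution y with
    y e^(- L_j) -> 0 at both ends of one line vanishes, which gives uniqueness.
    Pointwise limits of locally bounded holomorphic functions of omega are
    holomorphic by the Cauchy estimate. *)

(** On an infinite line, the usual integral equation would need improper integrals, from one end or
    the other according to the component. On a finite piece there are none, and since the problem is
    linear, existence follows from uniqueness, that is, from the a priori estimate alone; Cramer's
    rule then gives the dependence on omega. The estimate does not see the shape of the path: it
    needs a bound [K] for the exponentials and a small error, and both survive concatenation at the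
    price of factors [K]. At most three pieces are joined at a time, whence the bound
    [1 / (6 * K ^+ 2)] for the error of a single one. The L-condition may choose different
    alternatives for different closed intervals J, so the ends at which data are prescribed depend
    on J. Decay at both ends of a line does not refer to this choice; it is what identifies the
    solutions found for different J. R is small only on lines far from the origin, but these
    suffice, because a solution of the linear equation is determined by its value at one point. *)

Set Implicit Arguments.
Unset Strict Implicit.
Unset Printing Implicit Defensive.

Import Order.TTheory GRing.Theory Num.Theory.
Import numFieldNormedType.Exports.
Import ComplexField.Normc.

Local Open Scope classical_set_scope.
Local Open Scope ring_scope.

(** * Complex derivatives *)

Section ComplexDerivatives.
Variable R : realType.
Local Notation C := (Cx R).
Implicit Types (z w c d : C).

Lemma normc_ge0 z : 0 <= normc z.
Proof. by case: z => x y; exact: sqrtr_ge0. Qed.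

Lemma normcD_le z w : normc (z + w) <= normc z + normc w.
Proof. exact: (le_normcD (z : Rcomplex R) w). Qed.

Lemma normcNE z : normc (- z) = normc z.
Proof. exact: (@normcN R (z : Rcomplex R)). Qed.

Lemma normcBC z w : normc (z - w) = normc (w - z).
Proof. by rewrite -normcNE opprB. Qed.

Lemma normcB_le z w : normc (z - w) <= normc z + normc w.
Proof. by rewrite -(normcNE w); exact: normcD_le. Qed.

Lemma normc_dist_le z w v : normc (z - w) <= normc (z - v) + normc (v - w).
Proof. by rewrite -[z - w](subrKA v); exact: normcD_le. Qed.

Lemma normc_real (x : R) : normc (x%:C%C : C) = `|x|.
Proof. by rewrite /normc /= expr0n/= addr0 sqrtr_sqr. Qed.

Lemma normc_eq0 z : normc z = 0 -> z = 0.
Proof. exact: eq0_normc. Qed.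

Lemma normc_gt0 z : z != 0 -> 0 < normc z.
Proof.
move=> z0; rewrite lt_def normc_ge0 andbT.
by apply: contra z0 => /eqP/normc_eq0 ->.
Qed.

Lemma normr_Re_le z : `|complex.Re z| <= normc z.
Proof.
case: z => x y /=; rewrite -sqrtr_sqr ler_wsqrtr// lerDl; exact: sqr_ge0.
Qed.

Lemma normr_Im_le z : `|complex.Im z| <= normc z.
Proof.
case: z => x y /=; rewrite -sqrtr_sqr ler_wsqrtr// lerDr; exact: sqr_ge0.
Qed.

Lemma Re_le_normc z : complex.Re z <= normc z.
Proof. exact: le_trans (ler_norm _) (normr_Re_le _). Qed.

Lemma complexE z : z = (complex.Re z)%:C%C + 'i%C * (complex.Im z)%:C%C.
Proof. by case: z => x y; apply/eqP; rewrite eq_complex /=; apply/andP; split; apply/eqP; ring. Qed.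

Lemma normc_i : normc ('i%C : C) = 1.
Proof. by rewrite /normc /= expr0n/= add0r expr1n sqrtr1. Qed.

Lemma normc_le_ReIm z : normc z <= `|complex.Re z| + `|complex.Im z|.
Proof.
rewrite {1}(complexE z); apply: (le_trans (normcD_le _ _)).
by rewrite normcM normc_i mul1r !normc_real.
Qed.

Lemma normc_ge_sub z w : normc z - normc w <= normc (z - w).
Proof. by rewrite lerBlDr -{1}(subrK w z); exact: normcD_le. Qed.

(** Turns the estimate of a modulus into that of a real part, since complex-valued functions have no
    mean value point. *)
Lemma normc_rotation z : exists c, normc c = 1 /\ complex.Re (c * z) = normc z.
Proof.
have [->|z0] := eqVneq z 0.
  by exists 1; rewrite normc1 mulr0 normc0.
exists (conjc z / (normc z)%:C%C); have nz := normc_gt0 z0.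
have nc : normc (conjc z) = normc z by case: (z) => x y /=; rewrite sqrrN.
split; first by rewrite normcM normcV normc_real nc ger0_norm ?normc_ge0// divff ?gt_eqF.
rewrite mulrAC.
have -> : conjc z * z = ((normc z) ^+ 2)%:C%C.
  case: (z) => x y /=; rewrite sqr_sqrtr ?addr_ge0 ?sqr_ge0//.
  by apply/eqP; rewrite eq_complex /=; apply/andP; split; apply/eqP; ring.
have -> : ((normc z ^+ 2)%:C%C : C) / (normc z)%:C%C = (normc z)%:C%C.
  by rewrite rmorphXn expr2 mulfK// (inj_eq (@complexI _)) gt_eqF.
by [].
Qed.

Lemma ReB z w : complex.Re (z - w) = complex.Re z - complex.Re w.
Proof. by case: z w => [? ?] [? ?]. Qed.

Lemma ImB z w : complex.Im (z - w) = complex.Im z - complex.Im w.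
Proof. by case: z w => [? ?] [? ?]. Qed.

Lemma ReM_real (x : R) z : complex.Re (x%:C%C * z) = x * complex.Re z.
Proof. by case: z => u v /=; rewrite mul0r subr0. Qed.

Lemma ImM_real (x : R) z : complex.Im (x%:C%C * z) = x * complex.Im z.
Proof. by case: z => u v /=; rewrite mul0r addr0. Qed.

(* Differentiability of [f : X -> C] at [x], for [X] embedded in [C] by [e]:
   [e] is the identity for complex derivatives and the inclusion of the reals
   for derivatives along curves. *)
Definition gder (X : zmodType) (e : X -> C) (f : X -> C) (x : X) d : Prop :=
  forall eps : R, 0 < eps -> exists2 del : R, 0 < del &
    forall h, normc (e h) < del ->
      normc (f (x + h) - f x - e h * d) <= eps * normc (e h).

Definition cder (f : C -> C) (z d : C) : Prop := gder (fun h : C => h) f z d.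
Definition rder (f : R -> C) (t : R) d : Prop :=
  gder (fun h : R => h%:C%C : C) f t d.

Section Calculus.
Variables (X : zmodType) (e : X -> C).
Implicit Types (f g : X -> C) (x : X).

Lemma gder_cst c x : gder e (fun=> c) x 0.
Proof.
move=> eps e0; exists 1 => // h _.
by rewrite subrr mulr0 subr0 normc0 mulr_ge0 ?normc_ge0// ltW.
Qed.

Lemma gderD f g x d d' : gder e f x d -> gder e g x d' ->
  gder e (fun y => f y + g y) x (d + d').
Proof.
move=> Df Dg eps e0; have e2 : 0 < eps / 2 by rewrite divr_gt0.
have [a a0 Ha] := Df _ e2; have [b b0 Hb] := Dg _ e2.
exists (Num.min a b); first by rewrite lt_min a0.
move=> h; rewrite lt_min => /andP[ha hb].
have -> : f (x + h) + g (x + h) - (f x + g x) - e h * (d + d') =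
  (f (x + h) - f x - e h * d) + (g (x + h) - g x - e h * d') by ring.
apply: (le_trans (normcD_le _ _)); move: (Ha _ ha) (Hb _ hb).
by clear; lra.
Qed.

Lemma gderZ c f x d : gder e f x d -> gder e (fun y => c * f y) x (c * d).
Proof.
move=> Df eps e0.
have c1 : 0 < normc c + 1 by rewrite ltr_wpDl ?normc_ge0.
have [a a0 Ha] := Df (eps / (normc c + 1)) (divr_gt0 e0 c1).
exists a => // h ha.
have -> : c * f (x + h) - c * f x - e h * (c * d) =
  c * (f (x + h) - f x - e h * d) by ring.
rewrite normcM; apply: (le_trans (ler_wpM2l (normc_ge0 _) (Ha _ ha))).
rewrite mulrA ler_wpM2r ?normc_ge0// mulrA ler_pdivrMr// mulrC.
by rewrite ler_pM2l// lerDl.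
Qed.

Lemma gderN f x d : gder e f x d -> gder e (fun y => - f y) x (- d).
Proof.
move=> /(gderZ (-1)); rewrite mulN1r.
by under eq_fun do rewrite mulN1r.
Qed.

Lemma gderB f g x d d' : gder e f x d -> gder e g x d' ->
  gder e (fun y => f y - g y) x (d - d').
Proof. by move=> Df Dg; exact: (gderD Df (gderN Dg)). Qed.

Lemma gder_sum (I : Type) (r : seq I) (f : I -> X -> C) x (d : I -> C) :
  (forall i, gder e (f i) x (d i)) ->
  gder e (fun y => \sum_(i <- r) f i y) x (\sum_(i <- r) d i).
Proof.
move=> H; elim: r => [|i r IH].
  rewrite big_nil; under eq_fun do rewrite big_nil.
  exact: gder_cst.
rewrite big_cons; under eq_fun do rewrite big_cons.
exact: (gderD (H i) IH).
Qed.

Lemma gder_lip f x d : gder e f x d -> exists2 del : R, 0 < del &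
  forall h, normc (e h) < del ->
    normc (f (x + h) - f x) <= (normc d + 1) * normc (e h).
Proof.
move=> /(_ 1 ltr01)[a a0 Ha]; exists a => // h /Ha.
have := normc_ge_sub (f (x + h) - f x) (e h * d).
by rewrite normcM mulrDl mul1r mulrC; clear; lra.
Qed.

Lemma gder_comp (f : C -> C) (g : X -> C) x d d' :
  cder f (g x) d -> gder e g x d' -> gder e (fun y => f (g y)) x (d' * d).
Proof.
move=> Df Dg eps e0; have [a1 a10 Hlip] := gder_lip Dg.
have d1 : 0 < normc d' + 1 by rewrite ltr_wpDl ?normc_ge0.
have d2 : 0 < normc d + 1 by rewrite ltr_wpDl ?normc_ge0.
have e2 : 0 < eps / 2 by rewrite divr_gt0.
have [a2 a20 Hf] := Df _ (divr_gt0 e2 d1).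
have [a3 a30 Hg] := Dg _ (divr_gt0 e2 d2).
exists (Num.min a1 (Num.min (a2 / (normc d' + 1)) a3)).
  by rewrite !lt_min a10 a30 divr_gt0.
move=> h; rewrite !lt_min => /and3P[h1 h2 h3].
have L := Hlip _ h1; set k := g (x + h) - g x in L.
have k2 : normc k < a2.
  by apply: (le_lt_trans L); rewrite mulrC -ltr_pdivlMr.
have := Hf _ k2; rewrite {1}/k [g x + _]addrC subrK => F.
have G := Hg _ h3; rewrite -/k in G.
have -> : f (g (x + h)) - f (g x) - e h * (d' * d) =
  (f (g (x + h)) - f (g x) - k * d) + (k - e h * d') * d by ring.
apply: (le_trans (normcD_le _ _)); rewrite normcM.
have F' : normc (f (g (x + h)) - f (g x) - k * d) <= eps / 2 * normc (e h).
  apply: (le_trans F); rewrite mulrAC ler_pdivrMr// -[leRHS]mulrA.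
  by rewrite ler_wpM2l ?(ltW e2)// mulrC.
have G' : normc (k - e h * d') * normc d <= eps / 2 * normc (e h).
  apply: (@le_trans _ _ (normc (k - e h * d') * (normc d + 1))).
    by rewrite ler_wpM2l ?normc_ge0// lerDl.
  by rewrite -ler_pdivlMr// mulrAC.
by move: F' G'; clear; lra.
Qed.

Lemma gderM f g x d d' : gder e f x d -> gder e g x d' ->
  gder e (fun y => f y * g y) x (d * g x + f x * d').
Proof.
move=> Df Dg eps e0.
have A1 : 0 < normc d + 1 by rewrite ltr_wpDl ?normc_ge0.
have A2 : 0 < normc d' + 1 by rewrite ltr_wpDl ?normc_ge0.
have A3 : 0 < normc (f x) + 1 by rewrite ltr_wpDl ?normc_ge0.
have A4 : 0 < normc (g x) + 1 by rewrite ltr_wpDl ?normc_ge0.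
have e3 : 0 < eps / 3 by rewrite divr_gt0.
have [a1 a10 L1] := gder_lip Df; have [a2 a20 L2] := gder_lip Dg.
have [a3 a30 H1] := Df _ (divr_gt0 e3 A4).
have [a4 a40 H2] := Dg _ (divr_gt0 e3 A3).
have e4 := divr_gt0 e3 (mulr_gt0 A1 A2).
exists (Num.min (Num.min a1 a2) (Num.min (Num.min a3 a4)
   (eps / 3 / ((normc d + 1) * (normc d' + 1))))).
  by rewrite !lt_min a10 a20 a30 a40 e4.
move=> h; rewrite !lt_min => /andP[/andP[h1 h2] /andP[/andP[h3 h4] h5]].
have := L1 _ h1; have := L2 _ h2; have := H1 _ h3; have := H2 _ h4.
move=> K4 K3 K2 K1.
have -> : f (x + h) * g (x + h) - f x * g x - e h * (d * g x + f x * d') =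
  (f (x + h) - f x - e h * d) * g x + f x * (g (x + h) - g x - e h * d')
  + (f (x + h) - f x) * (g (x + h) - g x) by ring.
apply: (le_trans (normcD_le _ _)).
apply: (le_trans (lerD (normcD_le _ _) (lexx _))); rewrite !normcM.
have B1 : normc (f (x + h) - f x - e h * d) * normc (g x) <=
    eps / 3 * normc (e h).
  apply: (@le_trans _ _ (normc (f (x + h) - f x - e h * d) * (normc (g x) + 1))).
    by rewrite ler_wpM2l ?normc_ge0// lerDl.
  by rewrite -ler_pdivlMr// mulrAC.
have B2 : normc (f x) * normc (g (x + h) - g x - e h * d') <=
    eps / 3 * normc (e h).
  rewrite mulrC.
  apply: (@le_trans _ _ (normc (g (x + h) - g x - e h * d') * (normc (f x) + 1))).
    by rewrite ler_wpM2l ?normc_ge0// lerDl.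
  by rewrite -ler_pdivlMr// mulrAC.
have B3 : normc (f (x + h) - f x) * normc (g (x + h) - g x) <=
    eps / 3 * normc (e h).
  apply: (le_trans (ler_pM (normc_ge0 _) (normc_ge0 _) K1 K2)).
  rewrite mulrACA mulrA ler_wpM2r ?normc_ge0//.
  by rewrite mulrC -ler_pdivlMr ?mulr_gt0// ltW.
by move: B1 B2 B3; clear; lra.
Qed.

End Calculus.

Lemma gder_id (X : zmodType) (e : X -> C) x :
  (forall u v, e (u + v) = e u + e v) -> gder e e x 1.
Proof.
move=> eD eps e0; exists 1 => // h _.
by rewrite eD mulr1 [e x + _]addrC addrK subrr normc0 mulr_ge0 ?normc_ge0// ltW.
Qed.

Lemma cder_id z : cder id z 1.
Proof. exact: (@gder_id _ (fun h : C => h)). Qed.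

Lemma gder_eq (X : zmodType) (e : X -> C) f g x d :
  (forall y, f y = g y) -> gder e f x d -> gder e g x d.
Proof. by move=> fg; rewrite (_ : f = g)//; apply/funext. Qed.

Lemma cder_unique f z d d' : cder f z d -> cder f z d' -> d = d'.
Proof.
move=> D1 D2; apply/eqP; rewrite -subr_eq0; apply/eqP/normc_eq0/eqP.
rewrite eq_le normc_ge0 andbT; apply/ler_addgt0Pl => eps e0; rewrite addr0.
have e2 : 0 < eps / 2 by rewrite divr_gt0.
have [a a0 Ha] := D1 _ e2; have [b b0 Hb] := D2 _ e2.
pose m := Num.min a b / 2; have m0 : 0 < m by rewrite divr_gt0// lt_min a0.
pose h : C := m%:C%C.
have hm : normc h = m by rewrite normc_real gtr0_norm.
have mlt : m < Num.min a b by rewrite ltr_pdivrMr// ltr_pMr ?ltr1n// lt_min a0.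
move: (mlt); rewrite lt_min => /andP[ma mb].
have := Ha h; have := Hb h; rewrite hm => /(_ mb) E2 /(_ ma) E1.
have : normc (h * (d - d')) <= eps * m.
  have -> : h * (d - d') = (f (z + h) - f z - h * d') - (f (z + h) - f z - h * d) by ring.
  by apply: (le_trans (normcB_le _ _)); move: E1 E2; clear; lra.
by rewrite normcM hm mulrC ler_pM2r.
Qed.

Lemma is_deriveP (f : R -> R) (t d : R) : is_derive t 1 f d <->
  forall eps : R, 0 < eps -> exists2 del : R, 0 < del &
    forall h, `|h| < del -> `|f (t + h) - f t - h * d| <= eps * `|h|.
Proof.
split=> [[df <-] eps e0|H].
  move: (df); rewrite /derivable /derive.
  move=> /cvgrPdist_le/(_ _ e0).
  rewrite near_withinE => /nbhs_ballP[r /= r0 Hr]; exists r => // h hr.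
  have [->|h0] := eqVneq h 0; first by rewrite addr0 mul0r subr0 subrr normr0 mulr0.
  have := Hr h; rewrite /ball/= sub0r normrN => /(_ hr h0).
  rewrite /= -[_%R^-1 *: _]/(h^-1 * _) -[h *: 1]/(h * 1) mulr1.
  rewrite -[X in X <= _](mulfK (_ : `|h| != 0)) ?normr_eq0// ler_pdivrMr ?normr_gt0//.
  rewrite distrC -normrM mulrBl mulrAC mulVf// mul1r [h + t]addrC.
  by rewrite [_ * h]mulrC.
suff H' : (fun h => h^-1 *: ((f \o shift t) (h *: 1) - f t)) @ 0^' --> (d : R).
  have := cvg_lim (@Rhausdorff R) H' => dE.
  by apply: DeriveDef; [exact: (cvgP _ H')|exact: dE].
apply/cvgrPdist_le => eps e0; have [r r0 Hr] := H _ e0.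
rewrite near_withinE; apply/nbhs_ballP; exists r => //= h; rewrite /ball/= sub0r normrN => hr h0.
rewrite -[_%R^-1 *: _]/(h^-1 * _) -[h *: 1]/(h * 1) mulr1.
rewrite -(ler_pM2r (_ : 0 < `|h|)) ?normr_gt0//.
rewrite distrC -normrM mulrBl mulrAC mulVf// mul1r [h + t]addrC [d * _]mulrC.
exact: Hr.
Qed.

Lemma rder_ReIm (g : R -> C) (t : R) d : rder g t d ->
  is_derive t 1 (fun s => complex.Re (g s)) (complex.Re d) /\
  is_derive t 1 (fun s => complex.Im (g s)) (complex.Im d).
Proof.
move=> Dg; split; apply/is_deriveP => eps /Dg[a a0 Ha]; exists a => // h ha.
  have := Ha h; rewrite normc_real => /(_ ha); apply: le_trans.
  by rewrite -ReM_real -!ReB normr_Re_le.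
have := Ha h; rewrite normc_real => /(_ ha); apply: le_trans.
by rewrite -ImM_real -!ImB normr_Im_le.
Qed.

Lemma ReIm_rder (g : R -> C) (t u v : R) :
  is_derive t 1 (fun s => complex.Re (g s)) u ->
  is_derive t 1 (fun s => complex.Im (g s)) v -> rder g t (Complex u v).
Proof.
move=> /is_deriveP Du /is_deriveP Dv eps e0.
have e2 : 0 < eps / 2 by rewrite divr_gt0.
have [a a0 Ha] := Du _ e2; have [b b0 Hb] := Dv _ e2.
exists (Num.min a b); first by rewrite lt_min a0.
move=> h; rewrite normc_real lt_min => /andP[/Ha ha /Hb hb].
apply: (le_trans (normc_le_ReIm _)).
by rewrite !ReB !ImB ReM_real ImM_real /=; move: ha hb; clear; lra.
Qed.

Lemma le_derive1 (f df : R -> R) (a b : R) : a <= b ->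
  (forall t, a <= t <= b -> is_derive t 1 f (df t)) ->
  (forall t, a <= t <= b -> 0 <= df t) -> f a <= f b.
Proof.
move=> ab Df df0.
have D t : t \in `[a, b] -> derivable f t 1 /\ derive1 f t = df t.
  rewrite in_itv/= => /Df[d <-]; split=> //; exact: derive1E.
apply: (@ger0_derive1_le_cc _ f a b); rewrite ?bound_itvE//.
- by move=> x /subset_itv_oo_cc /D[].
- move=> x /subset_itv_oo_cc xab; have [_ ->] := D _ xab.
  by apply: df0; move: xab; rewrite in_itv.
- by apply: derivable_within_continuous => x /D[].
Qed.

(** Once the increment of [g] is rotated onto the positive reals by [c], the function
    [B - Re (c * g)] is nondecreasing. The varying bound [dB] leaves room for an exponential weight,
    or for a primitive of a bound, as [B]. *)
Lemma rder_mean_value (g dg : R -> C) (B dB : R -> R) (a b : R) : a <= b ->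
  (forall t, a <= t <= b -> rder g t (dg t)) ->
  (forall t, a <= t <= b -> is_derive t 1 B (dB t)) ->
  (forall t, a <= t <= b -> normc (dg t) <= dB t) ->
  normc (g b - g a) <= B b - B a.
Proof.
move=> ab Dg DB dgB; have [c [c1 <-]] := normc_rotation (g b - g a).
rewrite mulrBr ReB.
have := @le_derive1 (fun t => B t - complex.Re (c * g t))
  (fun t => dB t - complex.Re (c * dg t)) a b ab.
move=> /(_ _ _)/wrap[t tab|t tab|].
- have [H _] := rder_ReIm (gderZ c (Dg _ tab)).
  exact: (is_deriveB (DB _ tab) H).
- rewrite subr_ge0; apply: le_trans (dgB _ tab).
  by apply: (le_trans (Re_le_normc _)); rewrite normcM c1 mul1r.
- by clear; lra.
Qed.

Lemma rder_mean_value_cst (g dg : R -> C) (M a b : R) : a <= b ->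
  (forall t, a <= t <= b -> rder g t (dg t)) ->
  (forall t, a <= t <= b -> normc (dg t) <= M) ->
  normc (g b - g a) <= M * (b - a).
Proof.
move=> ab Dg dgM; rewrite mulrBr.
apply: (@rder_mean_value g dg (fun t => M * t) (fun=> M)) => // t _.
have -> : (fun t => M * t) = M *: (id : R -> R) by [].
by apply: is_derive_eq; rewrite -[_ *: _]/(M * 1) mulr1.
Qed.

Lemma rder_zero_cst (g : R -> C) (a b : R) : a <= b ->
  (forall t, a <= t <= b -> rder g t 0) -> g b = g a.
Proof.
move=> ab Dg; apply/eqP; rewrite -subr_eq0; apply/eqP/normc_eq0/eqP.
rewrite eq_le normc_ge0 andbT -(mul0r (b - a)).
by apply: (rder_mean_value_cst ab Dg) => t _; rewrite normc0.
Qed.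

Lemma rder_line (p c : C) (t : R) : rder (fun s => p + s%:C%C * c) t c.
Proof.
have I : gder (fun h : R => h%:C%C : C) (fun h => h%:C%C) t 1.
  by apply: gder_id => u v; rewrite rmorphD.
have := gderD (gder_cst (fun h : R => h%:C%C : C) p t) (gderZ c I).
by rewrite add0r mulr1; apply: gder_eq => y; rewrite mulrC.
Qed.

Lemma rder_cder_line (f : C -> C) (p c d : C) (t : R) :
  cder f (p + t%:C%C * c) d -> rder (fun s => f (p + s%:C%C * c)) t (c * d).
Proof. by move=> Df; exact: (@gder_comp _ _ f (fun s => p + s%:C%C * c) _ _ _ Df (rder_line p c t)). Qed.

Lemma cder_segment (f : C -> C) (df : C -> C) (p q : C) (M : R) :
  (forall t : R, 0 <= t <= 1 -> cder f (p + t%:C%C * (q - p)) (df (p + t%:C%C * (q - p)))) ->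
  (forall t : R, 0 <= t <= 1 -> normc (df (p + t%:C%C * (q - p))) <= M) ->
  normc (f q - f p) <= M * normc (q - p).
Proof.
move=> Df dM.
have := @rder_mean_value_cst (fun s => f (p + s%:C%C * (q - p)))
  (fun s => (q - p) * df (p + s%:C%C * (q - p))) (M * normc (q - p)) 0 1 ler01.
rewrite subr0 mulr1 rmorph1 rmorph0 mul1r mul0r addr0 [p + _]addrC subrK.
apply=> t t01; first exact: (rder_cder_line (Df _ t01)).
by rewrite normcM mulrC ler_wpM2r ?normc_ge0// dM.
Qed.

End ComplexDerivatives.

(** * Integrals along curves, Goursat's lemma and the Cauchy estimate *)

Section CurveIntegrals.
Variable R : realType.
Local Notation C := (Cx R).

Definition rcont (g : R -> C) (t : R) : Prop :=
  forall eps : R, 0 < eps -> exists2 del : R, 0 < del &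
    forall s, `|s - t| < del -> normc (g s - g t) <= eps.

Definition cont_on (g : R -> C) (a b : R) : Prop :=
  forall t, a <= t <= b -> rcont g t.

Lemma rcont_cst c t : rcont (fun=> c) t.
Proof. by move=> e e0; exists 1 => // s _; rewrite subrr normc0 ltW. Qed.

Lemma rder_rcont g t d : rder g t d -> rcont g t.
Proof.
move=> /gder_lip[a a0 Ha] e e0.
have d1 : 0 < normc d + 1 by rewrite ltr_wpDl ?normc_ge0.
exists (Num.min a (e / (normc d + 1))); first by rewrite lt_min a0 divr_gt0.
move=> s; rewrite lt_min => /andP[sa se].
have := Ha (s - t); rewrite normc_real [t + _]addrC subrK => /(_ sa).
by move/le_trans; apply; rewrite mulrC -ler_pdivlMr// ltW.
Qed.

Lemma rcontD f g t : rcont f t -> rcont g t -> rcont (fun s => f s + g s) t.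
Proof.
move=> Cf Cg e e0; have e2 : 0 < e / 2 by rewrite divr_gt0.
have [a a0 Ha] := Cf _ e2; have [b b0 Hb] := Cg _ e2.
exists (Num.min a b); first by rewrite lt_min a0.
move=> s; rewrite lt_min => /andP[/Ha h1 /Hb h2].
have -> : f s + g s - (f t + g t) = (f s - f t) + (g s - g t) by ring.
by apply: (le_trans (normcD_le _ _)); move: h1 h2; clear; lra.
Qed.

Lemma rcontM f g t : rcont f t -> rcont g t -> rcont (fun s => f s * g s) t.
Proof.
move=> Cf Cg e e0; have e3 : 0 < e / 3 by rewrite divr_gt0.
have A1 : 0 < normc (f t) + 1 by rewrite ltr_wpDl ?normc_ge0.
have A2 : 0 < normc (g t) + 1 by rewrite ltr_wpDl ?normc_ge0.
have [a a0 Ha] := Cf _ (divr_gt0 e3 A2).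
have [b b0 Hb] := Cg _ (divr_gt0 e3 A1).
have [c c0 Hc] := Cf _ (@ltr01 R).
exists (Num.min a (Num.min b c)); first by rewrite !lt_min a0 b0.
move=> s; rewrite !lt_min => /and3P[/Ha h1 /Hb h2 /Hc h3].
have -> : f s * g s - f t * g t =
  (f s - f t) * g t + (f s - f t + f t) * (g s - g t) by ring.
apply: (le_trans (normcD_le _ _)); rewrite !normcM.
have B1 : normc (f s - f t) * normc (g t) <= e / 3.
  apply: (@le_trans _ _ (normc (f s - f t) * (normc (g t) + 1))).
    by rewrite ler_wpM2l ?normc_ge0// lerDl.
  by rewrite -ler_pdivlMr.
have B2 : normc (f s - f t + f t) * normc (g s - g t) <= e / 3.
  rewrite mulrC; apply: (@le_trans _ _ (normc (g s - g t) * (normc (f t) + 1))).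
    rewrite ler_wpM2l ?normc_ge0//.
    by apply: (le_trans (normcD_le _ _)); rewrite addrC lerD2l.
  by rewrite -ler_pdivlMr.
by move: B1 B2 e0; clear; lra.
Qed.

Lemma rcontN f t : rcont f t -> rcont (fun s => - f s) t.
Proof.
by move=> Cf e /Cf[a a0 Ha]; exists a => // s /Ha; rewrite -opprD normcNE.
Qed.

Lemma rcontB f g t : rcont f t -> rcont g t -> rcont (fun s => f s - g s) t.
Proof. by move=> Cf Cg; exact: (rcontD Cf (rcontN Cg)). Qed.

Lemma rcont_comp (f : R -> C) (u : R -> R) t (K : R) : 0 < K ->
  (forall s, `|u s - u t| <= K * `|s - t|) -> rcont f (u t) ->
  rcont (fun s => f (u s)) t.
Proof.
move=> K0 Ku Cf e /Cf[a a0 Ha]; exists (a / K); first by rewrite divr_gt0.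
by move=> s sa; apply: Ha; apply: (le_lt_trans (Ku s)); rewrite mulrC -ltr_pdivlMr.
Qed.

Lemma rcont_Re g t : rcont g t -> {for t, continuous (fun s => complex.Re (g s))}.
Proof.
move=> Cg; apply/cvgrPdist_le => e /Cg[a a0 Ha]; apply/nbhs_ballP.
exists a => //= s; rewrite /ball/= distrC => /Ha; apply: le_trans.
by rewrite distrC -ReB normr_Re_le.
Qed.

Lemma rcont_Im g t : rcont g t -> {for t, continuous (fun s => complex.Im (g s))}.
Proof.
move=> Cg; apply/cvgrPdist_le => e /Cg[a a0 Ha]; apply/nbhs_ballP.
exists a => //= s; rewrite /ball/= distrC => /Ha; apply: le_trans.
by rewrite distrC -ImB normr_Im_le.
Qed.

Lemma ex_primitive_real (f : R -> R) (a b : R) : continuous f -> a <= b ->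
  exists F : R -> R, forall t, a <= t <= b -> is_derive t 1 F (f t).
Proof.
(* The integral starts at [a - 1] and is considered up to [b + 1], so that it has two-sided
   derivatives at [a] and [b] too. *)
move=> cf ab; pose lo := a - 1; pose hi := b + 1.
pose F t := \int[lebesgue_measure]_(u in `[lo, t]) f u.
exists F => t /andP[at_ tb].
have thi : t < hi by rewrite (le_lt_trans tb)// ltrDl.
have lot : lo < t by rewrite (lt_le_trans _ at_)// ltrBlDr ltrDl.
have := @continuous_FTC1 R f (BLeft lo) t hi thi _ _ (cf t).
case.
- apply: continuous_compact_integrable; first exact: segment_compact.
  exact: continuous_subspaceT.
- by rewrite lte_fin.
- rewrite -/F derive1E => d e.
  exact: (@DeriveDef _ _ _ _ _ F (f t) d e).
Qed.

(** Precomposition with [clamp a b] extends a function that is continuous at the points of [a, b] to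
    a continuous function on the line, without changing it on [a, b]. *)
Definition clamp (a b t : R) : R := Num.min b (Num.max a t).

Lemma clamp_in (a b t : R) : a <= t <= b -> clamp a b t = t.
Proof. by case/andP=> ? ?; rewrite /clamp max_r// min_r. Qed.

Lemma clamp_itv (a b t : R) : a <= b -> a <= clamp a b t <= b.
Proof. by move=> ab; rewrite /clamp le_min ab ge_min lexx le_max lexx. Qed.

Lemma max_lip (a s t : R) : `|Num.max a s - Num.max a t| <= `|s - t|.
Proof.
case: (leP a s) => h1; case: (leP a t) => h2; rewrite ?subrr ?normr0 ?normr_ge0//;
have := ler_norm (t - s); have := ler_norm (s - t); rewrite (distrC t);
by move=> h3 h4; rewrite ler_norml; apply/andP; split; lra.
Qed.

Lemma min_lip (b s t : R) : `|Num.min b s - Num.min b t| <= `|s - t|.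
Proof.
case: (leP b s) => h1; case: (leP b t) => h2; rewrite ?subrr ?normr0 ?normr_ge0//;
have := ler_norm (t - s); have := ler_norm (s - t); rewrite (distrC t);
by move=> h3 h4; rewrite ler_norml; apply/andP; split; lra.
Qed.

Lemma clamp_lip (a b s t : R) : `|clamp a b s - clamp a b t| <= 1 * `|s - t|.
Proof.
rewrite mul1r /clamp; apply: (le_trans (min_lip _ _ _)); exact: max_lip.
Qed.

Lemma ex_primitive (g : R -> C) (a b : R) : a <= b -> cont_on g a b ->
  exists G : R -> C, forall t, a <= t <= b -> rder G t (g t).
Proof.
move=> ab cg.
have cg' t : rcont (fun s => g (clamp a b s)) t.
  apply: (@rcont_comp g (clamp a b) t 1) => //; first by move=> s; exact: clamp_lip.
  by apply: cg; exact: clamp_itv.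
have [F HF] := ex_primitive_real (fun t => rcont_Re (cg' t)) ab.
have [H HH] := ex_primitive_real (fun t => rcont_Im (cg' t)) ab.
exists (fun t => Complex (F t) (H t)) => t tab.
have := ReIm_rder (HF _ tab : is_derive t 1 (fun s => complex.Re (Complex (F s) (H s))) _) (HH _ tab).
by rewrite clamp_in//; case: (g t).
Qed.

(** Defined through a chosen primitive and not by measure theory: estimates then come from the mean
    value inequality. The value is 0 if there is no primitive. *)
Definition cint (g : R -> C) (a b : R) : C :=
  let G := xget (fun=> 0) [set G : R -> C | forall t, a <= t <= b -> rder G t (g t)] in
  G b - G a.

Lemma cintE g G a b : a <= b -> (forall t, a <= t <= b -> rder G t (g t)) ->
  cint g a b = G b - G a.
Proof.
move=> ab HG; rewrite /cint; set H := xget _ _.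
have HH : forall t, a <= t <= b -> rder H t (g t).
  exact: (@xgetPex _ (fun=> 0) [set G : R -> C | forall t, a <= t <= b -> rder G t (g t)]
    (ex_intro _ G HG)).
have := @rder_zero_cst _ (fun t => H t - G t) a b ab.
move=> /(_ _)/wrap[t tab|].
  by rewrite -(subrr (g t)); exact: gderB (HH _ tab) (HG _ tab).
move=> /eqP; rewrite subr_eq => /eqP ->.
by ring.
Qed.

Lemma cintP g a b : a <= b -> cont_on g a b -> exists G,
  (forall t, a <= t <= b -> rder G t (g t)) /\ cint g a b = G b - G a.
Proof.
by move=> ab /(ex_primitive ab)[G HG]; exists G; split=> //; exact: cintE.
Qed.

(** Meant for an affine or constant [h], whose primitive [H] is explicit. *)
Lemma cint_approx g H h a b (eta : R) : a <= b -> cont_on g a b ->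
  (forall t, a <= t <= b -> rder H t (h t)) ->
  (forall t, a <= t <= b -> normc (g t - h t) <= eta) ->
  normc (cint g a b - (H b - H a)) <= eta * (b - a).
Proof.
move=> ab cg HH gh; have [G [HG ->]] := cintP ab cg.
have -> : G b - G a - (H b - H a) = (G b - H b) - (G a - H a) by ring.
apply: (@rder_mean_value_cst _ (fun t => G t - H t) (fun t => g t - h t)) => // t tab.
exact: gderB (HG _ tab) (HH _ tab).
Qed.

Lemma cint_bound g a b (M : R) : a <= b -> cont_on g a b ->
  (forall t, a <= t <= b -> normc (g t) <= M) ->
  normc (cint g a b) <= M * (b - a).
Proof.
move=> ab cg gM; rewrite -[cint _ _ _]subr0 -(subrr 0).
apply: (@cint_approx g (fun=> 0) (fun=> 0)) => // t tab; first exact: gder_cst.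
by rewrite subr0 gM.
Qed.

Lemma cint_split g a b c : a <= b -> b <= c -> cont_on g a c ->
  cint g a c = cint g a b + cint g b c.
Proof.
move=> ab bc cg; have [G [HG ->]] := cintP (le_trans ab bc) cg.
rewrite (@cintE _ G a b)// ?(@cintE _ G b c)//; first ring.
- by move=> t /andP[h1 h2]; apply: HG; rewrite (le_trans ab)//.
- by move=> t /andP[h1 h2]; apply: HG; rewrite h1 (le_trans h2).
Qed.

Lemma cintD f g a b : a <= b -> cont_on f a b -> cont_on g a b ->
  cint (fun t => f t + g t) a b = cint f a b + cint g a b.
Proof.
move=> ab cf cg; have [F [HF ->]] := cintP ab cf.
have [G [HG ->]] := cintP ab cg.
rewrite (@cintE _ (fun t => F t + G t))//; first ring.
by move=> t tab; exact: gderD (HF _ tab) (HG _ tab).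
Qed.

Lemma cintZ c g a b : a <= b -> cont_on g a b ->
  cint (fun t => c * g t) a b = c * cint g a b.
Proof.
move=> ab cg; have [G [HG ->]] := cintP ab cg.
rewrite (@cintE _ (fun t => c * G t))//; first ring.
by move=> t tab; exact: gderZ (HG _ tab).
Qed.

Lemma cintB f g a b : a <= b -> cont_on f a b -> cont_on g a b ->
  cint (fun t => f t - g t) a b = cint f a b - cint g a b.
Proof.
move=> ab cf cg; have [F [HF ->]] := cintP ab cf.
have [G [HG ->]] := cintP ab cg.
rewrite (@cintE _ (fun t => F t - G t))//; first ring.
by move=> t tab; exact: gderB (HF _ tab) (HG _ tab).
Qed.

End CurveIntegrals.

Section Goursat.
Variable R : realType.
Local Notation C := (Cx R).

Lemma pow2_small (x e : R) : 0 <= x -> 0 < e ->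
  exists k, forall l, (k <= l)%N -> x / 2 ^+ l < e.
Proof.
move=> x0 e0; have := archi_boundP (divr_ge0 x0 (ltW e0)).
set k := Num.bound _ => xk; exists k => l kl.
have P0 : 0 < 2 ^+ l :> R by rewrite exprn_gt0.
rewrite ltr_pdivrMr// mulrC -ltr_pdivrMr//; apply: (lt_le_trans xk).
by rewrite -natrX ler_nat (leq_trans kl)// ltnW// ltn_expl.
Qed.

Lemma rder_horizontal (y t : R) : rder (fun s => Complex s y : C) t 1.
Proof.
have := @rder_line R (Complex 0 y) 1 t; apply: gder_eq => s.
by rewrite mulr1; apply/eqP; rewrite eq_complex /= add0r addr0 !eqxx.
Qed.

Lemma rder_vertical (x t : R) : rder (fun s => Complex x s : C) t 'i%C.
Proof.
have := @rder_line R (Complex x 0) 'i%C t; apply: gder_eq => s.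
by apply/eqP; rewrite eq_complex /=; apply/andP; split; apply/eqP; ring.
Qed.

Lemma cder_rcont_comp (f : C -> C) (g : R -> C) (t : R) d d' :
  cder f (g t) d -> rder g t d' -> rcont (fun s => f (g s)) t.
Proof. by move=> Df Dg; exact: (rder_rcont (gder_comp Df Dg)). Qed.

(** The integral of f dz along the boundary of the rectangle, counterclockwise from the bottom
    side. *)
Definition bd (f : C -> C) (x1 x2 y1 y2 : R) : C :=
  cint (fun s => f (Complex s y1)) x1 x2 - cint (fun s => f (Complex s y2)) x1 x2
  + 'i%C * (cint (fun s => f (Complex x2 s)) y1 y2 - cint (fun s => f (Complex x1 s)) y1 y2).

Definition cder_on_rect (f : C -> C) (x1 x2 y1 y2 : R) : Prop :=
  forall x y, x1 <= x <= x2 -> y1 <= y <= y2 -> exists d, cder f (Complex x y) d.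

Lemma cder_on_rect_sub f x1 x2 y1 y2 x1' x2' y1' y2' :
  x1 <= x1' -> x2' <= x2 -> y1 <= y1' -> y2' <= y2 ->
  cder_on_rect f x1 x2 y1 y2 -> cder_on_rect f x1' x2' y1' y2'.
Proof.
move=> h1 h2 h3 h4 H x y /andP[h5 h6] /andP[h7 h8]; apply: H; apply/andP; split.
- exact: le_trans h1 h5.
- exact: le_trans h6 h2.
- exact: le_trans h3 h7.
- exact: le_trans h8 h4.
Qed.

Lemma cont_on_hor f x1 x2 y1 y2 y : cder_on_rect f x1 x2 y1 y2 ->
  y1 <= y <= y2 -> cont_on (fun s => f (Complex s y)) x1 x2.
Proof.
move=> H yy t tt; have [d D] := H _ _ tt yy.
exact: (cder_rcont_comp (g := fun s => Complex s y) D (rder_horizontal _ _)).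
Qed.

Lemma cont_on_ver f x1 x2 y1 y2 x : cder_on_rect f x1 x2 y1 y2 ->
  x1 <= x <= x2 -> cont_on (fun s => f (Complex x s)) y1 y2.
Proof.
move=> H xx t tt; have [d D] := H _ _ xx tt.
exact: (cder_rcont_comp (g := fun s => Complex x s) D (rder_vertical _ _)).
Qed.

Lemma bd_quad f x1 x2 y1 y2 x y : x1 <= x <= x2 -> y1 <= y <= y2 ->
  cder_on_rect f x1 x2 y1 y2 ->
  bd f x1 x2 y1 y2 = bd f x1 x y1 y + bd f x x2 y1 y + bd f x1 x y y2 + bd f x x2 y y2.
Proof.
move=> /[dup] xx /andP[hx1 hx2] /[dup] yy /andP[hy1 hy2] H.
have y12 := le_trans hy1 hy2; have x12 := le_trans hx1 hx2.
rewrite /bd !(@cint_split _ (fun s => f (Complex s _)) x1 x x2)//;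
  [|apply: (cont_on_hor H); rewrite ?lexx ?y12//..].
rewrite !(@cint_split _ (fun s => f (Complex _ s)) y1 y y2)//;
  [|apply: (cont_on_ver H); rewrite ?lexx ?x12//..].
ring.
Qed.

(** The affine part [A] of [f] at the point has a polynomial primitive [P], so it contributes
    nothing; the remainder is at most [eps * L] on the boundary, where [L] is the half-perimeter. *)
Lemma bd_local f (x y : R) d : cder f (Complex x y) d -> forall eps : R, 0 < eps ->
  exists2 del : R, 0 < del & forall x1 x2 y1 y2, x1 <= x <= x2 -> y1 <= y <= y2 ->
    (x2 - x1) + (y2 - y1) < del -> cder_on_rect f x1 x2 y1 y2 ->
    normc (bd f x1 x2 y1 y2) <= eps * 2 * ((x2 - x1) + (y2 - y1)) ^+ 2.
Proof.
move=> Df eps e0; have [a a0 Ha] := Df _ e0; exists a => // x1 x2 y1 y2.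
move=> /[dup] xx /andP[hx1 hx2] /[dup] yy /andP[hy1 hy2].
set L := _ + _ => La H.
have x12 := le_trans hx1 hx2; have y12 := le_trans hy1 hy2.
have L0 : 0 <= L by rewrite addr_ge0 // subr_ge0.
set p := Complex x y : C.
pose A (z : C) := f p + (z - p) * d.
have fA u v : x1 <= u <= x2 -> y1 <= v <= y2 ->
    normc (f (Complex u v) - A (Complex u v)) <= eps * L.
  move=> /andP[u1 u2] /andP[v1 v2].
  have hL : normc (Complex u v - p : C) <= L.
    apply: (le_trans (normc_le_ReIm _)); rewrite /= /L.
    have B1 : `|u - x| <= x2 - x1 by rewrite ler_norml; apply/andP; split; lra.
    have B2 : `|v - y| <= y2 - y1 by rewrite ler_norml; apply/andP; split; lra.
    exact: lerD.
  have := Ha (Complex u v - p) (le_lt_trans hL La).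
  rewrite -/p [p + _]addrC subrK => /le_trans; rewrite /A opprD addrA; apply.
  by rewrite ler_wpM2l// ltW.
have pA (z0 : C) : cder (fun w => f p * w + (d * 2^-1) * ((w - p) * (w - p))) z0 (A z0).
  have W := gderB (cder_id z0) (gder_cst (fun h : C => h) p z0).
  have := gderD (gderZ (f p) (cder_id z0)) (gderZ (d * 2^-1) (gderM W W)).
  rewrite /A => /(gder_eq _); move=> /(_ _ (fun=> erefl)).
  suff -> : f p * 1 + d * 2^-1 * ((1 - 0) * (id z0 - p) + (id z0 - p) * (1 - 0)) =
    f p + (z0 - p) * d by [].
  by rewrite /=; field.
pose P w := f p * w + (d * 2^-1) * ((w - p) * (w - p)).
have HH v u : rder (fun s => P (Complex s v)) u (1 * A (Complex u v)).
  exact: (gder_comp (pA (Complex u v)) (rder_horizontal v u)).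
have HV u v : rder (fun s => P (Complex u s)) v ('i%C * A (Complex u v)).
  exact: (gder_comp (pA (Complex u v)) (rder_vertical u v)).
have HV' u v : rder (fun s => - 'i%C * P (Complex u s)) v (A (Complex u v)).
  have := gderZ (- 'i%C) (HV u v).
  by rewrite mulrA mulNr -expr2 sqr_i opprK mul1r.
have E1 v : y1 <= v <= y2 -> normc (cint (fun s => f (Complex s v)) x1 x2 -
    (P (Complex x2 v) - P (Complex x1 v))) <= eps * L * (x2 - x1).
  move=> vv; apply: (@cint_approx R _ (fun s => P (Complex s v))
    (fun u => A (Complex u v)) x1 x2 (eps * L)) => //.
  - exact: (cont_on_hor H).
  - by move=> t _; rewrite -[A _]mul1r.
  - by move=> t tt; apply: fA.
have E2 u : x1 <= u <= x2 -> normc (cint (fun s => f (Complex u s)) y1 y2 -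
    (- 'i%C * P (Complex u y2) - - 'i%C * P (Complex u y1))) <= eps * L * (y2 - y1).
  move=> uu; apply: (@cint_approx R _ (fun s => - 'i%C * P (Complex u s))
    (fun v => A (Complex u v)) y1 y2 (eps * L)) => //.
  - exact: (cont_on_ver H).
  - by move=> t tt; apply: fA.
have y1y : y1 <= y1 <= y2 by rewrite lexx.
have y2y : y1 <= y2 <= y2 by rewrite lexx andbT.
have x1x : x1 <= x1 <= x2 by rewrite lexx.
have x2x : x1 <= x2 <= x2 by rewrite lexx andbT.
move: (E1 _ y1y) (E1 _ y2y) (E2 _ x1x) (E2 _ x2x); rewrite /bd.
set c1 := cint _ x1 x2; set c2 := cint _ x1 x2.
set c3 := cint _ y1 y2; set c4 := cint _ y1 y2.
move: (P (Complex x1 y1)) (P (Complex x1 y2)) (P (Complex x2 y1)) (P (Complex x2 y2)).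
move=> P11 P12 P21 P22 F1 F2 F3 F4.
(* The corner values of [P] cancel up to the factor [1 + 'i ^+ 2], which [ring] does not know to be
   zero. *)
have -> : c1 - c2 + 'i%C * (c4 - c3) = (c1 - (P21 - P11)) - (c2 - (P22 - P12))
   + 'i%C * ((c4 - (- 'i%C * P22 - - 'i%C * P21)) - (c3 - (- 'i%C * P12 - - 'i%C * P11)))
   + (1 + 'i%C ^+ 2) * (P21 - P22 + P12 - P11) by ring.
rewrite sqr_i subrr mul0r addr0.
apply: (le_trans (normcD_le _ _)); rewrite normcM normc_i mul1r.
apply: (le_trans (lerD (normcB_le _ _) (normcB_le _ _))).
have -> : eps * 2 * L ^+ 2 = eps * L * (x2 - x1) + eps * L * (x2 - x1)
   + (eps * L * (y2 - y1) + eps * L * (y2 - y1)) by rewrite /L; ring.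
by move: F1 F2 F3 F4; clear; lra.
Qed.

Lemma nested_intervals (u : nat -> R) (w : nat -> R) :
  (forall k, 0 <= w k) ->
  (forall k, u k <= u k.+1 /\ u k.+1 + w k.+1 <= u k + w k) ->
  exists p, forall k, u k <= p <= u k + w k.
Proof.
move=> w0 H.
have M k l : (k <= l)%N -> u k <= u l /\ u l + w l <= u k + w k.
  elim: l => [|l IH]; first by rewrite leqn0 => /eqP ->.
  rewrite leq_eqVlt => /orP[/eqP ->//|]; rewrite ltnS => /IH[h1 h2].
  by have [h3 h4] := H l; split; [exact: le_trans h3|exact: le_trans h2].
have B k l : u k <= u l + w l.
  case: (leqP k l) => [/M[h _]|/ltnW/M[_ h]].
    by apply: (le_trans h); rewrite lerDl.
  by apply: le_trans h; rewrite lerDl.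
exists (sup (range u)) => k; apply/andP; split.
  apply: ub_le_sup; last by exists k.
  by exists (u 0%N + w 0%N) => _ [l _ <-].
by apply: ge_sup; [exists (u 0%N); exists 0%N|move=> _ [l _ <-]].
Qed.

(* Quadrisection; the bound is of the form [eps * (w + h) ^+ 2] because the
   squared half-perimeters of the four quarters add up to that of the whole. *)
Theorem goursat f x1 x2 y1 y2 : x1 <= x2 -> y1 <= y2 ->
  cder_on_rect f x1 x2 y1 y2 -> bd f x1 x2 y1 y2 = 0.
Proof.
move=> x12 y12 H; apply/normc_eq0/eqP; rewrite eq_le normc_ge0 andbT.
set w := x2 - x1; set h := y2 - y1.
have w0 : 0 <= w by rewrite subr_ge0.
have h0 : 0 <= h by rewrite subr_ge0.
apply/ler_addgt0Pl => eps' e'0; rewrite addr0.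
have wh1 : 0 < (w + h) ^+ 2 * 2 + 1 by rewrite ltr_wpDl// mulr_ge0// sqr_ge0.
(* Chosen so that [eps * 2 * (w + h) ^+ 2 <= eps']: the initial rectangle is then bad if its
   integral exceeds [eps']. *)
pose eps := eps' / ((w + h) ^+ 2 * 2 + 1); have e0 : 0 < eps by rewrite divr_gt0.
pose W k : R := w / 2 ^+ k; pose V k : R := h / 2 ^+ k.
have pow0 k : 0 < 2 ^+ k :> R by rewrite exprn_gt0.
have W0 k : 0 <= W k by rewrite divr_ge0// ltW.
have V0 k : 0 <= V k by rewrite divr_ge0// ltW.
have WS k : W k = W k.+1 + W k.+1.
  by rewrite /W exprS; have := pow0 k => /gt_eqF/negbT P0; field; rewrite P0.
have VS k : V k = V k.+1 + V k.+1.
  by rewrite /V exprS; have := pow0 k => /gt_eqF/negbT P0; field; rewrite P0.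
pose inn k (p : R * R) := [/\ x1 <= p.1, p.1 + W k <= x2, y1 <= p.2 & p.2 + V k <= y2].
(* [p] is the lower left corner of a rectangle of generation [k]; by [bd_quad], one of the quarters
   of a bad rectangle is bad. *)
pose bad k (p : R * R) := inn k p /\
  eps * 2 * (W k + V k) ^+ 2 < normc (bd f p.1 (p.1 + W k) p.2 (p.2 + V k)).
pose next k (p q : R * R) := [/\ p.1 <= q.1, q.1 + W k.+1 <= p.1 + W k, p.2 <= q.2 & q.2 + V k.+1 <= p.2 + V k].
have step k p : bad k p -> exists q, bad k.+1 q /\ next k p q.
  move=> [[i1 i2 i3 i4] big]; apply: contrapT => no.
  have G q : next k p q -> normc (bd f q.1 (q.1 + W k.+1) q.2 (q.2 + V k.+1))
     <= eps * 2 * (W k.+1 + V k.+1) ^+ 2.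
    move=> nq; rewrite leNgt; apply/negP => lt_; apply: no; exists q; split=> //.
    case: nq => n1 n2 n3 n4; split=> //; split.
    - exact: le_trans n1.
    - exact: le_trans n2 i2.
    - exact: le_trans n3.
    - exact: le_trans n4 i4.
  have W1 := W0 k.+1; have V1 := V0 k.+1.
  have := G p; have := G (p.1 + W k.+1, p.2).
  have := G (p.1, p.2 + V k.+1); have := G (p.1 + W k.+1, p.2 + V k.+1).
  rewrite /next /= (WS k) (VS k).
  move=> /(_ _)/wrap[|G4]; first by split; clear -W1 V1; lra.
  move=> /(_ _)/wrap[|G3]; first by split; clear -W1 V1; lra.
  move=> /(_ _)/wrap[|G2]; first by split; clear -W1 V1; lra.
  move=> /(_ _)/wrap[|G1]; first by split; clear -W1 V1; lra.
  move: big; apply/negP; rewrite -leNgt.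
  rewrite (WS k) (VS k) (@bd_quad f _ _ _ _ (p.1 + W k.+1) (p.2 + V k.+1)).
  - rewrite !(addrA p.1) !(addrA p.2).
    apply: (le_trans (normcD_le _ _)).
    apply: (le_trans (lerD (normcD_le _ _) (lexx _))).
    apply: (le_trans (lerD (lerD (normcD_le _ _) (lexx _)) (lexx _))).
    have -> : eps * 2 * (W k.+1 + W k.+1 + (V k.+1 + V k.+1)) ^+ 2 =
      4 * (eps * 2 * (W k.+1 + V k.+1) ^+ 2) by ring.
    by move: G1 G2 G3 G4; clear; lra.
  - by apply/andP; split; clear -W1; lra.
  - by apply/andP; split; clear -V1; lra.
  - by rewrite -(WS k) -(VS k); apply: cder_on_rect_sub H.
rewrite leNgt; apply/negP => contra.
pose nx k p := xget p [set q | bad k.+1 q /\ next k p q].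
pose s := fix s k := if k is k'.+1 then nx k' (s k') else (x1, y1).
have bs k : bad k (s k).
  elim: k => [|k IH] /=.
    rewrite /bad /inn /= /W /V expr0 !divr1 /w /h.
    have -> : x1 + (x2 - x1) = x2 by rewrite addrC subrK.
    have -> : y1 + (y2 - y1) = y2 by rewrite addrC subrK.
    split; first by split.
    apply: le_lt_trans contra; rewrite /eps -/w -/h.
    rewrite -(mulrA _ 2) mulrAC ler_pdivrMr// ler_pM2l//.
    by rewrite mulrC lerDl.
  rewrite /nx; case: xgetP => [q _ []//|no].
  by have [q Hq] := step _ _ IH; case: (no q).
have ns k : next k (s k) (s k.+1).
  rewrite /= /nx; case: xgetP => [q _ []//|no].
  by have [q Hq] := step _ _ (bs k); case: (no q).
have [p Hp] := @nested_intervals (fun k => (s k).1) W W0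
  (fun k => let: And4 a b _ _ := ns k in conj a b).
have [q Hq] := @nested_intervals (fun k => (s k).2) V V0
  (fun k => let: And4 _ _ a b := ns k in conj a b).
have [i1 i2 i3 i4] := (bs 0%N).1.
have pin : x1 <= p <= x2.
  have /andP[h1 h2] := Hp 0%N; rewrite (le_trans i1 h1)/=.
  exact: le_trans h2 i2.
have qin : y1 <= q <= y2.
  have /andP[h1 h2] := Hq 0%N; rewrite (le_trans i3 h1)/=.
  exact: le_trans h2 i4.
have [d Dd] := H _ _ pin qin.
have [del d0 Hd] := bd_local Dd e0.
have [k Hk] : exists k, W k + V k < del.
  have [k /(_ k (leqnn k)) Hk] := pow2_small (addr_ge0 w0 h0) d0.
  by exists k; rewrite /W /V -mulrDl.
have [[j1 j2 j3 j4]] := bs k; apply/negP; rewrite -leNgt.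
have := Hd (s k).1 ((s k).1 + W k) (s k).2 ((s k).2 + V k) (Hp k) (Hq k).
rewrite ![_ + _ - (s k).1]addrAC ![_ + _ - (s k).2]addrAC !subrr !add0r.
by apply=> //; apply: cder_on_rect_sub H.
Qed.

End Goursat.

Section Cauchy.
Variable R : realType.
Local Notation C := (Cx R).
Implicit Types z w : C.

Lemma expCD z w : expC (z + w) = expC z * expC w.
Proof.
case: z w => x y [u v]; apply/eqP; rewrite eq_complex /= expRD cosD sinD.
by apply/andP; split; apply/eqP; ring.
Qed.

Lemma expC0 : expC (0 : C) = 1.
Proof. by rewrite /expC /= expR0 cos0 sin0 mulr1 mulr0. Qed.

Lemma normc_expC z : normc (expC z) = expR (complex.Re z).
Proof.
rewrite /normc /expC /= !exprMn -mulrDr cos2Dsin2 mulr1 sqrtr_sqr.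
by rewrite ger0_norm ?expR_ge0.
Qed.

Lemma expC_neq0 z : expC z != 0.
Proof.
apply/eqP => z0; have := normc_expC z; rewrite z0 normc0 => /esym/eqP.
by rewrite gt_eqF ?expR_gt0.
Qed.

Lemma expCN z : expC (- z) = (expC z)^-1.
Proof.
by apply: (mulfI (expC_neq0 z)); rewrite -expCD subrr expC0 divff ?expC_neq0.
Qed.

Lemma cder_expC0 : cder (@expC R) 0 1.
Proof.
move=> eps e0; have e3 : 0 < eps / 3 by rewrite divr_gt0.
pose U (y : R) : C := Complex (cos y) (sin y).
have U0 : U 0 = 1 by rewrite /U cos0 sin0.
have U1 y : normc (U y) = 1 by rewrite /U /normc /= cos2Dsin2 sqrtr1.
have DU : rder U 0 'i%C.
  have := @ReIm_rder R U 0 (- sin 0) (cos 0) (is_derive_cos _) (is_derive_sin _).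
  by rewrite cos0 sin0 oppr0.
have [a a0 Ha] := DU _ e3; have [b b0 Hb] := rder_rcont DU e3.
have [c c0 Hc] := (is_deriveP expR 0 1).1
  (eq_ind _ (fun d : R => is_derive (0 : R) (1 : R) (@expR R) d) (is_derive_expR 0) _ (expR0 R)) _ e3.
exists (Num.min a (Num.min b c)); first by rewrite !lt_min a0 b0.
move=> h; rewrite !lt_min => /and3P[ha hb hc].
set x := complex.Re h; set y := complex.Im h.
have yh : `|y| <= normc h := normr_Im_le h.
have xh : `|x| <= normc h := normr_Re_le h.
have := Ha y; rewrite normc_real add0r U0 => /(_ (le_lt_trans yh ha)) A.
have := Hb y; rewrite subr0 U0 => /(_ (le_lt_trans yh hb)) B.
have := Hc x; rewrite add0r expR0 mulr1 => /(_ (le_lt_trans xh hc)) D.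
rewrite add0r expC0 mulr1.
have -> : expC h - 1 - h = ((expR x - 1 - x)%:C%C * U y : C) + (U y - 1 - y%:C%C * 'i%C)
   + x%:C%C * (U y - 1).
  rewrite {2}(complexE h) -/x -/y.
  have -> : expC h = (expR x)%:C%C * U y.
    by apply/eqP; rewrite eq_complex /= -/x -/y; apply/andP; split; apply/eqP; ring.
  by rewrite !rmorphB rmorph1; ring.
apply: (le_trans (normcD_le _ _)).
apply: (le_trans (lerD (normcD_le _ _) (lexx _))).
rewrite !normcM U1 !normc_real mulr1.
have B' : `|x| * normc (U y - 1) <= normc h * (eps / 3).
  by apply: ler_pM => //; exact: normc_ge0.
have A' : eps / 3 * `|y| <= eps / 3 * normc h by rewrite ler_wpM2l// ltW.
have D' : eps / 3 * `|x| <= eps / 3 * normc h by rewrite ler_wpM2l// ltW.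
have -> : eps * normc h = eps / 3 * normc h + eps / 3 * normc h + normc h * (eps / 3).
  by field.
apply: lerD => //; apply: lerD; [exact: le_trans D'|exact: le_trans A'].
Qed.

Lemma cder_expC z : cder (@expC R) z (expC z).
Proof.
have T : cder (fun w => w - z) z 1.
  have := gderB (cder_id z) (gder_cst (fun h : C => h) z z).
  by rewrite subr0.
have H : cder (@expC R) (z - z) 1 by rewrite subrr; exact: cder_expC0.
have := gderZ (expC z) (@gder_comp _ _ (fun h : C => h) _ (fun w => w - z) _ _ _ H T).
rewrite !mulr1; apply: gder_eq => w.
by rewrite -expCD [z + _]addrC subrK.
Qed.

Lemma expC_period x y : expC (Complex x (y + 2 * pi) : C) = expC (Complex x y).
Proof. by rewrite /expC /= mulr_natl cosD2pi sinD2pi. Qed.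

(* Goursat on the strip [x <= ln r], [0 <= y <= 2 pi] for the periodic function
   [(f (c + e^z) - f c) e^-z], whose mean tends to [f' c] as [x] tends to -oo. *)
Lemma cauchy_estimate f (c d : C) (r M : R) : 0 < r ->
  (forall z, normc (z - c) <= r -> exists d, cder f z d) ->
  (forall z, normc (z - c) <= r -> normc (f z) <= M) ->
  cder f c d -> normc d <= 2 * M / r.
Proof.
move=> r0 Hf HM Dc.
pose g z := (f (c + expC z) - f c) * expC (- z).
have Dg z : expR (complex.Re z) <= r -> exists d, cder g z d.
  move=> zr; have [d1 D1] : exists d, cder f (c + expC z) d.
    by apply: Hf; rewrite addrAC subrr add0r normc_expC.
  have E1 : cder (fun w => c + expC w) z (0 + expC z).
    exact: gderD (gder_cst _ c z) (cder_expC z).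
  have F1 := @gder_comp _ _ (fun h : C => h) f (fun w => c + expC w) z _ _ D1 E1.
  have F2 := gderB F1 (gder_cst (fun h : C => h) (f c) z).
  have N1 := gderN (cder_id z).
  have F3 := @gder_comp _ _ (fun h : C => h) (@expC R) (fun w => - w) z _ _ (cder_expC (- z)) N1.
  by eexists; exact: (gderM F2 F3).
have pi0 := pi_gt0 R.
have pi2 : 0 <= 2 * pi :> R by rewrite mulr_ge0// ltW.
pose J x := cint (fun y => g (Complex x y)) 0 (2 * pi).
have rect x1 : x1 <= ln r -> cder_on_rect g x1 (ln r) 0 (2 * pi).
  move=> x1r x y /andP[_ xr] _; apply: Dg => /=.
  by rewrite -(@lnK R r) ?posrE// ler_expR.
have Jeq x1 : x1 <= ln r -> J (ln r) = J x1.
  move=> x1r; have := goursat x1r pi2 (rect _ x1r).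
  rewrite /bd (_ : (fun s => g (Complex s (2 * pi))) = fun s => g (Complex s 0)).
    rewrite subrr add0r => /eqP; rewrite mulf_eq0 -/(J _) -/(J _) subr_eq0.
    have i0 : ('i%C : C) == 0 = false.
      by apply/negP => /eqP/(congr1 (@complex.Im R))/eqP; rewrite /= oner_eq0.
    by rewrite i0 => /eqP.
  apply/funext => s; rewrite /g !expCN.
  by rewrite -[2 * pi]add0r expC_period.
have cJ x : x <= ln r -> cont_on (fun y => g (Complex x y)) 0 (2 * pi).
  by move=> xr; apply: (cont_on_ver (rect _ xr)); rewrite lexx.
have J1 : normc (J (ln r)) <= 2 * M / r * (2 * pi).
  rewrite -[2 * pi]subr0; apply: cint_bound; rewrite ?subr0//; first exact: cJ.
  move=> t _; rewrite /g expCN normcM normcV normc_expC /= lnK ?posrE//.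
  rewrite ler_wpM2r ?invr_ge0 ?(ltW r0)//; apply: (le_trans (normcB_le _ _)).
  have H1 : normc (f (c + expC (Complex (ln r) t))) <= M.
    by apply: HM; rewrite addrAC subrr add0r normc_expC /= lnK.
  have H2 : normc (f c) <= M by apply: HM; rewrite subrr normc0 ltW.
  by rewrite mulr_natl mulr2n lerD.
apply/ler_addgt0Pl => eps e0; have [a a0 Ha] := Dc _ e0.
(* At radius [rho] the difference quotient is within [eps] of [d], so [J (ln rho)] is within
   [eps * (2 * pi)] of [2 * pi * d]. It equals [J (ln r)], which [M] bounds. *)
pose rho := Num.min r (a / 2).
have rho0 : 0 < rho by rewrite lt_min r0 divr_gt0.
have lnr : ln rho <= ln r by rewrite ler_ln ?posrE// ge_min lexx.
have J2 : normc (J (ln rho) - d * (2 * pi)%:C%C) <= eps * (2 * pi).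
  have := @cint_approx R (fun y => g (Complex (ln rho) y)) (fun t => d * t%:C%C) (fun=> d)
    0 (2 * pi) eps pi2 (cJ _ lnr).
  rewrite subr0 rmorph0 mulr0 subr0; apply.
    move=> t _; have := rder_line 0 d t; apply: gder_eq => s.
    by rewrite add0r mulrC.
  move=> t _; rewrite /g; set h := expC _.
  have nh : normc h = rho by rewrite normc_expC /= lnK.
  have h0 : h != 0 by exact: expC_neq0.
  have := Ha h; rewrite nh => /(_ _)/wrap[|K].
    by rewrite (@le_lt_trans _ _ (a / 2))// ?ge_min ?lexx ?orbT// ltr_pdivrMr// ltr_pMr// ltr1n.
  have -> : (f (c + h) - f c) * expC (- Complex (ln rho) t) - d =
     (f (c + h) - f c - h * d) / h.
    by rewrite expCN -/h [RHS]mulrBl [h * d]mulrC mulfK.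
  by rewrite normcM normcV nh ler_pdivrMr.
have p2 : 0 < 2 * pi :> R by rewrite mulr_gt0.
rewrite -(ler_pM2r p2) [leRHS]mulrDl.
have -> : normc d * (2 * pi) = normc (d * (2 * pi)%:C%C).
  by rewrite normcM normc_real ger0_norm.
have := normcB_le (J (ln rho)) (J (ln rho) - d * (2 * pi)%:C%C).
rewrite opprB addrC subrK => /le_trans; apply; rewrite -(Jeq _ lnr) [leLHS]addrC.
rewrite (Jeq _ lnr) in J1 *; exact: (lerD J2 J1).
Qed.

End Cauchy.

(** * Holomorphic functions on normed spaces *)

Section GateauxHolomorphy.
Variable R : realType.
Local Notation C := (Cx R).

Lemma normCE (z : C) : `|z| = (normc z)%:C%C.
Proof. by rewrite normc_def; case: z. Qed.

Section RealNorm.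
Variable E : normedModType C.
Implicit Types (u v p q : E).

(* The norm of [E] takes its values in [C]; [rn] is the same norm, in [R]. *)
Definition rn v : R := complex.Re `|v|.

Lemma rnE v : `|v| = (rn v)%:C%C :> C.
Proof.
have := normr_ge0 v; rewrite /rn lecE /= => /andP[/eqP h _].
by apply/eqP; rewrite eq_complex /= h !eqxx.
Qed.

Lemma rn_ge0 v : 0 <= rn v.
Proof. by have := normr_ge0 v; rewrite rnE lecR. Qed.

Lemma rnD_le u v : rn (u + v) <= rn u + rn v.
Proof. by have := ler_normD u v; rewrite !rnE -rmorphD lecR. Qed.

Lemma rnZ (c : C) v : rn (c *: v) = normc c * rn v.
Proof.
have := normrZ c v; rewrite !rnE normc_def -rmorphM /=.
by case: c => a b /complexI.
Qed.

Lemma rn0 : rn 0 = 0.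
Proof. by rewrite /rn normr0. Qed.

Lemma rn_eq0 v : rn v = 0 -> v = 0.
Proof. by move=> v0; apply/normr0_eq0; rewrite rnE v0. Qed.

Lemma rnN v : rn (- v) = rn v.
Proof. by rewrite /rn normrN. Qed.

Lemma nbhs_rnP p (P : set E) : nbhs p P <->
  exists2 del : R, 0 < del & forall q, rn (q - p) < del -> P q.
Proof.
split=> [/nbhs_normP[e /= e0 He]|[del d0 H]].
  have eE : e = (complex.Re e)%:C%C.
    by case: e e0 {He} => a b; rewrite ltcE /= => /andP[/eqP -> _].
  exists (complex.Re e); first by rewrite -ltcR -eE.
  by move=> q pq; apply: He; rewrite /= distrC rnE eE ltcR.
apply/nbhs_normP; exists del%:C%C => /=; first by rewrite ltcR.
by move=> q /=; rewrite distrC rnE ltcR; exact: H.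
Qed.

Lemma differentiable_eps (f : E -> C) p (D : {linear E -> C}) : continuous D ->
  (forall eps : R, 0 < eps -> exists2 del : R, 0 < del & forall h, rn h < del ->
     normc (f (p + h) - f p - D h) <= eps * rn h) ->
  differentiable f p.
Proof.
move=> cD H.
have o : f \o shift p = cst (f p) + D +o_ (0 : E) id.
  apply/eqaddoP => e e0.
  have eE : e = (complex.Re e)%:C%C.
    by case: e e0 => a b; rewrite ltcE /= => /andP[/eqP -> _].
  have [del d0 Hd] : exists2 del : R, 0 < del & forall h, rn h < del ->
     normc (f (p + h) - f p - D h) <= complex.Re e * rn h.
    by apply: H; rewrite -ltcR -eE.
  apply/nbhs_rnP; exists del => // h; rewrite subr0 => /Hd.
  rewrite [`|id h|]rnE {2}eE -rmorphM /=.
  have -> : (f \o shift p - (cst (f p) + D)) h = f (p + h) - f p - D h.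
    by rewrite !fctE /= [h + p]addrC opprD addrA.
  by rewrite -lecR; apply: le_trans; rewrite normc_def; case: (_ - D h).
have dE := diff_unique cD o.
by apply/diff_locallyP; rewrite dE.
Qed.

Lemma diff_eps (f : E -> C) p : differentiable f p ->
  forall eps : R, 0 < eps -> exists2 del : R, 0 < del & forall h, rn h < del ->
     normc (f (p + h) - f p - 'd f p h) <= eps * rn h.
Proof.
move=> /diff_locally/eqaddoP H eps e0.
have epsC : 0 < eps%:C%C :> C by rewrite ltcR.
have [del d0 Hd] := (nbhs_rnP (0 : E) _).1 (H _ epsC).
exists del => // h hd; have := Hd h; rewrite subr0 => /(_ hd).
rewrite [`|id h|]rnE -rmorphM /=.
have -> : (f \o shift p - (cst (f p) + 'd f p)) h = f (p + h) - f p - 'd f p h.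
  by rewrite !fctE /= [h + p]addrC opprD addrA.
by rewrite normc_def; case: (_ - 'd f p h) => a b; rewrite lecR.
Qed.

Definition dder (f : E -> C) p v (d : C) : Prop := cder (fun z => f (p + z *: v)) 0 d.

Lemma diff_dder (f : E -> C) p v : differentiable f p -> dder f p v ('d f p v).
Proof.
move=> df eps e0; have v1 : 0 < rn v + 1 by rewrite ltr_wpDl ?rn_ge0.
have [del d0 H] := diff_eps df (divr_gt0 e0 v1).
exists (del / (rn v + 1)); first by rewrite divr_gt0.
move=> h hd; have K : normc h * rn v <= normc h * (rn v + 1).
  by rewrite ler_wpM2l ?normc_ge0// lerDl.
rewrite add0r scale0r addr0.
have := H (h *: v); rewrite rnZ => /(_ _)/wrap[|].
  by apply: (le_lt_trans K); rewrite -ltr_pdivlMr.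
rewrite linearZ /= -[h *: 'd f p v]/(h * 'd f p v) => /le_trans; apply.
by rewrite mulrAC ler_pdivrMr// -mulrA ler_wpM2l// ltW.
Qed.

Lemma dder_shift (f : E -> C) p v z d : dder f (p + z *: v) v d <->
  cder (fun w => f (p + w *: v)) z d.
Proof.
by split=> H eps /H[del d0 Hd]; exists del => // h /Hd;
  rewrite add0r scale0r addr0 scalerDl addrA.
Qed.

(** Together with a bound on [f] this already implies Frechet differentiability, through [quasi]
    below. *)
Definition gateaux (f : E -> C) p (r : R) : Prop :=
  forall q, rn (q - p) < r -> forall v, exists d, dder f q v d.

(** On the complex line through [u] and [v], the Cauchy estimate applies in discs about the points
    of the segment. Their radius [rho] amounts to [r / 4] in [E], which keeps them in the ball
    because the segment stays within [r / 2] of [p]. *)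
Lemma gateaux_lip (f : E -> C) p (r M : R) : 0 < r -> gateaux f p r ->
  (forall q, rn (q - p) < r -> normc (f q) <= M) ->
  forall u v, rn (u - p) < r / 2 -> rn (v - p) < r / 2 ->
  normc (f u - f v) <= 8 * M / r * rn (u - v).
Proof.
move=> r0 Hf HM u v ur vr; set w := u - v.
have [w0|w0] := eqVneq (rn w) 0.
  by rewrite w0 mulr0 (subr0_eq (rn_eq0 w0)) subrr normc0.
have wpos : 0 < rn w by rewrite lt_def w0 rn_ge0.
pose phi (z : C) := f (v + z *: w).
pose rho := r / 4 / rn w; have rho0 : 0 < rho by rewrite !divr_gt0.
have inball (t : R) z : 0 <= t <= 1 -> normc (z - t%:C%C) <= rho -> rn (v + z *: w - p) < r.
  move=> /andP[t0 t1] zt.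
  have -> : v + z *: w - p =
      (t%:C%C *: (u - p) + (1 - t)%:C%C *: (v - p)) + (z - t%:C%C) *: w.
    rewrite rmorphB rmorph1 scalerBl scale1r addrCA -scalerBr.
    have -> : u - p - (v - p) = w by rewrite opprB addrA subrK.
    by rewrite -[RHS]addrA -scalerDl [t%:C%C + _]addrC subrK addrAC.
  apply: (le_lt_trans (rnD_le _ _)).
  have B1 : rn ((z - t%:C%C) *: w) <= r / 4 by rewrite rnZ -ler_pdivlMr.
  have B2 := rnD_le (t%:C%C *: (u - p)) ((1 - t)%:C%C *: (v - p)).
  have t1' : 0 <= 1 - t by rewrite subr_ge0.
  rewrite !rnZ !normc_real !ger0_norm// in B2.
  have B3 : t * rn (u - p) + (1 - t) * rn (v - p) <= t * (r / 2) + (1 - t) * (r / 2).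
    by rewrite lerD// ler_wpM2l// ltW.
  by move: B1 B2 B3 r0; rewrite -mulrDl [t + _]addrC subrK mul1r; clear; lra.
have Dphi (t : R) z : 0 <= t <= 1 -> normc (z - t%:C%C) <= rho -> exists d, cder phi z d.
  by move=> t01 zt; have [d /dder_shift D] := Hf _ (inball _ _ t01 zt) w; exists d.
pose dphi z := xget 0 [set d | cder phi z d].
have HD (t : R) z : 0 <= t <= 1 -> normc (z - t%:C%C) <= rho -> cder phi z (dphi z).
  by move=> t01 /(Dphi _ _ t01)[d D]; exact: (@xgetPex _ 0 [set d | cder phi z d] (ex_intro _ d D)).
have c0 (t : R) : normc (t%:C%C - t%:C%C : C) <= rho by rewrite subrr normc0 ltW.
have := @cder_segment R phi dphi 0 1 (8 * M / r * rn w).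
rewrite subr0 normc1 mulr1 /phi scale1r scale0r addr0.
have -> : v + w = u by rewrite /w addrC subrK.
apply=> t t01; rewrite mulr1 add0r; first exact: (HD t).
have -> : 8 * M / r * rn w = 2 * M / rho.
  by rewrite /rho; field; rewrite w0 gt_eqF.
apply: (@cauchy_estimate R phi t%:C%C _ rho M rho0) => //.
- by move=> z; exact: Dphi.
- by move=> z /(inball _ _ t01); exact: HM.
- exact: (HD t).
Qed.

(** [gateaux_lip] is applied twice: to [f], which bounds the difference [g] by [8 * M / r * rn u] on
    the ball of radius [r / 4], and then to [g] on that ball. Hence 256 = 8 * 8 * 4. *)
Lemma gateaux_second_diff (f : E -> C) p (r M : R) : 0 < r -> gateaux f p r ->
  (forall q, rn (q - p) < r -> normc (f q) <= M) ->
  forall u v, rn u < r / 8 -> rn v < r / 8 ->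
  normc (f (p + v + u) - f (p + v) - f (p + u) + f p) <= 256 * M / r ^+ 2 * rn u * rn v.
Proof.
move=> r0 Hf HM u v ur vr.
pose g q := f (q + u) - f q.
have r4 : 0 < r / 4 by rewrite divr_gt0.
have := @gateaux_lip g p (r / 4) (8 * M / r * rn u) r4.
move=> /(_ _)/wrap[|].
  move=> q qp w.
  have h1 : rn (q + u - p) < r.
    rewrite addrAC; apply: (le_lt_trans (rnD_le _ _)).
    by move: qp ur r0; clear; lra.
  have h2 : rn (q - p) < r by move: qp r0; clear; lra.
  have [d1 D1] := Hf _ h1 w; have [d2 D2] := Hf _ h2 w.
  exists (d1 - d2); rewrite /dder /g.
  apply: gderB => //; apply: gder_eq D1 => z.
  by rewrite addrAC.
move=> /(_ _)/wrap[|].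
  move=> q qp; rewrite /g -{2}[u](addrK q) [u + q]addrC.
  apply: (gateaux_lip r0 Hf HM).
    rewrite addrAC; apply: (le_lt_trans (rnD_le _ _)).
    by move: qp ur r0; clear; lra.
  by move: qp r0; clear; lra.
move=> /(_ (p + v) p).
rewrite [p + v - p]addrAC subrr add0r rn0.
have v1 : rn v < r / 4 / 2 by rewrite -mulrA -invfM -natrM.
have v2 : 0 < r / 4 / 2 by rewrite divr_gt0.
move=> /(_ v1 v2); rewrite /g opprB !addrA.
have -> : 8 * (8 * M / r * rn u) / (r / 4) * rn v = 256 * M / r ^+ 2 * rn u * rn v.
  by field; rewrite gt_eqF.
by rewrite addrAC.
Qed.

Lemma cder_le_lip (f : C -> C) z (d : C) (L r : R) : 0 < r -> cder f z d ->
  (forall h, normc h < r -> normc (f (z + h) - f z) <= L * normc h) -> normc d <= L.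
Proof.
move=> r0 Df Lf; apply/ler_addgt0Pl => e e0; have [a a0 Ha] := Df _ e0.
pose m := Num.min a r / 2; have mn0 : 0 < Num.min a r by rewrite lt_min a0.
have m0 : 0 < m by rewrite divr_gt0.
have : m < Num.min a r by rewrite ltr_pdivrMr// ltr_pMr// ltr1n.
rewrite lt_min => /andP[ma mr].
have hm : normc (m%:C%C : C) = m by rewrite normc_real gtr0_norm.
have := Ha m%:C%C; have := Lf m%:C%C; rewrite hm => /(_ mr) L1 /(_ ma) L2.
rewrite -(ler_pM2r m0) mulrDl.
have -> : normc d * m = normc (m%:C%C * d) by rewrite normcM hm mulrC.
have := normcB_le (f (z + m%:C%C) - f z) (f (z + m%:C%C) - f z - m%:C%C * d).
rewrite opprB [X in normc X](_ : _ = m%:C%C * d); last by ring.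
by move: L1 L2; clear; lra.
Qed.

(** The derivative of [k] on [0, 1] is the difference of the derivatives of [f] in direction [v] at
    [p + t v] and at [p]. The second difference, divided by its step, bounds it by
    [K * rn v ^+ 2]. *)
Lemma gateaux_second_order (f : E -> C) p (r M : R) : 0 < r -> gateaux f p r ->
  (forall q, rn (q - p) < r -> normc (f q) <= M) ->
  forall v d, rn v < r / 8 -> dder f p v d ->
  normc (f (p + v) - f p - d) <= 256 * M / r ^+ 2 * rn v ^+ 2.
Proof.
move=> r0 Hf HM v d vr Dv; set K := 256 * M / r ^+ 2.
have M0 : 0 <= M by apply: (le_trans (normc_ge0 (f p))); apply: HM; rewrite subrr rn0.
have K0 : 0 <= K by apply: divr_ge0; [apply: mulr_ge0 M0; exact: ler0n|exact: sqr_ge0].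
have SD := gateaux_second_diff r0 Hf HM; rewrite -/K in SD; clearbody K.
pose k (z : C) := f (p + z *: v) - z * d.
pose dk z := xget 0 [set e | cder k z e].
have tv (t : R) : 0 <= t <= 1 -> rn (t%:C%C *: v) <= rn v.
  by move=> /andP[t0 t1]; rewrite rnZ normc_real ger0_norm// ler_piMl// rn_ge0.
have Dk (t : R) : 0 <= t <= 1 -> exists e, dder f (p + t%:C%C *: v) v e /\ cder k t%:C%C (e - d).
  move=> t01.
  have [|e De] := Hf (p + t%:C%C *: v) _ v.
    rewrite addrAC subrr add0r; apply: (le_lt_trans (tv _ t01)).
    by move: vr r0; clear; lra.
  exists e; split=> //; have {}De := (dder_shift _ _ _ _ _).1 De.
  rewrite -[d]mul1r; apply: gderB De _.
  have := gderZ d (cder_id (t%:C%C : C)); rewrite mulr1 mul1r.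
  by apply: gder_eq => z; rewrite mulrC.
have HD (t : R) : 0 <= t <= 1 -> cder k t%:C%C (dk t%:C%C).
  move=> /Dk[e [_ D]].
  exact: (@xgetPex _ 0 [set e | cder k t%:C%C e] (ex_intro _ _ D)).
have := @cder_segment R k dk 0 1 (K * rn v ^+ 2).
rewrite subr0 normc1 mulr1 /k scale1r scale0r addr0 mul1r mul0r subr0.
rewrite addrAC; apply=> t t01; rewrite mulr1 add0r; first exact: HD.
have [e [De Dke]] := Dk _ t01.
rewrite (cder_unique (HD _ t01) Dke).
have v1 : 0 < rn v + 1 by rewrite ltr_wpDl ?rn_ge0.
apply: (@cder_le_lip (fun z => f (p + t%:C%C *: v + z *: v) - f (p + z *: v)) 0 _ _
  (r / 8 / (rn v + 1))).
- by rewrite !divr_gt0.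
- exact: gderB De Dv.
- move=> h hr; rewrite add0r !scale0r !addr0.
  have -> : f (p + t%:C%C *: v + h *: v) - f (p + h *: v) - (f (p + t%:C%C *: v) - f p) =
    f (p + t%:C%C *: v + h *: v) - f (p + t%:C%C *: v) - f (p + h *: v) + f p by ring.
  have hv : rn (h *: v) < r / 8.
    rewrite rnZ; apply: (@le_lt_trans _ _ (normc h * (rn v + 1))).
      by rewrite ler_wpM2l ?normc_ge0// lerDl.
    by rewrite -ltr_pdivlMr.
  have tvr : rn (t%:C%C *: v) < r / 8 by apply: le_lt_trans vr; exact: tv.
  apply: (le_trans (SD _ _ hv tvr)); rewrite rnZ expr2.
  have -> : K * (rn v * rn v) * normc h = K * (normc h * rn v) * rn v by ring.
  apply: ler_wpM2l; last exact: tv.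
  by rewrite !mulr_ge0 ?rn_ge0 ?normc_ge0.
Qed.




(** * Limits of complex sequences, and stability of holomorphy under limits and integrals *)

Definition cvgC (u : nat -> C) (l : C) : Prop :=
  forall e : R, 0 < e -> exists N, forall k, (N <= k)%N -> normc (u k - l) <= e.

Lemma cvgC_cst c : cvgC (fun=> c) c.
Proof. by move=> e e0; exists 0%N => k _; rewrite subrr normc0 ltW. Qed.

Lemma cvgCD (u v : nat -> C) l m : cvgC u l -> cvgC v m -> cvgC (fun k => u k + v k) (l + m).
Proof.
move=> Hu Hv e e0; have e2 : 0 < e / 2 by rewrite divr_gt0.
have [N1 H1] := Hu _ e2; have [N2 H2] := Hv _ e2.
exists (maxn N1 N2) => k; rewrite geq_max => /andP[/H1 k1 /H2 k2].
have -> : u k + v k - (l + m) = (u k - l) + (v k - m) by ring.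
by apply: (le_trans (normcD_le _ _)); move: k1 k2; clear; lra.
Qed.

Lemma cvgCZ c (u : nat -> C) l : cvgC u l -> cvgC (fun k => c * u k) (c * l).
Proof.
move=> Hu e e0; have c1 : 0 < normc c + 1 by rewrite ltr_wpDl ?normc_ge0.
have [N HN] := Hu _ (divr_gt0 e0 c1); exists N => k /HN H.
rewrite -mulrBr normcM; apply: (@le_trans _ _ ((normc c + 1) * normc (u k - l))).
  by rewrite ler_wpM2r ?normc_ge0// lerDl.
by rewrite mulrC -ler_pdivlMr.
Qed.

Lemma cvgCB (u v : nat -> C) l m : cvgC u l -> cvgC v m -> cvgC (fun k => u k - v k) (l - m).
Proof.
move=> Hu Hv; have := cvgCD Hu (cvgCZ (-1) Hv); rewrite mulN1r.
by under eq_fun do rewrite mulN1r.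
Qed.

Lemma cvgC_bound (u : nat -> C) l (M : R) : cvgC u l -> (forall k, normc (u k) <= M) -> normc l <= M.
Proof.
move=> Hu HM; apply/ler_addgt0Pl => e e0; have [N HN] := Hu _ e0.
have := HN N (leqnn N); have := HM N; have := normcB_le (u N) (u N - l).
by rewrite subKr; clear; lra.
Qed.

Lemma cvgC_unique (u : nat -> C) l l' : cvgC u l -> cvgC u l' -> l = l'.
Proof.
move=> H H'; apply/eqP; rewrite -subr_eq0; apply/eqP/normc_eq0/eqP.
rewrite eq_le normc_ge0 andbT; apply: (cvgC_bound (cvgCB H H')) => k.
by rewrite subrr normc0.
Qed.

Lemma cvgC_shift (u : nat -> C) l : cvgC u l -> cvgC (fun k => u k.+1) l.
Proof. by move=> Hu e /Hu[N HN]; exists N => k Nk; apply: HN; rewrite leqW. Qed.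

Lemma cauchyR_cvg (u : nat -> R) :
  (forall e : R, 0 < e -> exists N, forall k, (N <= k)%N -> `|u k - u N| <= e) ->
  exists l, forall e : R, 0 < e -> exists N, forall k, (N <= k)%N -> `|u k - l| <= e.
Proof.
move=> H; have cu : cvg (u @ \oo).
  apply: cauchy_cvg; apply: cauchy_exP => e e0.
  have [N HN] := H (e / 2) (divr_gt0 e0 (ltr0n _ 2)).
  exists (u N); exists N => // k /= /HN; rewrite /ball/= distrC => /le_lt_trans; apply.
  by rewrite ltr_pdivrMr// ltr_pMr// ltr1n.
exists (lim (u @ \oo)) => e e0.
have /cvgrPdist_le/(_ _ e0)[N _ HN] := cu.
by exists N => k /HN; rewrite distrC.
Qed.

Lemma cauchyC_cvg (u : nat -> C) :
  (forall e : R, 0 < e -> exists N, forall k, (N <= k)%N -> normc (u k - u N) <= e) ->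
  exists l, cvgC u l.
Proof.
move=> H.
have [|a Ha] := @cauchyR_cvg (fun k => complex.Re (u k)).
  move=> e /H[N HN]; exists N => k /HN; apply: le_trans.
  by rewrite -ReB normr_Re_le.
have [|b Hb] := @cauchyR_cvg (fun k => complex.Im (u k)).
  move=> e /H[N HN]; exists N => k /HN; apply: le_trans.
  by rewrite -ImB normr_Im_le.
exists (Complex a b) => e e0; have e2 : 0 < e / 2 by rewrite divr_gt0.
have [N1 H1] := Ha _ e2; have [N2 H2] := Hb _ e2.
exists (maxn N1 N2) => k; rewrite geq_max => /andP[/H1 k1 /H2 k2].
apply: (le_trans (normc_le_ReIm _)); rewrite ReB ImB /=.
by move: k1 k2; clear; lra.
Qed.

(* Inequalities which hold for holomorphic functions near [p], imply complex
   differentiability at [p], and pass to pointwise limits and to integrals. *)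
Record quasi (f : E -> C) (p : E) (r K : R) : Prop := Quasi {
  quasi_second : forall u v, rn u < r -> rn v < r ->
    normc (f (p + v + u) - f (p + v) - f (p + u) + f p) <= K * (rn u * rn v);
  quasi_ratio : forall (c : C) v, normc c <= 1 -> rn v < r ->
    normc (f (p + c *: v) - f p - c * (f (p + v) - f p)) <= K * (normc c * rn v ^+ 2);
  quasi_lip : forall v, rn v < r -> normc (f (p + v) - f p) <= K * rn v }.

(** The second order remainder enters [quasi_ratio] twice, for [c *: v] and for [v], whence the
    factor 2; the last summand serves [quasi_lip]. *)
Lemma gateaux_quasi (f : E -> C) p (r M : R) : 0 < r -> gateaux f p r ->
  (forall q, rn (q - p) < r -> normc (f q) <= M) ->
  quasi f p (r / 8) (2 * (256 * M / r ^+ 2) + 8 * M / r).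
Proof.
move=> r0 Hf HM.
have M0 : 0 <= M by apply: (le_trans (normc_ge0 (f p))); apply: HM; rewrite subrr rn0.
have SD := gateaux_second_diff r0 Hf HM.
have SO := gateaux_second_order r0 Hf HM.
have L := gateaux_lip r0 Hf HM.
have K10 : 0 <= 256 * M / r ^+ 2.
  by apply: divr_ge0; [apply: mulr_ge0 M0; exact: ler0n|exact: sqr_ge0].
have K20 : 0 <= 8 * M / r by apply: divr_ge0 (ltW r0); apply: mulr_ge0 M0; exact: ler0n.
move: (256 * M / r ^+ 2) (8 * M / r) SD SO L K10 K20 => K1 K2 SD SO L K10 K20.
split.
- move=> u v ur vr; apply: (le_trans (SD _ _ ur vr)); rewrite -mulrA ler_wpM2r//.
    by rewrite mulr_ge0 ?rn_ge0.
  by move: K10 K20; clear; lra.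
- move=> c v c1 vr; have [|d Dv] := Hf p _ v; first by rewrite subrr rn0.
  have Dcv : dder f p (c *: v) (c * d).
    have S : cder (fun z : C => z * c) 0 c.
      have := gderZ c (cder_id (0 : C)); rewrite mulr1.
      by apply: gder_eq => z; rewrite mulrC.
    have D0 : cder (fun z => f (p + z *: v)) (0 * c) d by rewrite mul0r.
    have := @gder_comp _ _ (fun h : C => h) _ (fun z : C => z * c) _ _ _ D0 S.
    by apply: gder_eq => z; rewrite scalerA.
  have cv : rn (c *: v) <= rn v by rewrite rnZ ler_piMl ?rn_ge0.
  have H1 := SO _ _ vr Dv; have H2 := SO _ _ (le_lt_trans cv vr) Dcv.
  have -> : f (p + c *: v) - f p - c * (f (p + v) - f p) =
    (f (p + c *: v) - f p - c * d) - c * (f (p + v) - f p - d) by ring.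
  apply: (le_trans (normcB_le _ _)); rewrite normcM.
  have H3 : normc c * normc (f (p + v) - f p - d) <= K1 * (normc c * rn v ^+ 2).
    by rewrite mulrCA ler_wpM2l ?normc_ge0.
  have H4 : K1 * rn (c *: v) ^+ 2 <= K1 * (normc c * rn v ^+ 2).
    rewrite ler_wpM2l// rnZ exprMn ler_wpM2r ?sqr_ge0// expr2.
    by rewrite ler_piMl// normc_ge0.
  have H5 : 0 <= K2 * (normc c * rn v ^+ 2) by rewrite !mulr_ge0 ?normc_ge0 ?rn_ge0.
  have -> : (2 * K1 + K2) * (normc c * rn v ^+ 2) = K1 * (normc c * rn v ^+ 2)
    + K1 * (normc c * rn v ^+ 2) + K2 * (normc c * rn v ^+ 2) by ring.
  by move: H2 H3 H4 H5; clear; lra.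
- move=> v vr; have := L (p + v) p; rewrite addrAC subrr add0r rn0.
  move=> /(_ _ _)/wrap[||H].
  + by move: vr r0; clear; lra.
  + by rewrite divr_gt0.
  + apply: (le_trans H); rewrite ler_wpM2r ?rn_ge0//.
    by move: K10 K20; clear; lra.
Qed.

(** Convergence is asked for on the ball of radius [2 * r], since the second difference evaluates at
    [p + v + u]. *)
Lemma quasi_limit (f : nat -> E -> C) (g : E -> C) p (r K : R) :
  (forall k, quasi (f k) p r K) ->
  (forall q, rn (q - p) < 2 * r -> cvgC (f^~ q) (g q)) -> quasi g p r K.
Proof.
move=> Hf Hg.
have G1 v : rn v < r -> cvgC (f^~ (p + v)) (g (p + v)).
  move=> vr; apply: Hg; rewrite addrAC subrr add0r.
  by move: vr (rn_ge0 v); clear; lra.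
have G0 v : rn v < r -> cvgC (f^~ p) (g p).
  move=> vr; apply: Hg; rewrite subrr rn0.
  by move: vr (rn_ge0 v); clear; lra.
split.
- move=> u v ur vr.
  have G2 : cvgC (f^~ (p + v + u)) (g (p + v + u)).
    apply: Hg; rewrite -(addrA p) addrAC subrr add0r.
    by apply: (le_lt_trans (rnD_le _ _)); move: ur vr; clear; lra.
  apply: (cvgC_bound (cvgCD (cvgCB (cvgCB G2 (G1 _ vr)) (G1 _ ur)) (G0 _ ur))) => k.
  exact: (quasi_second (Hf k)).
- move=> c v c1 vr; have cv : rn (c *: v) < r.
    by apply: le_lt_trans vr; rewrite rnZ ler_piMl ?rn_ge0.
  apply: (cvgC_bound (cvgCB (cvgCB (G1 _ cv) (G0 _ cv)) (cvgCZ c (cvgCB (G1 _ vr) (G0 _ vr))))) => k.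
  exact: (quasi_ratio (Hf k)).
- move=> v vr; apply: (cvgC_bound (cvgCB (G1 _ vr) (G0 _ vr))) => k.
  exact: (quasi_lip (Hf k)).
Qed.

Lemma quasi_cint (f : R -> E -> C) p (r K : R) :
  (forall t, 0 <= t <= 1 -> quasi (f t) p r K) ->
  (forall q, rn (q - p) < 2 * r -> cont_on (f^~ q) 0 1) ->
  quasi (fun q => cint (f^~ q) 0 1) p r K.
Proof.
move=> Hf Hg.
have G1 v : rn v < r -> cont_on (f^~ (p + v)) 0 1.
  move=> vr; apply: Hg; rewrite addrAC subrr add0r.
  by move: vr (rn_ge0 v); clear; lra.
have G0 v : rn v < r -> cont_on (f^~ p) 0 1.
  move=> vr; apply: Hg; rewrite subrr rn0.
  by move: vr (rn_ge0 v); clear; lra.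
have cB g h : cont_on g 0 1 -> cont_on h 0 1 -> cont_on (fun t : R => g t - h t : C) 0 1.
  by move=> cg ch t t01; exact: rcontB (cg _ t01) (ch _ t01).
have cA g h : cont_on g 0 1 -> cont_on h 0 1 -> cont_on (fun t : R => g t + h t : C) 0 1.
  by move=> cg ch t t01; exact: rcontD (cg _ t01) (ch _ t01).
have cZ c g : cont_on g 0 1 -> cont_on (fun t : R => c * g t : C) 0 1.
  by move=> cg t t01; exact: rcontM (rcont_cst c t) (cg _ t01).
have bnd g (M : R) : cont_on g 0 1 -> (forall t : R, 0 <= t <= 1 -> normc (g t) <= M) ->
    normc (cint g 0 1) <= M.
  by move=> cg gM; have := cint_bound ler01 cg gM; rewrite subr0 mulr1.
split.
- move=> u v ur vr.
  have G2 : cont_on (f^~ (p + v + u)) 0 1.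
    apply: Hg; rewrite -(addrA p) addrAC subrr add0r.
    by apply: (le_lt_trans (rnD_le _ _)); move: ur vr; clear; lra.
  have c1 := cB _ _ G2 (G1 _ vr); have c2 := cB _ _ c1 (G1 _ ur).
  rewrite -cintB//; last exact: G1.
  rewrite -cintB//; last exact: G1.
  rewrite -cintD//; last exact: (G0 u).
  apply: bnd; first exact: cA c2 (G0 _ ur).
  by move=> t t01; exact: (quasi_second (Hf _ t01)).
- move=> c v c1 vr; have cv : rn (c *: v) < r.
    by apply: le_lt_trans vr; rewrite rnZ ler_piMl ?rn_ge0.
  have d1 := cB _ _ (G1 _ cv) (G0 _ cv); have d2 := cB _ _ (G1 _ vr) (G0 _ vr).
  rewrite -cintB//; [|exact: G1|exact: (G0 v)].
  rewrite -cintB//; [|exact: G1|exact: (G0 v)].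
  rewrite -cintZ// -cintB//; last exact: cZ.
  apply: bnd; first exact: cB d1 (cZ c _ d2).
  by move=> t t01; exact: (quasi_ratio (Hf _ t01)).
- move=> v vr; have d2 := cB _ _ (G1 _ vr) (G0 _ vr).
  rewrite -cintB//; [|exact: G1|exact: (G0 v)].
  apply: bnd => // t t01; exact: (quasi_lip (Hf _ t01)).
Qed.

(** [quasi_ratio] divided by [c], as [c] tends to 0 through the positive reals [m]. *)
Lemma quasi_second_order (f : E -> C) p (r K : R) v d : 0 <= K -> quasi f p r K ->
  dder f p v d -> rn v < r -> normc (f (p + v) - f p - d) <= K * rn v ^+ 2.
Proof.
move=> K0 Hf Dv vr; apply/ler_addgt0Pl => e e0.
have [a a0 Ha] := Dv _ e0; pose m := Num.min a 1 / 2.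
have mn0 : 0 < Num.min a 1 by rewrite lt_min a0 ltr01.
have m0 : 0 < m by rewrite divr_gt0.
have : m < Num.min a 1 by rewrite ltr_pdivrMr// ltr_pMr// ltr1n.
rewrite lt_min => /andP[ma /ltW m1].
have hm : normc (m%:C%C : C) = m by rewrite normc_real gtr0_norm.
have := Ha m%:C%C; rewrite hm add0r scale0r addr0 => /(_ ma) H1.
have := quasi_ratio Hf (c := m%:C%C) (v := v); rewrite hm => /(_ m1 vr) H2.
rewrite -(ler_pM2r m0) mulrDl -{1}hm mulrC -normcM.
have -> : m%:C%C * (f (p + v) - f p - d) = (f (p + m%:C%C *: v) - f p - m%:C%C * d)
  - (f (p + m%:C%C *: v) - f p - m%:C%C * (f (p + v) - f p)) by ring.
apply: (le_trans (normcB_le _ _)).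
have -> : K * rn v ^+ 2 * m = K * (m * rn v ^+ 2) by ring.
exact: lerD.
Qed.

(** By [quasi_ratio] the difference quotients at [c] and at any smaller [c'] differ by O(|c|). Those
    at [s / 2 ^+ k] thus form a Cauchy sequence, whose limit is within O(|h|) of the quotient at
    every small [h]. *)
Lemma quasi_dder (f : E -> C) p (r K : R) v : 0 < r -> 0 <= K -> quasi f p r K ->
  exists d, dder f p v d.
Proof.
move=> r0 K0 Hf; have v1 : 0 < rn v + 1 by rewrite ltr_wpDl ?rn_ge0.
pose s := r / 2 / (rn v + 1); have s0 : 0 < s by rewrite !divr_gt0.
have small (c : C) : normc c <= s -> rn (c *: v) < r.
  move=> cs; rewrite rnZ; apply: (@le_lt_trans _ _ (s * (rn v + 1))).
    by rewrite ler_pM ?normc_ge0 ?rn_ge0// lerDl.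
  by rewrite /s divfK ?gt_eqF// ltr_pdivrMr// ltr_pMr// ltr1n.
pose q (c : C) := (f (p + c *: v) - f p) / c.
have Q (c c' : C) : c != 0 -> c' != 0 -> normc c' <= normc c -> normc c <= s ->
    normc (q c' - q c) <= K * (normc c * rn v ^+ 2).
  move=> c0 c'0 cc cs; have nc := normc_gt0 c0; have nc' := normc_gt0 c'0.
  have := quasi_ratio Hf (c := c' / c) (v := c *: v).
  rewrite scalerA divfK// normcM normcV ler_pdivrMr// mul1r => /(_ cc (small _ cs)).
  have -> : f (p + c' *: v) - f p - c' / c * (f (p + c *: v) - f p) = c' * (q c' - q c).
    by rewrite /q; field; rewrite c0.
  rewrite normcM rnZ.
  have -> : K * (normc c' / normc c * (normc c * rn v) ^+ 2) =
    normc c' * (K * (normc c * rn v ^+ 2)) by field; rewrite gt_eqF.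
  by rewrite ler_pM2l.
pose m k : C := (s / 2 ^+ k)%:C%C.
have p0 k : 0 < s / 2 ^+ k by rewrite divr_gt0// exprn_gt0.
have nm k : normc (m k) = s / 2 ^+ k by rewrite normc_real gtr0_norm.
have m0 k : m k != 0.
  by apply/eqP => h; have := nm k; rewrite h normc0 => /eqP; rewrite lt_eqF.
have ms k : normc (m k) <= s.
  by rewrite nm ler_pdivrMr ?exprn_gt0// ler_peMr ?(ltW s0)// exprn_ege1// ler1n.
have V0 : 0 < K * rn v ^+ 2 + 1 by rewrite ltr_wpDl// mulr_ge0 ?sqr_ge0.
have [|d Hd] := @cauchyC_cvg (fun k => q (m k)).
  move=> e e0; have [N HN] := pow2_small (ltW s0) (divr_gt0 e0 V0).
  exists N => k Nk; apply: (le_trans (Q (m N) (m k) _ _ _ _)) => //.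
    by rewrite !nm ler_pM2l// lef_pV2 ?posrE ?exprn_gt0// ler_eXn2l ?ltr1n.
  have := HN N (leqnn N); rewrite nm => h.
  rewrite mulrCA; apply: (@le_trans _ _ (s / 2 ^+ N * (K * rn v ^+ 2 + 1))).
    by rewrite ler_pM2l// lerDl.
  by rewrite -ler_pdivlMr// ltW.
exists d => e e0; exists (Num.min s (e / (K * rn v ^+ 2 + 1))).
  by rewrite lt_min s0 divr_gt0.
move=> h; rewrite lt_min => /andP[hs he]; rewrite add0r scale0r addr0.
have [->|h0] := eqVneq h 0; first by rewrite scale0r addr0 subrr mul0r subr0 !normc0 mulr0.
have nh := normc_gt0 h0.
have -> : f (p + h *: v) - f p - h * d = h * (q h - d) by rewrite /q; field.
rewrite normcM mulrC ler_pM2r// normcBC.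
apply: (@le_trans _ _ (K * (normc h * rn v ^+ 2))).
  have [N HN] := pow2_small (ltW s0) nh.
  apply/ler_addgt0Pl => e' e'0; have [N' HN'] := Hd _ e'0.
  pose k := maxn N N'.
  have Q1 := Q h (m k) h0 (m0 k) _ (ltW hs).
  have {}Q1 := Q1 (eq_ind_r (fun x => x <= _) (ltW (HN _ (leq_maxl _ _))) (nm k)).
  have Q2 := HN' k (leq_maxr _ _).
  apply: (le_trans (normc_dist_le _ _ (q (m k)))).
  by rewrite normcBC; exact: lerD.
rewrite mulrCA; apply: (@le_trans _ _ (normc h * (K * rn v ^+ 2 + 1))).
  by rewrite ler_pM2l// lerDl.
by rewrite -ler_pdivlMr// ltW.
Qed.

(** The directional derivative [D] is homogeneous by the chain rule, additive by [quasi_second] and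
    continuous by [quasi_lip]; [quasi_second_order] makes it a Frechet derivative. *)
Lemma quasi_differentiable (f : E -> C) p (r K : R) : 0 < r -> 0 <= K ->
  quasi f p r K -> differentiable f p.
Proof.
move=> r0 K0 Hf.
pose D v := xget 0 [set d | dder f p v d].
have HD v : dder f p v (D v).
  have [d Hd] := quasi_dder v r0 K0 Hf.
  exact: (@xgetPex _ 0 [set d | dder f p v d] (ex_intro _ _ Hd)).
have DZ (c : C) v : D (c *: v) = c * D v.
  apply: (cder_unique (HD _)).
  have S : cder (fun z : C => z * c) 0 c.
    have := gderZ c (cder_id (0 : C)); rewrite mulr1.
    by apply: gder_eq => z; rewrite mulrC.
  have D0 : cder (fun z => f (p + z *: v)) (0 * c) (D v) by rewrite mul0r; exact: HD.
  have := @gder_comp _ _ (fun h : C => h) _ (fun z : C => z * c) _ _ _ D0 S.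
  by apply: gder_eq => z; rewrite scalerA.
have small v : 0 < r / (rn v + 1) by rewrite divr_gt0// ltr_wpDl ?rn_ge0.
have smallP (h : C) v : normc h < r / (rn v + 1) -> rn (h *: v) < r.
  move=> hr; rewrite rnZ; apply: (@le_lt_trans _ _ (normc h * (rn v + 1))).
    by rewrite ler_wpM2l ?normc_ge0// lerDl.
  by rewrite -ltr_pdivlMr// ltr_wpDl ?rn_ge0.
have DD u v : D (u + v) = D u + D v.
  apply: (cder_unique (HD _)).
  move=> e e0; have e3 : 0 < e / 3 by rewrite divr_gt0.
  have [a a0 Ha] := HD u _ e3; have [b b0 Hb] := HD v _ e3.
  have V0 : 0 < K * (rn u * rn v) + 1 by rewrite ltr_wpDl// !mulr_ge0 ?rn_ge0.
  exists (Num.min (Num.min a b) (Num.min (e / 3 / (K * (rn u * rn v) + 1))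
    (Num.min (r / (rn u + 1)) (r / (rn v + 1))))).
    by rewrite !lt_min a0 b0 !small divr_gt0.
  move=> h; rewrite !lt_min => /andP[/andP[ha hb] /and3P[hc hu hv]].
  have := Ha _ ha; have := Hb _ hb; have := quasi_second Hf (smallP _ _ hu) (smallP _ _ hv).
  rewrite !add0r !scale0r !addr0 => H1 H2 H3.
  have -> : f (p + h *: (u + v)) - f p - h * (D u + D v) =
    (f (p + h *: v + h *: u) - f (p + h *: v) - f (p + h *: u) + f p) +
    ((f (p + h *: v) - f p - h * D v) + (f (p + h *: u) - f p - h * D u)).
    by rewrite scalerDr [h *: u + _]addrC addrA; ring.
  apply: (le_trans (normcD_le _ _)).
  apply: (le_trans (lerD (lexx _) (normcD_le _ _))).
  have H4 : K * (rn (h *: u) * rn (h *: v)) <= e / 3 * normc h.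
    rewrite !rnZ; have -> : K * (normc h * rn u * (normc h * rn v)) =
      (normc h * (K * (rn u * rn v))) * normc h by ring.
    rewrite ler_wpM2r ?normc_ge0//.
    apply: (@le_trans _ _ (normc h * (K * (rn u * rn v) + 1))).
      by rewrite ler_wpM2l ?normc_ge0// lerDl.
    by rewrite -ler_pdivlMr// ltW.
  by move: H1 H2 H3 H4; clear; lra.
have est v : rn v < r -> normc (f (p + v) - f p - D v) <= K * rn v ^+ 2.
  exact: quasi_second_order (HD v).
have Dlip v : normc (D v) <= K * rn v.
  apply: (@cder_le_lip _ 0 _ _ (r / (rn v + 1)) _ (HD v)) => // h hr.
  rewrite add0r scale0r addr0; apply: (le_trans (quasi_lip Hf (smallP _ _ hr))).
  by rewrite rnZ; have -> : K * (normc h * rn v) = K * rn v * normc h by ring.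
pose Dl : {linear E -> C} := HB.pack D
  (GRing.isLinear.Build C E C *:%R D (fun c u v => etrans (DD (c *: u) v) (congr1 (fun x => x + D v) (DZ c u)))).
apply: (@differentiable_eps f p Dl).
- move=> v; apply/cvgrPdist_le => e e0.
  have eE : e = (complex.Re e)%:C%C.
    by case: e e0 => a b; rewrite ltcE /= => /andP[/eqP -> _].
  have e1 : 0 < complex.Re e by rewrite -ltcR -eE.
  have K1 : 0 < K + 1 by rewrite ltr_wpDl.
  apply/nbhs_rnP; exists (complex.Re e / (K + 1)); first by rewrite divr_gt0.
  move=> w; rewrite -rnN opprB => wv; rewrite -linearB /= eE normCE lecR.
  apply: (le_trans (Dlip _)); apply: (@le_trans _ _ ((K + 1) * rn (v - w))).
    by rewrite ler_wpM2r ?rn_ge0// lerDl.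
  by rewrite mulrC -ler_pdivlMr// ltW.
- move=> e e0; have K1 : 0 < K + 1 by rewrite ltr_wpDl.
  exists (Num.min r (e / (K + 1))); first by rewrite lt_min r0 divr_gt0.
  move=> h; rewrite lt_min => /andP[hr he]; apply: (le_trans (est _ hr)).
  rewrite expr2 mulrA ler_wpM2r ?rn_ge0//.
  apply: (@le_trans _ _ ((K + 1) * rn h)); first by rewrite ler_wpM2r ?rn_ge0// lerDl.
  by rewrite mulrC -ler_pdivlMr// ltW.
Qed.

Lemma differentiable_gateaux (f : E -> C) p (r : R) :
  (forall q, rn (q - p) < r -> differentiable f q) -> gateaux f p r.
Proof. by move=> H q /H Df v; eexists; exact: diff_dder. Qed.

Lemma bounded_hol_quasi p (r M : R) : 0 < r -> exists2 K : R, 0 <= K &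
  forall f : E -> C, (forall q, rn (q - p) < r -> differentiable f q) ->
  (forall q, rn (q - p) < r -> normc (f q) <= M) -> quasi f p (r / 8) K.
Proof.
move=> r0; have [M0|M0] := lerP 0 M.
  exists (2 * (256 * M / r ^+ 2) + 8 * M / r).
    apply: addr_ge0; last by apply: divr_ge0 (ltW r0); apply: mulr_ge0 M0; exact: ler0n.
    apply: mulr_ge0; first exact: ler0n.
    by apply: divr_ge0; [apply: mulr_ge0 M0; exact: ler0n|exact: sqr_ge0].
  by move=> f Df fM; exact: gateaux_quasi (differentiable_gateaux Df) fM.
exists 0 => // f _ /(_ p); rewrite subrr rn0 => /(_ r0)/(le_trans (normc_ge0 _)).
by rewrite leNgt M0.
Qed.

(** Pointwise convergence also gives convergence of the derivatives, which lets a differential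
    equation pass to the limit. *)
Lemma hol_limit (f : nat -> E -> C) (g : E -> C) p (r M : R) : 0 < r ->
  (forall k q, rn (q - p) < r -> differentiable (f k) q) ->
  (forall k q, rn (q - p) < r -> normc (f k q) <= M) ->
  (forall q, rn (q - p) < r -> cvgC (f^~ q) (g q)) ->
  differentiable g p /\ forall v, cvgC (fun k => 'd (f k) p v) ('d g p v).
Proof.
move=> r0 Df fM fg; have [K K0 HK] := bounded_hol_quasi p M r0.
have Q k : quasi (f k) p (r / 8) K := HK _ (Df k) (fM k).
have Qg : quasi g p (r / 8) K.
  apply: (quasi_limit Q) => q qp; apply: fg; move: qp r0; clear; lra.
have r8 : 0 < r / 8 by rewrite divr_gt0.
have Dg := quasi_differentiable r8 K0 Qg.
split=> // v e e0.
have v1 : 0 < rn v + 1 by rewrite ltr_wpDl ?rn_ge0.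
have V0 : 0 < K * rn v ^+ 2 + 1 by rewrite ltr_wpDl// mulr_ge0 ?sqr_ge0.
have e4 : 0 < e / 4 by rewrite divr_gt0.
(* The derivatives are compared through difference quotients of step [m], so small that each second
   order remainder is at most [e / 4 * m]; the remaining two quarters go to the convergence at
   [p + w] and at [p]. *)
pose m := Num.min (r / 16 / (rn v + 1)) (e / 4 / (K * rn v ^+ 2 + 1)).
have m0 : 0 < m by rewrite lt_min !divr_gt0.
have hm : normc (m%:C%C : C) = m by rewrite normc_real gtr0_norm.
pose w := m%:C%C *: v.
have wr : rn w < r / 8.
  rewrite rnZ hm; apply: (@le_lt_trans _ _ (m * (rn v + 1))).
    by rewrite ler_pM2l// lerDl.
  apply: (@le_lt_trans _ _ (r / 16)); last by move: r0; clear; lra.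
  by rewrite -ler_pdivlMr// ge_min lexx.
have dw h : differentiable h p -> 'd h p w = m%:C%C * ('d h p v : C).
  by move=> _; rewrite /w linearZ.
have D0 k : differentiable (f k) p by apply: Df; rewrite subrr rn0.
have Kw : K * rn w ^+ 2 <= e / 4 * m.
  rewrite rnZ hm; have -> : K * (m * rn v) ^+ 2 = m * (K * rn v ^+ 2) * m by ring.
  rewrite ler_pM2r//; apply: (@le_trans _ _ (m * (K * rn v ^+ 2 + 1))).
    by rewrite ler_pM2l// lerDl.
  by rewrite -ler_pdivlMr// ge_min lexx orbT.
have Ek k := quasi_second_order K0 (Q k) (diff_dder w (D0 k)) wr.
have Eg := quasi_second_order K0 Qg (diff_dder w Dg) wr.
have em : 0 < e / 4 * m by rewrite mulr_gt0.
have [|N1 H1] := fg (p + w) _ _ em.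
  by rewrite addrAC subrr add0r; move: wr r0; clear; lra.
have [|N2 H2] := fg p _ _ em; first by rewrite subrr rn0.
exists (maxn N1 N2) => k; rewrite geq_max => /andP[/H1 k1 /H2 k2].
have key (A A' B B' x y z t : C) : z = m%:C%C * x -> t = m%:C%C * y ->
    normc (A - A' - z) <= e / 4 * m -> normc (B - B' - t) <= e / 4 * m ->
    normc (A - B) <= e / 4 * m -> normc (A' - B') <= e / 4 * m -> normc (x - y) <= e.
  move=> zE tE h1 h2 h3 h4; rewrite -(ler_pM2l m0) -{1}hm -normcM mulrBr -zE -tE.
  have -> : z - t = (A - B) - (A' - B') - (A - A' - z) + (B - B' - t) by ring.
  apply: (le_trans (normcD_le _ _)); apply: (le_trans (lerD (normcB_le _ _) (lexx _))).
  apply: (le_trans (lerD (lerD (normcB_le _ _) (lexx _)) (lexx _))).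
  by move: h1 h2 h3 h4; clear; lra.
exact: (key _ _ _ _ _ _ _ _ (dw (f k) (D0 k)) (dw g Dg) (le_trans (Ek k) Kw)
  (le_trans Eg Kw) k1 k2).
Qed.

Lemma hol_cint (f : R -> E -> C) p (r M : R) : 0 < r ->
  (forall t q, 0 <= t <= 1 -> rn (q - p) < r -> differentiable (f t) q) ->
  (forall t q, 0 <= t <= 1 -> rn (q - p) < r -> normc (f t q) <= M) ->
  (forall q, rn (q - p) < r -> cont_on (f^~ q) 0 1) ->
  differentiable (fun q => cint (f^~ q) 0 1) p.
Proof.
move=> r0 Df fM cf; have [K K0 HK] := bounded_hol_quasi p M r0.
have r8 : 0 < r / 8 by rewrite divr_gt0.
apply: (@quasi_differentiable _ p (r / 8) K r8 K0); apply: quasi_cint.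
  by move=> t t01; apply: HK => q; [exact: Df|exact: fM].
by move=> q qp; apply: cf; move: qp r0; clear; lra.
Qed.

End RealNorm.
End GateauxHolomorphy.

(** * Primitives in the first variable on domains star-shaped about a base point, with parameters *)

Section RayPrimitives.
Variable R : realType.
Local Notation C := (Cx R).

Lemma addBl (V : zmodType) (x y : V) : x + y - x = y.
Proof. by rewrite addrAC subrr add0r. Qed.

Lemma rnC (z : C) : rn z = normc z.
Proof. by rewrite /rn normCE. Qed.

Lemma rn_pair (U W : normedModType C) (q : U * W) : rn q = Num.max (rn q.1) (rn q.2).
Proof.
rewrite {1}/rn prod_normE !rnE; have [h|h] := leP (rn q.1) (rn q.2).
  by rewrite max_r// lecR.
by rewrite max_l// lecR ltW.
Qed.

Lemma rn_fst (U W : normedModType C) (q : U * W) : rn q.1 <= rn q.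
Proof. by rewrite rn_pair le_max lexx. Qed.

Lemma rn_snd (U W : normedModType C) (q : U * W) : rn q.2 <= rn q.
Proof. by rewrite rn_pair le_max lexx orbT. Qed.

Lemma rn_pair_lt (U W : normedModType C) (q : U * W) d :
  rn q.1 < d -> rn q.2 < d -> rn q < d.
Proof. by move=> h1 h2; rewrite rn_pair gt_max h1. Qed.

Lemma rn_pair_le (U W : normedModType C) (q : U * W) d :
  rn q.1 <= d -> rn q.2 <= d -> rn q <= d.
Proof. by move=> h1 h2; rewrite rn_pair ge_max h1. Qed.

Lemma differentiable_affine (E E' : normedModType C) (f : {linear E -> E'})
    (c : E') (K : R) p : (forall v, rn (f v) <= K * rn v) ->
  differentiable (fun q => f q + c) p.
Proof.
move=> fK; have cf : continuous f.
  move=> v; apply/cvgrPdist_le => e e0.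
  have eE : e = (complex.Re e)%:C%C.
    by case: e e0 => a b; rewrite ltcE /= => /andP[/eqP -> _].
  have e1 : 0 < complex.Re e by rewrite -ltcR -eE.
  have K1 : 0 < `|K| + 1 by rewrite ltr_wpDl.
  apply/nbhs_rnP; exists (complex.Re e / (`|K| + 1)); first by rewrite divr_gt0.
  move=> w; rewrite -rnN opprB => wv; rewrite -linearB /= eE rnE lecR.
  apply: (le_trans (fK _)); apply: (@le_trans _ _ ((`|K| + 1) * rn (v - w))).
    rewrite ler_wpM2r ?rn_ge0//; apply: (le_trans (ler_norm _)).
    by rewrite lerDl.
  by rewrite mulrC -ler_pdivlMr// ltW.
exact: (differentiableD (linear_differentiable p cf) (differentiable_cst c p)).
Qed.

Variable W : normedModType C.
Local Notation E := (C * W)%type.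
Variable z0 : C.

Definition ray (t : R) (p : E) : E := (z0 + t%:C%C * (p.1 - z0), p.2).

Lemma ray1 p : ray 1 p = p.
Proof. by case: p => z w; rewrite /ray rmorph1 mul1r addrC subrK. Qed.

Lemma ray0 p : ray 0 p = (z0, p.2).
Proof. by rewrite /ray rmorph0 mul0r addr0. Qed.

Lemma ray_ray s t p : ray s (ray t p) = ray (s * t) p.
Proof. by rewrite /ray /= addBl rmorphM mulrA. Qed.

Lemma differentiable_ray (t : R) p : 0 <= t <= 1 -> differentiable (ray t) p.
Proof.
move=> /andP[t0 t1].
have L : linear (fun q : E => (t%:C%C * q.1, q.2) : E).
  move=> c u v /=; congr (_, _).
  change (t%:C%C * (c * u.1 + v.1) = c * (t%:C%C * u.1) + t%:C%C * v.1).
  by ring.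
pose f : {linear E -> E} := HB.pack (fun q : E => (t%:C%C * q.1, q.2) : E)
  (GRing.isLinear.Build C E E *:%R _ L).
have := @differentiable_affine E E f ((1 - t)%:C%C * z0, 0) 1 p.
have -> : (fun q => f q + ((1 - t)%:C%C * z0, 0)) = ray t.
  apply/funext => q; rewrite /ray /f /=; congr (_, _); last by rewrite addr0.
  change (t%:C%C * q.1 + (1 - t)%:C%C * z0 = z0 + t%:C%C * (q.1 - z0)).
  by rewrite rmorphB rmorph1; ring.
apply=> v; rewrite mul1r; apply: rn_pair_le => /=; last exact: (rn_snd v).
rewrite rnC normcM normc_real ger0_norm//; apply: le_trans (rn_fst v).
by rewrite rnC ler_piMl ?normc_ge0.
Qed.

Variable V : set E.
Hypothesis V_open : open V.
Hypothesis V_ray : forall p t, V p -> 0 <= t <= 1 -> V (ray t p).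

Lemma ray_close t0 p0 (del : R) : 0 < del -> exists2 eta : R, 0 < eta &
  forall t p, `|t - t0| < eta -> rn (p - p0) < eta -> rn (ray t p - ray t0 p0) < del.
Proof.
move=> d0; pose B := normc (p0.1 - z0) + `|t0| + 1.
have B0 : 0 < B by rewrite ltr_wpDl// addr_ge0 ?normc_ge0.
exists (Num.min (del / (2 * B)) (Num.min 1 del)).
  by rewrite !lt_min ltr01 d0 !divr_gt0// mulr_gt0.
move=> t p; rewrite !lt_min => /and3P[t1 t2 _] /and3P[p1 p2 p3].
apply: rn_pair_lt; last exact: le_lt_trans (rn_snd (p - p0)) p3.
rewrite /ray /= rnC.
have -> : z0 + t%:C%C * (p.1 - z0) - (z0 + t0%:C%C * (p0.1 - z0)) =
   (t - t0)%:C%C * (p0.1 - z0) + t%:C%C * (p.1 - p0.1).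
  by rewrite rmorphB; ring.
apply: (le_lt_trans (normcD_le _ _)); rewrite !normcM !normc_real.
have n1 : normc (p.1 - p0.1) < del / (2 * B).
  by rewrite -rnC; apply: (le_lt_trans (rn_fst (p - p0))).
have tB : `|t| < B.
  have := ler_normD (t - t0) t0; rewrite subrK.
  have := normc_ge0 (p0.1 - z0); rewrite /B; move: t2; clear; lra.
have nB : normc (p0.1 - z0) < B.
  by rewrite /B -addrA ltrDl ltr_wpDl.
have h1 : `|t - t0| * normc (p0.1 - z0) <= del / (2 * B) * B.
  by rewrite ler_pM ?normc_ge0// ltW.
have h2 : `|t| * normc (p.1 - p0.1) < B * (del / (2 * B)).
  by rewrite ltr_pM ?normc_ge0.
have h3 : del / (2 * B) * B = del / 2 by field; rewrite gt_eqF.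
rewrite [B * _]mulrC h3 in h2; rewrite h3 in h1.
by move: h1 h2; clear; lra.
Qed.

Lemma open_rn (U : set E) p : open U -> U p ->
  exists2 del : R, 0 < del & forall q, rn (q - p) < del -> U q.
Proof. by move=> oU Up; apply/nbhs_rnP; exact: open_nbhs_nbhs. Qed.

Lemma diff_cont_eps (f : E -> C) p : differentiable f p -> forall e : R, 0 < e ->
  exists2 del : R, 0 < del & forall q, rn (q - p) < del -> normc (f q - f p) <= e.
Proof.
move=> /differentiable_continuous/cvgrPdist_le H e e0.
have eC : 0 < e%:C%C :> C by rewrite ltcR.
have [del d0 Hd] := (nbhs_rnP p _).1 (H _ eC).
by exists del => // q /Hd; rewrite normCE lecR normcBC.
Qed.

(* A point of the segment from [(z0, w)] to [p] has a neighbourhood on which a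
   given holomorphic function is bounded; compactness makes this uniform. *)
Lemma ray_uniform (f : E -> C) p : (forall q, V q -> differentiable f q) -> V p ->
  exists r M : R, 0 < r /\ forall q t, rn (q - p) < r -> 0 <= t <= 1 ->
    V (ray t q) /\ normc (f (ray t q)) <= M.
Proof.
move=> Df Vp.
have := (compact_near_coveringP (`[0, 1]%classic : set R)).1 (@segment_compact R 0 1).
move=> /(_ (E * R)%type (filter_prod (nbhs p) (pinfty_nbhs R))
  (fun i t => V (ray t i.1) /\ normc (f (ray t i.1)) <= i.2) _ _)/wrap[].
  move=> t; rewrite /= in_itv/= => t01.
  have Vt := V_ray Vp t01.
  have [d1 d10 H1] := open_rn V_open Vt.
  have [d2 d20 H2] := diff_cont_eps (Df _ Vt) ltr01.
  have [|eta eta0 H] := @ray_close t p (Num.min d1 d2); first by rewrite lt_min d10.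
  exists (ball t eta, (fun i : E * R => rn (i.1 - p) < eta /\ normc (f (ray t p)) + 1 < i.2)).
    split=> /=; first exact: nbhsx_ballx.
    exists ([set q | rn (q - p) < eta], [set M | normc (f (ray t p)) + 1 < M]).
      split; last by exists (normc (f (ray t p)) + 1); split; first exact: num_real.
      exact: ((nbhs_rnP p [set q | rn (q - p) < eta]).2 (ex_intro2 _ _ eta eta0 (fun q h => h))).
    by move=> [q M] [].
  move=> [s [q M]] [/= ts [qp fM]]; rewrite /ball /= distrC in ts.
  have := H _ _ ts qp; rewrite lt_min => /andP[h1 h2].
  split; first exact: H1.
  have := H2 _ h2; have := normc_ge_sub (f (ray s q)) (f (ray t p)).
  by move: fM; clear; lra.
move=> [[A B] [/= HA [M [_ HM]]] AB]; have [r r0 Hr] := (nbhs_rnP p A).1 HA.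
exists r, (M + 1); split=> // q t qr t01.
have := AB (q, M + 1) (conj (Hr _ qr) (HM (M + 1) _)) t.
by rewrite /= in_itv/= => -[]//; rewrite ltrDl.
Qed.

Definition prim (f : E -> C) (p : E) : C :=
  (p.1 - z0) * cint (fun t => f (ray t p)) 0 1.

Lemma cont_ray (f : E -> C) p : (forall q, V q -> differentiable f q) -> V p ->
  cont_on (fun t => f (ray t p)) 0 1.
Proof.
move=> Df Vp t t01 e e0; have Vt := V_ray Vp t01.
have [d d0 H] := diff_cont_eps (Df _ Vt) e0.
have [eta eta0 He] := @ray_close t p d d0.
by exists eta => // s st; apply: H; apply: He => //; rewrite subrr rn0.
Qed.

Lemma differentiable_fst (U W' : normedModType C) (p : U * W') :
  differentiable (fun q : U * W' => q.1) p.
Proof.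
have L : linear (fun q : U * W' => q.1) by [].
pose f : {linear (U * W')%type -> U} := HB.pack (fun q : U * W' => q.1)
  (GRing.isLinear.Build C (U * W')%type U *:%R _ L).
have := @differentiable_affine (U * W')%type U f 0 1 p.
have -> : (fun q => f q + 0) = (fun q => q.1) by apply/funext => q; rewrite addr0.
by apply=> v; rewrite mul1r; exact: rn_fst.
Qed.

Lemma differentiable_prim (f : E -> C) p : (forall q, V q -> differentiable f q) ->
  V p -> differentiable (prim f) p.
Proof.
move=> Df Vp; have [r [M [r0 H]]] := ray_uniform Df Vp.
have V' q : rn (q - p) < r -> V q.
  by move=> qp; rewrite -(ray1 q); apply: (H q 1 qp _).1; rewrite ler01 lexx.
have D1 : differentiable (fun q : E => cint (fun t => f (ray t q)) 0 1) p.
  apply: (@hol_cint R E (fun t q => f (ray t q)) p r M r0).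
  - move=> t q t01 qp; have := differentiable_comp (differentiable_ray q t01)
      (Df _ (H _ _ qp t01).1); by [].
  - by move=> t q t01 qp; exact: (H _ _ qp t01).2.
  - by move=> q qp; apply: cont_ray => //; exact: V'.
have D2 : differentiable (fun q : E => q.1 - z0) p.
  exact: (differentiableB (differentiable_fst p) (differentiable_cst z0 p)).
exact: (differentiableM D2 D1).
Qed.

(** Agreement to the left of 1 suffices: beyond 1 the ray may leave [V], where nothing is known. *)
Lemma rder_left_unique (g h : R -> C) d d' : rder g 1 d -> rder h 1 d' ->
  (forall t, 0 <= t <= 1 -> g t = h t) -> d = d'.
Proof.
move=> Dg Dh gh; apply/eqP; rewrite -subr_eq0; apply/eqP/normc_eq0/eqP.
rewrite eq_le normc_ge0 andbT; apply/ler_addgt0Pl => e e0; rewrite addr0.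
have [a a0 Ha] := gderB Dg Dh e0; pose m := Num.min a 1 / 2.
have mn0 : 0 < Num.min a 1 by rewrite lt_min a0 ltr01.
have m0 : 0 < m by rewrite divr_gt0.
have : m < Num.min a 1 by rewrite ltr_pdivrMr// ltr_pMr// ltr1n.
rewrite lt_min => /andP[ma m1].
have := Ha (- m); rewrite normc_real normrN gtr0_norm// => /(_ ma).
rewrite !gh ?ler01 ?lexx// ?subr_ge0 ?(ltW m1)//=; last by rewrite lerBlDr lerDl ltW.
by rewrite !subrr sub0r normcNE normcM normc_real normrN gtr0_norm// mulrC ler_pM2r.
Qed.

Lemma cder_fst (f : E -> C) (z : C) (w : W) : differentiable f ((z, w) : E) ->
  cder (fun x => f (x, w)) z ('d f ((z, w) : E) ((1, 0) : E)).
Proof.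
move=> df; have D := diff_dder ((1, 0) : E) df.
move=> e /D[del d0 Hd]; exists del => // h /Hd.
rewrite !add0r scale0r addr0.
suff -> : ((z, w) : E) + h *: ((1, 0) : E) = (z + h, w) by [].
change ((z + h * 1, w + h *: 0) = (z + h, w) :> E).
by rewrite mulr1 scaler0 addr0.
Qed.

(** As [prim f] is already known to be differentiable, its derivative need only be identified along
    the ray. There [prim f] is, by rescaling the integral, a multiple of a primitive [H] of [f] on
    the ray. At [z0] the ray degenerates and the continuity of [f] is used. *)
Lemma cder_prim (f : E -> C) z w : (forall q, V q -> differentiable f q) ->
  V (z, w) -> cder (fun x => prim f (x, w)) z (f (z, w)).
Proof.
move=> Df Vp; set p := (z, w).
have Dp := cder_fst (differentiable_prim Df Vp).
have [zz0|zz0] := eqVneq z z0; last first.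
  suff <- : 'd (prim f) p (1, 0) = f p by [].
  have cg := cont_ray Df Vp.
  have [H [HH _]] := cintP ler01 cg.
  have Dline : rder (fun t : R => prim f (z0 + t%:C%C * (z - z0), w)) 1
      ((z - z0) * 'd (prim f) p (1, 0)).
    apply: (@rder_cder_line R (fun x => prim f (x, w))).
    by rewrite rmorph1 mul1r [z0 + _]addrC subrK.
  have h1 : 0 <= (1 : R) <= 1 by rewrite ler01 lexx.
  have DH := gderZ (z - z0) (gderB (HH 1 h1) (gder_cst (fun h : R => h%:C%C : C) (H 0) 1)).
  have E1 := rder_left_unique Dline DH.
  rewrite subr0 ray1 in E1; apply: (mulfI (_ : z - z0 != 0)); first by rewrite subr_eq0.
  apply: E1 => t /andP[t0 t1]; rewrite -[(_, w)]/(ray t p) /prim /=.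
  rewrite addBl.
  rewrite mulrAC mulrC; congr (_ * _).
  rewrite -cintZ//; last first.
    by apply: cont_ray => //; apply: V_ray => //; rewrite t0.
  have := @cintE R (fun s => t%:C%C * f (ray s (ray t p))) (fun s => H (s * t)) 0 1 ler01.
  rewrite mul1r mul0r; apply=> s /andP[s0 s1]; rewrite ray_ray.
  have st : 0 <= s * t <= 1 by rewrite mulr_ge0//= mulr_ile1.
  move=> e e0; have [a a0 Ha] := HH _ st _ e0.
  exists a => // h; rewrite normc_real => ha.
  have ht : `|h * t| <= `|h| by rewrite normrM (ger0_norm t0) ler_piMr.
  have := Ha (h * t); rewrite normc_real => /(_ (le_lt_trans ht ha)).
  rewrite mulrDl rmorphM mulrA => /le_trans; apply.
  by rewrite ler_wpM2l// ltW.
subst z => e e0.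
have [d1 d10 H1] := open_rn V_open Vp.
have [d2 d20 H2] := diff_cont_eps (Df _ Vp) e0.
exists (Num.min d1 d2); first by rewrite lt_min d10.
move=> h; rewrite lt_min => /andP[h1 h2].
have rh : rn ((z0 + h, w) - p) = normc h.
  by rewrite rn_pair /= subrr rn0 addrAC subrr add0r max_l ?rn_ge0// rnC.
have Vh : V (z0 + h, w) by apply: H1; rewrite rh.
rewrite /prim /= subrr mul0r subr0 addrAC subrr add0r -mulrBr normcM mulrC.
rewrite ler_wpM2r ?normc_ge0//.
have := @cint_approx R (fun t => f (ray t (z0 + h, w))) (fun t => t%:C%C * f p) (fun=> f p) 0 1 e ler01.
rewrite rmorph1 rmorph0 mul1r mul0r !subr0 mulr1; apply.
- exact: cont_ray.
- by move=> t _; have := rder_line 0 (f p) t; apply: gder_eq => s; rewrite add0r.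
- move=> t /andP[t0 t1]; apply: H2; apply: le_lt_trans h2.
  rewrite rn_pair /ray /= subrr rn0 max_l ?rn_ge0//.
  rewrite rnC !addBl normcM normc_real ger0_norm//.
  by rewrite ler_piMl ?normc_ge0.
Qed.

End RayPrimitives.

(** * Linear differential equations with parameters *)

Section MatrixDerivatives.
Variable R : realType.
Local Notation C := (Cx R).

Definition mcder n k (F : C -> 'M[C]_(n, k)) (z : C) (D : 'M[C]_(n, k)) : Prop :=
  forall i j, cder (fun x => F x i j) z (D i j).

Lemma mcderM n k l (F : C -> 'M[C]_(n, k)) (G : C -> 'M[C]_(k, l)) z DF DG :
  mcder F z DF -> mcder G z DG ->
  mcder (fun x => F x *m G x) z (DF *m G z + F z *m DG).
Proof.
move=> HF HG i j; rewrite !mxE -big_split /=.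
have := gder_sum (index_enum 'I_k) (fun s => gderM (HF i s) (HG s j)).
by apply: gder_eq => x; rewrite mxE.
Qed.

Lemma mcder_cst n k (A : 'M[C]_(n, k)) z : mcder (fun=> A) z 0.
Proof. by move=> i j; rewrite mxE; exact: gder_cst. Qed.

Lemma cder_zero_segment (f : C -> C) (p q : C) :
  (forall t : R, 0 <= t <= 1 -> cder f (p + t%:C%C * (q - p)) 0) -> f q = f p.
Proof.
move=> Df; apply/eqP; rewrite -subr_eq0; apply/eqP/normc_eq0/eqP.
rewrite eq_le normc_ge0 andbT -(mul0r (normc (q - p))).
by apply: (@cder_segment R f (fun=> 0)) => // t _; rewrite normc0.
Qed.

Lemma sum_ge_term (I : finType) (F : I -> R) i : (forall j, 0 <= F j) ->
  F i <= \sum_j F j.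
Proof. by move=> F0; rewrite (bigD1 i)//= lerDl sumr_ge0. Qed.

Lemma geometric_cauchy (u : nat -> C) (X : R) :
  (forall k, normc (u k.+1 - u k) <= X / 2 ^+ k) ->
  (exists l, cvgC u l) /\ forall k, normc (u k - u 0%N) <= 2 * X.
Proof.
move=> H.
have X0 : 0 <= X by have := le_trans (normc_ge0 _) (H 0%N); rewrite expr0 divr1.
have D N m : normc (u (N + m)%N - u N) <= 2 * X / 2 ^+ N - 2 * X / 2 ^+ (N + m).
  elim: m => [|m IH]; first by rewrite addn0 !subrr normc0.
  rewrite addnS; have := H (N + m)%N; have := normc_dist_le (u (N + m).+1) (u N) (u (N + m)%N).
  have -> : X / 2 ^+ (N + m) = 2 * X / 2 ^+ (N + m) - 2 * X / 2 ^+ (N + m).+1.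
    by rewrite exprS; have P0 : (2 ^+ (N + m) : R) != 0 by [rewrite expf_neq0]; field; rewrite P0.
  by move: IH; clear; lra.
have D' N m : normc (u (N + m)%N - u N) <= 2 * X / 2 ^+ N.
  apply: (le_trans (D N m)); rewrite lerBlDr lerDl.
  by rewrite divr_ge0 ?exprn_ge0// mulr_ge0.
split; last first.
  by move=> k; have := D' 0%N k; rewrite add0n expr0 divr1.
apply: cauchyC_cvg => e e0; have [N HN] := @pow2_small R (2 * X) e (mulr_ge0 (ler0n _ 2) X0) e0.
exists N => k Nk; have := D' N (k - N)%N; rewrite subnKC// => /le_trans; apply.
exact: ltW (HN N (leqnn N)).
Qed.

Lemma cvgC_sum (I : Type) (r : seq I) (u : I -> nat -> C) (l : I -> C) :
  (forall i, cvgC (u i) (l i)) ->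
  cvgC (fun k => \sum_(i <- r) u i k) (\sum_(i <- r) l i).
Proof.
move=> H; elim: r => [|i r IH].
  rewrite big_nil; under eq_fun do rewrite big_nil.
  exact: cvgC_cst.
rewrite big_cons; under eq_fun do rewrite big_cons.
exact: (cvgCD (H i) IH).
Qed.

End MatrixDerivatives.

(** * Picard iteration and fundamental matrices, holomorphic in all variables *)

Section LinearODE.
Variables (R : realType) (W : normedModType (Cx R)).
Local Notation C := (Cx R).
Local Notation E := (C * W)%type.
Variables (z0 : C) (V : set E).
Hypothesis V_open : open V.
Hypothesis V_ray : forall p t, V p -> 0 <= t <= 1 -> V (ray z0 t p).

Definition mhol n k (Y : E -> 'M[C]_(n, k)) : Prop :=
  forall i j q, V q -> differentiable (fun x => Y x i j) q.

Section Existence.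
Variables (n : nat) (A : E -> 'M[C]_n).
Hypothesis A_hol : mhol A.

Fixpoint picard (k : nat) : E -> 'M[C]_n :=
  if k is k'.+1 then
    fun p => 1%:M + \matrix_(i, j) prim z0 (fun q => (A q *m picard k' q) i j) p
  else fun=> 0.

Lemma mholM m k l (F : E -> 'M[C]_(m, k)) (G : E -> 'M[C]_(k, l)) :
  mhol F -> mhol G -> mhol (fun q => F q *m G q).
Proof.
move=> HF HG i j q Vq.
have -> : (fun x => (F x *m G x) i j) =
    \sum_(s < k) ((fun x => F x i s) * (fun x => G x s j)).
  by apply/funext => x; rewrite mxE fct_sumE.
by apply: differentiable_sum => s; apply: differentiableM; [exact: HF|exact: HG].
Qed.

Lemma mhol_picard k : mhol (picard k).
Proof.
elim: k => [|k IH] i j q Vq /=.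
  exact: (differentiable_cst ((0 : 'M[C]_n) i j) q).
have -> : (fun x => (1%:M + \matrix_(i, j) prim z0 (fun q => (A q *m picard k q) i j) x) i j) =
   cst ((1%:M : 'M[C]_n) i j) + prim z0 (fun q => (A q *m picard k q) i j).
  by apply/funext => x; rewrite !mxE /=; congr (_ + _); rewrite /prim; under eq_fun do rewrite mxE.
apply: differentiableD => //; apply: (differentiable_prim V_open V_ray) => // x Vx.
exact: (mholM A_hol IH).
Qed.

Lemma mcder_picard k z w : V (z, w) ->
  mcder (fun x => picard k.+1 (x, w)) z (A (z, w) *m picard k (z, w)).
Proof.
move=> Vp i j.
have H := @cder_prim R W z0 V V_open V_ray (fun q => (A q *m picard k q) i j) z w
  (fun q Vq => mholM A_hol (@mhol_picard k) i j Vq) Vp.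
have := gderD (gder_cst (fun h : C => h) ((1%:M : 'M[C]_n) i j) z) H.
rewrite add0r; apply: gder_eq => x /=.
by rewrite !mxE /=; congr (_ + _); rewrite /prim; under [in RHS]eq_fun do rewrite mxE.
Qed.

Lemma rder_along_ray (f : C -> C) (z d : C) (t : R) :
  cder f (z0 + t%:C%C * (z - z0)) d ->
  rder (fun s => f (z0 + s%:C%C * (z - z0))) t ((z - z0) * d).
Proof. exact: rder_cder_line. Qed.

(* The weight [expR (2 n B t)] makes the Picard operator a contraction of
   ratio [1 / 2] along the segment. *)
Lemma picard_step k p (B : R) : 0 <= B -> V p ->
  (forall i j t, 0 <= t <= 1 -> normc (p.1 - z0) * normc (A (ray z0 t p) i j) <= B) ->
  forall i j t, 0 <= t <= 1 ->
  normc (picard k.+1 (ray z0 t p) i j - picard k (ray z0 t p) i j)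
    <= expR (2 * n%:R * B * t) / 2 ^+ k.
Proof.
move=> B0 Vp HB; elim: k => [|k IH] i j t /andP[t0 t1].
  rewrite /= !mxE subr0 expr0 divr1 /prim.
  rewrite (@cintE R _ (fun=> 0) 0 1 ler01); last first.
    move=> s _; rewrite mulmx0 mxE; exact: gder_cst.
  rewrite subrr mulr0 addr0; apply: (@le_trans _ _ 1).
    by case: (i == j); rewrite ?normc1 ?normc0 ?ler01.
  have := expR_ge1Dx (2 * n%:R * B * t); apply: le_trans.
  by rewrite lerDl !mulr_ge0.
pose g s := picard k.+2 (ray z0 s p) i j - picard k.+1 (ray z0 s p) i j.
pose dg s := (p.1 - z0) * \sum_l A (ray z0 s p) i l *
  (picard k.+1 (ray z0 s p) l j - picard k (ray z0 s p) l j).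
have g0 : g 0 = 0.
  by rewrite /g !ray0 /= !mxE /prim /= subrr !mul0r subrr.
rewrite -[X in normc X]subr0 -g0 -/(g t).
apply: (@le_trans _ _ (expR (2 * n%:R * B * t) / 2 ^+ k.+1 - expR (2 * n%:R * B * 0) / 2 ^+ k.+1)); last first.
  by rewrite lerBlDr lerDl divr_ge0 ?expR_ge0// exprn_ge0.
apply: (@rder_mean_value R g dg (fun s => expR (2 * n%:R * B * s) / 2 ^+ k.+1)
  (fun s => n%:R * B * (expR (2 * n%:R * B * s) / 2 ^+ k)) 0 t t0).
- move=> s /andP[s0 st]; have s01 : 0 <= s <= 1 by rewrite s0 (le_trans st).
  have Vs := V_ray Vp s01.
  have D1 := rder_along_ray (mcder_picard k.+1 Vs i j).
  have D2 := rder_along_ray (mcder_picard k Vs i j).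
  have := gderB D1 D2; rewrite -mulrBr !mxE -sumrB /dg.
  by under eq_bigr do rewrite -mulrBr.
- move=> s _.
  have P0 : (2 ^+ k : R) != 0 by rewrite expf_neq0.
  have D1 : is_derive s (1 : R) (fun s : R => 2 * n%:R * B * s) (2 * n%:R * B).
    have -> : (fun s : R => 2 * n%:R * B * s) = (2 * n%:R * B) *: (id : R -> R) by [].
    by apply: is_derive_eq; rewrite -[_ *: _]/(_ * 1) mulr1.
  have D2 : is_derive s (1 : R) (fun s : R => expR (2 * n%:R * B * s))
      (expR (2 * n%:R * B * s) * (2 * n%:R * B)).
    exact: (@is_derive1_comp _ expR (fun s : R => 2 * n%:R * B * s)).
  have -> : (fun s0 : R => expR (2 * n%:R * B * s0) / 2 ^+ k.+1) =
    (2 ^+ k.+1)^-1 *: (fun s : R => expR (2 * n%:R * B * s)).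
    by apply/funext => x; rewrite mulrC.
  apply: is_derive_eq; rewrite -[_ *: _]/(_ * _) exprS.
  by field; rewrite P0.
- move=> s /andP[s0 st]; have s01 : 0 <= s <= 1 by rewrite s0 (le_trans st).
  rewrite /dg mulr_sumr.
  have bigle (F : 'I_n -> C) (M : R) : (forall l, normc (F l) <= M) ->
      normc (\sum_l F l) <= n%:R * M.
    move=> FM; apply: (@le_trans _ _ (\sum_(l < n) normc (F l))).
      elim/big_ind2: _ => [|x1 x2 y1 y2 h1 h2|//]; first by rewrite normc0.
      by apply: (le_trans (normcD_le _ _)); exact: lerD.
    apply: (le_trans (ler_sum _ (fun l _ => FM l))).
    by rewrite sumr_const card_ord mulr_natl.
  rewrite -mulrA; apply: bigle => l; rewrite mulrA normcM.
  apply: ler_pM; rewrite ?normc_ge0//; last exact: IH.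
  by rewrite normcM; exact: HB.
Qed.

Lemma ray_uniform_mx p : V p ->
  exists r B : R, [/\ 0 < r, 0 <= B & forall q t, rn (q - p) < r -> 0 <= t <= 1 ->
    V (ray z0 t q) /\ forall i j, normc (A (ray z0 t q) i j) <= B].
Proof.
move=> Vp.
have /choice[f Hf] (ij : 'I_n * 'I_n) : exists rM : R * R, 0 < rM.1 /\
    forall q t, rn (q - p) < rM.1 -> 0 <= t <= 1 ->
    V (ray z0 t q) /\ normc (A (ray z0 t q) ij.1 ij.2) <= rM.2.
  have [r [M [r0 H]]] := ray_uniform V_open V_ray (fun q => @A_hol ij.1 ij.2 q) Vp.
  by exists (r, M).
have [d d0 Hd] := open_rn V_open Vp.
have f0 ij : 0 <= (f ij).1^-1 by rewrite invr_ge0; apply: ltW; case: (Hf ij).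
(* The inverse of a sum of inverses lies below every radius [(f ij).1], and makes sense for [n = 0]
   too. *)
pose S := \sum_ij (f ij).1^-1 + 1; have S0 : 0 < S by rewrite ltr_wpDl// sumr_ge0.
exists (Num.min S^-1 d), (\sum_ij `|(f ij).2|); split.
- by rewrite lt_min invr_gt0 S0.
- exact: sumr_ge0.
move=> q t; rewrite lt_min => /andP[qS qd] t01; split; first exact: V_ray (Hd _ qd) t01.
move=> i j; have [r0 H] := Hf (i, j).
have [|_ h] := H q t _ t01.
  apply: (lt_le_trans qS); rewrite -[leRHS]invrK lef_pV2 ?posrE ?invr_gt0//.
  apply: (@le_trans _ _ (\sum_ij (f ij).1^-1)); last by rewrite lerDl.
  exact: (@sum_ge_term R _ (fun ij => (f ij).1^-1) (i, j) f0).
apply: (le_trans h); apply: (le_trans (ler_norm _)).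
exact: (@sum_ge_term R _ (fun ij => `|(f ij).2|) (i, j) (fun=> normr_ge0 _)).
Qed.

Lemma picard_estimate p : V p -> exists r X : R, [/\ 0 < r,
  (forall q, rn (q - p) < r -> V q) &
  (forall q, rn (q - p) < r -> forall i j k,
    normc (picard k.+1 q i j - picard k q i j) <= X / 2 ^+ k)].
Proof.
move=> Vp; have [r [B [r0 B0 H]]] := ray_uniform_mx Vp.
pose D := normc (p.1 - z0) + r; have D0 : 0 <= D by rewrite addr_ge0 ?normc_ge0// ltW.
exists r, (expR (2 * n%:R * (D * B) * 1)); split=> //.
  by move=> q qr; rewrite -(ray1 z0 q); apply: (H q 1 qr _).1; rewrite ler01 lexx.
move=> q qr i j k.
have := @picard_step k q (D * B) (mulr_ge0 D0 B0) _ _ i j 1.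
rewrite ray1; apply; last by rewrite ler01 lexx.
- by rewrite -(ray1 z0 q); apply: (H q 1 qr _).1; rewrite ler01 lexx.
- move=> i' j' t t01; apply: ler_pM; rewrite ?normc_ge0//; last exact: (H q t qr t01).2.
  have := normc_dist_le q.1 z0 p.1; have := le_lt_trans (rn_fst (q - p)) qr.
  by rewrite rnC /= /D; lra.
Qed.

(** The iterates converge pointwise and are locally bounded, by the geometric estimate. [hol_limit]
    gives the holomorphy of the limit and the convergence of the derivatives, hence the equation. *)
Theorem ode_exists : exists Y : E -> 'M[C]_n, [/\ mhol Y,
  (forall w, V (z0, w) -> Y (z0, w) = 1%:M) &
  forall z w, V (z, w) -> mcder (fun x => Y (x, w)) z (A (z, w) *m Y (z, w))].
Proof.
pose Y p : 'M[C]_n := \matrix_(i, j) xget 0 [set l | cvgC (fun k => picard k p i j) l].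
have HY p i j : V p -> cvgC (fun k => picard k p i j) (Y p i j).
  move=> Vp; have [r [X [r0 _ H]]] := picard_estimate Vp.
  have pp : rn (p - p) < r by rewrite subrr rn0.
  have [[l Hl] _] := geometric_cauchy (fun k => H p pp i j k).
  rewrite mxE; exact: (@xgetPex _ 0 [set l | cvgC (fun k => picard k p i j) l] (ex_intro _ l Hl)).
have L p i j : V p -> differentiable (fun x => Y x i j) p /\
    forall v, cvgC (fun k => 'd (fun x => picard k x i j) p v) ('d (fun x => Y x i j) p v).
  move=> Vp; have [r [X [r0 Vr H]]] := picard_estimate Vp.
  apply: (@hol_limit R E (fun k x => picard k x i j) (fun x => Y x i j) p r (2 * X) r0).
  - by move=> k q qr; apply: mhol_picard; exact: Vr.
  - move=> k q qr; have := (geometric_cauchy (fun k => H q qr i j k)).2 k.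
    by rewrite [picard 0 q i j]mxE subr0.
  - by move=> q qr; apply: HY; exact: Vr.
exists Y; split.
- by move=> i j q Vq; exact: (L q i j Vq).1.
- move=> w Vw; apply/matrixP => i j.
  apply: (cvgC_unique (cvgC_shift (HY _ i j Vw))).
  have -> : (fun k => picard k.+1 (z0, w) i j) = fun=> (1%:M : 'M[C]_n) i j.
    by apply/funext => k; rewrite /= !mxE /prim /= subrr mul0r addr0.
  exact: cvgC_cst.
- move=> z w Vp i j; have [DY cY] := L (z, w) i j Vp.
  have := cder_fst DY; set d := 'd _ _ _ => Dd.
  suff <- : d = (A (z, w) *m Y (z, w)) i j by [].
  apply: (cvgC_unique (cvgC_shift (cY ((1, 0) : E)))).
  have -> : (fun k => 'd (fun x => picard k.+1 x i j) ((z, w) : E) ((1, 0) : E)) =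
      fun k => \sum_l A (z, w) i l * picard k (z, w) l j.
    apply/funext => k.
    have D1 := cder_fst (@mhol_picard k.+1 i j _ Vp).
    by rewrite (cder_unique D1 (mcder_picard k Vp i j)) mxE.
  rewrite mxE; apply: cvgC_sum => l; apply: cvgCZ; exact: HY.
Qed.

End Existence.

Lemma ray_const (f : C -> C) z w : V (z, w) ->
  (forall x, V (x, w) -> cder f x 0) -> f z = f z0.
Proof.
move=> Vp H; apply: cder_zero_segment => t t01.
by apply: H; have := V_ray Vp t01.
Qed.

(** The inverse [Z] is the transpose of a solution of the adjoint equation: [Z *m Y] has derivative
    0 along the rays and is the identity at [z0]. *)
Theorem ode_fundamental n (A : E -> 'M[C]_n) : mhol A ->
  exists Y Z : E -> 'M[C]_n, [/\ mhol Y, mhol Z,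
    (forall p, V p -> Z p *m Y p = 1%:M),
    (forall z w, V (z, w) -> mcder (fun x => Y (x, w)) z (A (z, w) *m Y (z, w))) &
    (forall z w, V (z, w) -> mcder (fun x => Z (x, w)) z (- (Z (z, w) *m A (z, w))))].
Proof.
move=> HA; have [Y [HY Y0 DY]] := ode_exists HA.
have HB : mhol (fun p => - (A p)^T).
  move=> i j q Vq; have -> : (fun x => (- (A x)^T) i j) = - (fun x => A x j i).
    by apply/funext => x; rewrite !mxE.
  exact: differentiableN (HA j i q Vq).
have [T [HT T0 DT]] := ode_exists HB.
have HZ : mhol (fun p => (T p)^T).
  move=> i j q Vq; have -> : (fun x => (T x)^T i j) = fun x => T x j i.
    by apply/funext => x; rewrite mxE.
  exact: HT.
have DZ z w : V (z, w) -> mcder (fun x => (T (x, w))^T) z (- ((T (z, w))^T *m A (z, w))).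
  move=> Vp i j; have := DT z w Vp j i.
  have -> : (- (A (z, w))^T *m T (z, w)) j i = (- ((T (z, w))^T *m A (z, w))) i j.
    rewrite mulNmx !mxE; congr (- _); apply: eq_bigr => s _; rewrite !mxE; exact: mulrC.
  by apply: gder_eq => x; rewrite mxE.
exists Y, (fun p => (T p)^T); split=> //.
move=> [z w] Vp; have V0 : V (z0, w).
  by have := V_ray Vp (_ : 0 <= 0 <= 1); rewrite ray0 lexx ler01; apply.
apply/matrixP => i j.
rewrite (@ray_const (fun x => ((T (x, w))^T *m Y (x, w)) i j) z w Vp).
  by rewrite Y0// T0// trmx1 mulmx1.
move=> x Vx; have := mcderM (DZ _ _ Vx) (DY _ _ Vx) i j.
by rewrite mulNmx mulmxA addNr mxE.
Qed.

End LinearODE.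

(** * Boundary value problems *)

Section BoundaryValueProblem.
Variables (R : realType) (n : nat).
Local Notation C := (Cx R).
Variables (Sec : set C) (A : C -> 'M[C]_n) (L : 'I_n -> C -> C).

Definition sol (y : C -> 'cV[C]_n) : Prop :=
  forall z, Sec z -> mcder y z (A z *m y z).

Lemma solB y y' : sol y -> sol y' -> sol (fun z => y z - y' z).
Proof.
move=> Hy Hy' z Sz i k.
have -> : (A z *m (y z - y' z)) i k = (A z *m y z) i k - (A z *m y' z) i k.
  by rewrite mulmxBr !mxE.
apply: gder_eq (gderB (Hy z Sz i k) (Hy' z Sz i k)) => x.
by rewrite !mxE.
Qed.

Section Column.
Variable j : 'I_n.

(* [nrm y] is the column [y] divided by the [j]-th diagonal exponential: a
   column of [Y exp(- L)]; it is close to the unit vector [delta_j]. *)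
Definition nrm (y : C -> 'cV[C]_n) (i : 'I_n) (z : C) : C := y z i 0 * expC (- L j z).

(** The factor by which the [i]-th component of [nrm y] is multiplied from [x] to [s] in the
    unperturbed equation, with Lambda alone. *)
Definition gap (i : 'I_n) (s x : C) : C := expC ((L i s - L j s) - (L i x - L j x)).

Lemma gapM i s x t : gap i s x * gap i x t = gap i s t.
Proof. by rewrite /gap -expCD; congr expC; ring. Qed.

Lemma gap_diag s x : gap j s x = 1.
Proof. by rewrite /gap !subrr expC0. Qed.

Lemma nrmB y y' i z : nrm (fun z => y z - y' z) i z = nrm y i z - nrm y' i z.
Proof. by rewrite /nrm !mxE; ring. Qed.

Lemma nrm_eq0 y z : (forall i, nrm y i z = 0) -> y z = 0.
Proof.
move=> H; apply/matrixP => i k; rewrite (ord1 k) mxE; apply: (mulIf (expC_neq0 (- L j z))).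
by rewrite mul0r; exact: H.
Qed.

Variable fw : pred 'I_n.

Definition base (x x' : C) (i : 'I_n) : C := if fw i then x else x'.

(* The datum of the [i]-th component is prescribed at the end from which the
   exponential [gap i] does not grow; [S] stands for a path from [x] to [x']. *)
Record conn (S : set C) (x x' : C) (K e : R) : Prop := Conn {
  conn_l : S x;
  conn_r : S x';
  conn_K : 1 <= K;
  conn_e : 0 <= e;
  conn_bounded : forall y, sol y -> exists B : R, forall s i, S s -> normc (nrm y i s) <= B;
  conn_gap : forall s i, S s -> normc (gap i s (base x x' i)) <= K;
  conn_err : forall y B, sol y -> (forall s i, S s -> normc (nrm y i s) <= B) ->
    forall s i, S s ->
    normc (nrm y i s - gap i s (base x x' i) * nrm y i (base x x' i)) <= e * B }.

(** When the datum sits on the other piece, the estimate passes through the junction [x']: the error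
    made on the other piece is multiplied by the gap on this one, hence the mixed products [K' * e]
    and [K * e']. *)
Lemma conn_comp S x x' K e T x'' K' e' :
  conn S x x' K e -> conn T x' x'' K' e' ->
  conn (S `|` T) x x'' (K * K') (K' * e + K * e').
Proof.
move=> [Sx Sx' K1 e0 bS gS eS] [Tx' Tx'' K1' e0' bT gT eT].
have K0 : 0 <= K by rewrite (le_trans ler01).
have K0' : 0 <= K' by rewrite (le_trans ler01).
split.
- by left.
- by right.
- by rewrite mulr_ege1.
- by rewrite addr_ge0// mulr_ge0.
- move=> y sy; have [B HB] := bS _ sy; have [B' HB'] := bT _ sy.
  exists (Num.max B B') => s i [Ss|Ts]; rewrite le_max.
    by rewrite HB.
  by rewrite HB'// orbT.
- move=> s i; rewrite /base; case: ifPn => fi [Ss|Ts].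
  + apply: (@le_trans _ _ K); last by rewrite ler_peMr.
    by have := gS s i Ss; rewrite /base fi.
  + rewrite -(gapM i s x' x) normcM mulrC; apply: ler_pM; rewrite ?normc_ge0//.
      by have := gS x' i Sx'; rewrite /base fi.
    by have := gT s i Ts; rewrite /base fi.
  + rewrite -(gapM i s x' x'') normcM; apply: ler_pM; rewrite ?normc_ge0//.
      by have := gS s i Ss; rewrite /base (negbTE fi).
    by have := gT x' i Tx'; rewrite /base (negbTE fi).
  + apply: (@le_trans _ _ K'); last by rewrite ler_peMl.
    by have := gT s i Ts; rewrite /base (negbTE fi).
- move=> y B sy HB s i.
  have HS : forall s i, S s -> normc (nrm y i s) <= B by move=> *; apply: HB; left.
  have HT : forall s i, T s -> normc (nrm y i s) <= B by move=> *; apply: HB; right.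
  have B0 : 0 <= B by apply: (le_trans (normc_ge0 (nrm y i x))); apply: HS.
  have h1 : e * B <= (K' * e + K * e') * B.
    by rewrite ler_wpM2r// -[leLHS]addr0 lerD ?ler_peMl// mulr_ge0.
  have h2 : e' * B <= (K' * e + K * e') * B.
    by rewrite ler_wpM2r// -[leLHS]add0r lerD ?ler_peMl// mulr_ge0.
  rewrite /base; case: ifPn => fi [Ss|Ts].
  + by apply: le_trans h1; have := eS y B sy HS s i Ss; rewrite /base fi.
  + have E1 := eT y B sy HT s i Ts; have E2 := eS y B sy HS x' i Sx'.
    have G := gT s i Ts; rewrite /base fi in E1 E2 G.
    have -> : nrm y i s - gap i s x * nrm y i x =
      (nrm y i s - gap i s x' * nrm y i x') + gap i s x' * (nrm y i x' - gap i x' x * nrm y i x).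
      by rewrite -(gapM i s x' x); ring.
    apply: (le_trans (normcD_le _ _)); rewrite normcM addrC mulrDl.
    apply: lerD; first by rewrite -mulrA ler_pM ?normc_ge0.
    by apply: (le_trans E1); rewrite ler_wpM2r// ler_peMl.
  + have E1 := eS y B sy HS s i Ss; have E2 := eT y B sy HT x' i Tx'.
    have G := gS s i Ss; rewrite /base (negbTE fi) in E1 E2 G.
    have -> : nrm y i s - gap i s x'' * nrm y i x'' =
      (nrm y i s - gap i s x' * nrm y i x') + gap i s x' * (nrm y i x' - gap i x' x'' * nrm y i x'').
      by rewrite -(gapM i s x' x''); ring.
    apply: (le_trans (normcD_le _ _)); rewrite normcM mulrDl.
    apply: lerD; last by rewrite -mulrA ler_pM ?normc_ge0.
    by apply: (le_trans E1); rewrite ler_wpM2r// ler_peMl.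
  + by apply: le_trans h2; have := eT y B sy HT s i Ts; rewrite /base (negbTE fi).
Qed.

(** A bound [B] improves to [K * beta + B / 2]. Iterating from the finite bound given by
    [conn_bounded] leads to the fixed point [2 * K * beta]. *)
Lemma conn_apriori S x x' K e y (beta : R) : conn S x x' K e -> e <= 1 / 2 -> sol y ->
  (forall i, normc (nrm y i (base x x' i)) <= beta) ->
  forall s i, S s -> normc (nrm y i s) <= 2 * K * beta.
Proof.
move=> H e2 sy Hb; have [B0 HB0] := conn_bounded H sy.
have K0 : 0 <= K by rewrite (le_trans ler01) ?(conn_K H).
have step B : (forall s i, S s -> normc (nrm y i s) <= B) ->
    forall s i, S s -> normc (nrm y i s) <= K * beta + B / 2.
  move=> HB s i Ss.
  have Bge0 : 0 <= B := le_trans (normc_ge0 _) (HB s i Ss).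
  have E := conn_err H sy HB i Ss.
  have G : normc (gap i s (base x x' i) * nrm y i (base x x' i)) <= K * beta.
    rewrite normcM; apply: ler_pM; rewrite ?normc_ge0//; exact: (conn_gap H).
  have D := normcD_le (nrm y i s - gap i s (base x x' i) * nrm y i (base x x' i))
     (gap i s (base x x' i) * nrm y i (base x x' i)).
  rewrite subrK in D.
  have E' : e * B <= B / 2.
    by rewrite mulrC ler_wpM2l// -[leRHS]mul1r.
  by move: E G D E'; lra.
have iter k : forall s i, S s -> normc (nrm y i s) <= 2 * K * beta + `|B0| / 2 ^+ k.
  elim: k => [|k IH] s i Ss.
    rewrite expr0 divr1; apply: (le_trans (HB0 s i Ss)).
    apply: (le_trans (ler_norm _)); rewrite lerDr.
    have b0 : 0 <= beta by apply: le_trans (Hb i); exact: normc_ge0.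
    by rewrite !mulr_ge0.
  apply: (le_trans (step _ IH s i Ss)).
  have -> : `|B0| / 2 ^+ k.+1 = `|B0| / 2 ^+ k / 2 by rewrite exprS invfM mulrA mulrAC.
  by lra.
move=> s i Ss; apply/ler_addgt0Pl => eps eps0.
have [k Hk] := pow2_small (normr_ge0 B0) eps0.
apply: (le_trans (iter k s i Ss)); rewrite addrC lerD2r.
exact: ltW (Hk k (leqnn k)).
Qed.

Definition bvp (x x' : C) (y : C -> 'cV[C]_n) : Prop :=
  sol y /\ forall i, nrm y i (base x x' i) = (i == j)%:R.

Lemma normc_delta (i : 'I_n) : normc ((i == j)%:R : C) <= 1.
Proof. by case: (i == j); rewrite ?normc1 ?normc0. Qed.

Lemma bvp_bound S x x' K e y : conn S x x' K e -> e <= 1 / 2 -> bvp x x' y ->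
  forall s i, S s -> normc (nrm y i s) <= 2 * K.
Proof.
move=> H e2 [sy Hy] s i Ss; rewrite -[2 * K]mulr1.
by apply: (conn_apriori H e2 sy) => // k; rewrite Hy normc_delta.
Qed.

(** The unit vector [delta_j] is the normalized unperturbed solution: its only non-zero component is
    [j], where the gap is 1. *)
Lemma gap_delta i s x : gap i s x * (i == j)%:R = (i == j)%:R.
Proof. by case: eqVneq => [->|_]; rewrite ?gap_diag ?mulr1// mulr0. Qed.

Lemma bvp_near1 S x x' K e y : conn S x x' K e -> e <= 1 / 2 -> bvp x x' y ->
  forall s i, S s -> normc (nrm y i s - (i == j)%:R) <= e * (2 * K).
Proof.
move=> H e2 Hy s i Ss.
have := conn_err H Hy.1 (bvp_bound H e2 Hy) i Ss.
by rewrite (Hy.2 i) gap_delta.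
Qed.

(** On [S], the difference of the two solutions has zero data at [x]. Its data at [x'] are the
    deviation of [y'] from [delta_j] there, which is an error on [T], at most [e' * (2 * (K * K'))].
    The a priori estimate on [S] then applies. *)
Lemma bvp_extend_r S x x' K e T x'' K' e' y y' :
  conn S x x' K e -> conn T x' x'' K' e' -> e <= 1 / 2 -> K' * e + K * e' <= 1 / 2 ->
  bvp x x' y -> bvp x x'' y' ->
  forall s i, S s -> normc (nrm y' i s - nrm y i s) <= 4 * K ^+ 2 * K' * e'.
Proof.
move=> HS HT e2 et [sy Hy] Hy'; have HST := conn_comp HS HT.
have bnd := bvp_bound HST et Hy'.
have -> : 4 * K ^+ 2 * K' * e' = 2 * K * (e' * (2 * (K * K'))) by ring.
move=> s i Ss; rewrite -nrmB.
apply: (conn_apriori HS e2 (solB Hy'.1 sy)) => // k.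
rewrite nrmB (Hy k) /base; case: ifPn => fk.
  have := Hy'.2 k; rewrite /base fk => ->; rewrite subrr normc0.
  by rewrite !mulr_ge0 ?(conn_e HT)// (le_trans ler01) ?(conn_K HS) ?(conn_K HT).
have := conn_err HT Hy'.1 (fun s i Ts => bnd s i (or_intror Ts)) k (conn_l HT).
rewrite /base (negbTE fk).
by have := Hy'.2 k; rewrite /base (negbTE fk) => ->; rewrite gap_delta.
Qed.

Lemma bvp_extend_l S x x' K e T x'' K' e' y y' :
  conn S x x' K e -> conn T x' x'' K' e' -> e' <= 1 / 2 -> K' * e + K * e' <= 1 / 2 ->
  bvp x' x'' y -> bvp x x'' y' ->
  forall s i, T s -> normc (nrm y' i s - nrm y i s) <= 4 * K' ^+ 2 * K * e.
Proof.
move=> HS HT e2 et [sy Hy] Hy'; have HST := conn_comp HS HT.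
have bnd := bvp_bound HST et Hy'.
have -> : 4 * K' ^+ 2 * K * e = 2 * K' * (e * (2 * (K * K'))) by ring.
move=> s i Ss; rewrite -nrmB.
apply: (conn_apriori HT e2 (solB Hy'.1 sy)) => // k.
rewrite nrmB (Hy k) /base; case: ifPn => fk; last first.
  have := Hy'.2 k; rewrite /base (negbTE fk) => ->; rewrite subrr normc0.
  by rewrite !mulr_ge0 ?(conn_e HS)// (le_trans ler01) ?(conn_K HS) ?(conn_K HT).
have := conn_err HS Hy'.1 (fun s i Ss => bnd s i (or_introl Ss)) k (conn_r HS).
rewrite /base fk.
by have := Hy'.2 k; rewrite /base fk => ->; rewrite gap_delta.
Qed.

Variables (Y0 Z0 : C -> 'M[C]_n).
Hypothesis Y0_sol : forall z, Sec z -> mcder Y0 z (A z *m Y0 z).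
Hypothesis ZY : forall z, Sec z -> Z0 z *m Y0 z = 1%:M.

Lemma sol_fundamental (c : 'cV[C]_n) : sol (fun z => Y0 z *m c).
Proof.
move=> z Sz; have := mcderM (Y0_sol Sz) (@mcder_cst R n 1 c z).
by rewrite mulmx0 addr0 mulmxA.
Qed.

(** Row [i] is taken at the end where the datum of component [i] is prescribed, so this is the
    matrix of the boundary conditions on the coordinates with respect to [Y0]. *)
Definition bvp_matrix (x x' : C) : 'M[C]_n := \matrix_(i, l) Y0 (base x x' i) i l.

Definition bvp_coef (x x' : C) : 'cV[C]_n :=
  invmx (bvp_matrix x x') *m \col_i ((i == j)%:R * expC (L j (base x x' i))).

Lemma unitmx_inj (M : 'M[C]_n) : (forall c : 'cV[C]_n, M *m c = 0 -> c = 0) -> M \in unitmx.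
Proof.
move=> H; rewrite -unitmx_tr -row_free_unit; apply/inj_row_free => v.
move=> /(congr1 trmx); rewrite trmx_mul trmxK trmx0 => /H/(congr1 trmx).
by rewrite trmxK trmx0.
Qed.

(** A vector of the kernel gives a solution with zero data, which vanishes by the a priori estimate
    with [beta = 0]. *)
Lemma bvp_matrix_unit S x x' K e : conn S x x' K e -> e <= 1 / 2 -> Sec x ->
  bvp_matrix x x' \in unitmx.
Proof.
move=> H e2 Sx; apply: unitmx_inj => c Mc.
have sy := sol_fundamental c.
have Y0c : Y0 x *m c = 0.
  apply: (@nrm_eq0 (fun z => Y0 z *m c)) => i; apply/normc_eq0/eqP.
  rewrite eq_le normc_ge0 andbT -(mulr0 (2 * K)).
  apply: (conn_apriori H e2 sy) (conn_l H) => k.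
  suff -> : nrm (fun z => Y0 z *m c) k (base x x' k) = 0 by rewrite normc0.
  rewrite /nrm; have := congr1 (fun v : 'cV[C]_n => v k 0) Mc; rewrite !mxE.
  by under eq_bigr do rewrite mxE; move=> ->; rewrite mul0r.
by rewrite -[c]mul1mx -(ZY Sx) -mulmxA Y0c mulmx0.
Qed.

Lemma bvp_exists S x x' K e : conn S x x' K e -> e <= 1 / 2 -> Sec x ->
  bvp x x' (fun z => Y0 z *m bvp_coef x x').
Proof.
move=> H e2 Sx; split; first exact: sol_fundamental.
move=> i; have U := bvp_matrix_unit H e2 Sx.
have E : bvp_matrix x x' *m bvp_coef x x' = \col_i ((i == j)%:R * expC (L j (base x x' i))).
  by rewrite /bvp_coef mulmxA mulmxV// mul1mx.
rewrite /nrm; have := congr1 (fun v : 'cV[C]_n => v i 0) E; rewrite !mxE.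
under eq_bigr do rewrite mxE; move=> ->.
by rewrite -mulrA expCN divff ?expC_neq0// mulr1.
Qed.

End Column.
End BoundaryValueProblem.

(** * The error estimate along a curve parametrized by arc length *)

Section CurvePieces.
Variables (R : realType) (n : nat).
Local Notation C := (Cx R).

Lemma cont_on_bounded (g : R -> C) (u v : R) : u <= v -> cont_on g u v ->
  exists B, forall t, u <= t <= v -> normc (g t) <= B.
Proof.
move=> uv cg.
have cg' t : rcont (fun s => g (clamp u v s)) t.
  apply: (@rcont_comp R g (clamp u v) t 1) => //; first by move=> s; exact: clamp_lip.
  by apply: cg; exact: clamp_itv.
have ch : continuous (fun t => normc (g (clamp u v t))).
  move=> t; apply/cvgrPdist_le => e e0; have [a a0 Ha] := cg' t _ e0.
  apply/nbhs_ballP; exists a => //= s; rewrite /ball/= distrC => /Ha.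
  rewrite normcBC; have := normc_ge_sub (g (clamp u v t)) (g (clamp u v s)).
  have := normc_ge_sub (g (clamp u v s)) (g (clamp u v t)).
  rewrite [normc (g (clamp u v s) - _)]normcBC => h1 h2 h3.
  by rewrite ler_norml; apply/andP; split; lra.
have [c _ Hc] := EVT_max uv (continuous_subspaceT ch).
exists (normc (g (clamp u v c))) => t tuv.
by have := Hc t; rewrite in_itv/= clamp_in//; apply.
Qed.

Variables (Sec : set C) (Lam Rm : C -> 'M[C]_n) (L : 'I_n -> C -> C).
Hypothesis Lam_diag : forall z, Sec z -> is_diag_mx (Lam z).
Hypothesis L_der : forall z i, Sec z -> cder (L i) z (expC z * Lam z i i).

Definition odeA (z : C) : 'M[C]_n := expC z *: (Lam z + Rm z).

Section Piece.
Variables (j : 'I_n) (gamma dgamma : R -> C) (u v : R) (G g : R -> R).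
Hypothesis uv : u <= v.
Hypothesis gamma_der : forall s, u <= s <= v -> rder gamma s (dgamma s).
Hypothesis gamma_speed : forall s, u <= s <= v -> normc (expC (gamma s) * dgamma s) = 1.
Hypothesis gamma_Sec : forall s, u <= s <= v -> Sec (gamma s).
Hypothesis G_der : forall s, u <= s <= v -> is_derive s 1 G (g s).
Hypothesis g_bound : forall s i l, u <= s <= v -> normc (Rm (gamma s) i l) <= g s.

(** An integrating factor: up to a constant, the product is [y i * expC (- L i)], in whose
    derivative the diagonal part cancels and [Rm] alone remains. *)
Lemma cder_gap_nrm y i w z : sol Sec odeA y -> Sec z ->
  cder (fun x => gap L j i w x * nrm L j y i x) z
    (gap L j i w z * (expC z * \sum_l Rm z i l * nrm L j y l z)).
Proof.
move=> sy Sz; set c := L i w - L j w.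
have E x : gap L j i w x * nrm L j y i x = expC c * (y x i 0 * expC (- L i x)).
  rewrite /gap /nrm -/c mulrCA [in RHS]mulrCA -!expCD; congr (_ * expC _).
  by ring.
have DL := gderN (L_der i Sz).
have DE := @gder_comp _ _ (fun h : C => h) (@expC R) (fun x => - L i x) z _ _ (cder_expC _) DL.
have := gderZ (expC c) (gderM (sy z Sz i 0) DE).
set d := (X in gder _ _ _ X); suff -> : d =
  gap L j i w z * (expC z * \sum_l Rm z i l * nrm L j y l z).
  by apply: gder_eq => x; rewrite E.
rewrite /d mxE {d}.
have -> : \sum_l odeA z i l * y z l 0 =
    expC z * (Lam z i i * y z i 0) + expC z * \sum_l Rm z i l * y z l 0.
  rewrite -mulrDr -(_ : \sum_l Lam z i l * y z l 0 = Lam z i i * y z i 0).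
    rewrite -big_split mulr_sumr /=; apply: eq_bigr => l _.
    by rewrite /odeA !mxE; ring.
  rewrite (bigD1 i)//= big1 ?addr0// => l li.
  by rewrite (is_diag_mxP (Lam_diag Sz)) ?mul0r// eq_sym.
have -> : \sum_l Rm z i l * nrm L j y l z = (\sum_l Rm z i l * y z l 0) * expC (- L j z).
  by rewrite mulr_suml; apply: eq_bigr => l _; rewrite /nrm mulrA.
have -> : gap L j i w z = expC c * (expC (- L i z) * expC (L j z)).
  by rewrite /gap -!expCD; congr expC; rewrite /c; ring.
have e1 : expC (L j z) * expC (- L j z) = 1 by rewrite -expCD subrr expC0.
set S := \sum_l _; transitivity (expC c * expC (- L i z) * (expC z * S) * (expC (L j z) * expC (- L j z))).
  by rewrite e1; ring.
by ring.
Qed.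

Lemma normc_sum_le (F : 'I_n -> C) (M : R) : (forall l, normc (F l) <= M) ->
  normc (\sum_l F l) <= n%:R * M.
Proof.
move=> FM; apply: (@le_trans _ _ (\sum_(l < n) normc (F l))).
  elim/big_ind2: _ => [|x1 x2 y1 y2 h1 h2|//]; first by rewrite normc0.
  by apply: (le_trans (normcD_le _ _)); exact: lerD.
apply: (le_trans (ler_sum _ (fun l _ => FM l))).
by rewrite sumr_const card_ord mulr_natl.
Qed.

Lemma piece_err y (B K : R) i w a b : sol Sec odeA y -> 0 <= K ->
  (forall s l, u <= s <= v -> normc (nrm L j y l (gamma s)) <= B) ->
  u <= a -> a <= b -> b <= v ->
  (forall t, a <= t <= b -> normc (gap L j i w (gamma t)) <= K) ->
  normc (gap L j i w (gamma b) * nrm L j y i (gamma b) -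
         gap L j i w (gamma a) * nrm L j y i (gamma a)) <= K * n%:R * (G b - G a) * B.
Proof.
move=> sy K0 HB ua ab bv HK.
have tin t : a <= t <= b -> u <= t <= v.
  by move=> /andP[h1 h2]; rewrite (le_trans ua)// (le_trans h2).
have -> : K * n%:R * (G b - G a) * B = K * n%:R * B * G b - K * n%:R * B * G a by ring.
apply: (@rder_mean_value R (fun t => gap L j i w (gamma t) * nrm L j y i (gamma t))
  (fun t => dgamma t * (gap L j i w (gamma t) * (expC (gamma t) * \sum_l Rm (gamma t) i l * nrm L j y l (gamma t))))
  (fun t => K * n%:R * B * G t) (fun t => K * n%:R * B * g t) a b ab).
- move=> t tab; have tuv := tin _ tab.
  exact: (@gder_comp _ _ _ (fun x => gap L j i w x * nrm L j y i x) gamma t _ _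
    (cder_gap_nrm i w sy (gamma_Sec tuv)) (gamma_der tuv)).
- move=> t tab; have D := G_der (tin _ tab).
  have -> : (fun t => K * n%:R * B * G t) = (K * n%:R * B) *: G by [].
  exact: is_deriveZ.
- move=> t tab; have tuv := tin _ tab.
  set S := \sum_l _.
  have -> : dgamma t * (gap L j i w (gamma t) * (expC (gamma t) * S)) =
    (expC (gamma t) * dgamma t) * (gap L j i w (gamma t) * S) by ring.
  rewrite normcM gamma_speed// mul1r normcM -!mulrA; apply: ler_pM; rewrite ?normc_ge0 ?HK//.
  apply: normc_sum_le => l; rewrite normcM mulrC.
  by apply: ler_pM; rewrite ?normc_ge0 ?HB ?g_bound.
Qed.

Lemma G_mono a b : u <= a -> a <= b -> b <= v -> G a <= G b.
Proof.
move=> ua ab bv; apply: (@le_derive1 _ G g) => // t /andP[h1 h2];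
  have tuv : u <= t <= v by rewrite (le_trans ua)// (le_trans h2).
  exact: G_der.
have := g_bound j j tuv; apply: le_trans; exact: normc_ge0.
Qed.

Lemma conn_piece (fw : pred 'I_n) (K : R) : 1 <= K ->
  (forall i s t, u <= s -> s <= t -> t <= v ->
     normc (if fw i then gap L j i (gamma t) (gamma s) else gap L j i (gamma s) (gamma t)) <= K) ->
  conn Sec odeA L j fw [set gamma s | s in `[u, v]] (gamma u) (gamma v) K
    (K * n%:R * (G v - G u)).
Proof.
move=> K1 HK; have K0 : 0 <= K by rewrite (le_trans ler01).
have Guv : 0 <= G v - G u by rewrite subr_ge0 G_mono.
split=> //.
- by exists u => //=; rewrite in_itv/= lexx.
- by exists v => //=; rewrite in_itv/= lexx uv.
- by rewrite !mulr_ge0.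
- move=> y sy.
  have /choice[b Hb] (i : 'I_n) : exists B, forall t, u <= t <= v -> normc (nrm L j y i (gamma t)) <= B.
    apply: cont_on_bounded => // t tuv; have Sz := gamma_Sec tuv.
    have D1 := gderN (L_der j Sz).
    have D2 := @gder_comp _ _ (fun h : C => h) (@expC R) (fun x => - L j x) _ _ _ (cder_expC _) D1.
    have D3 := gderM (sy _ Sz i 0) D2.
    exact: (@cder_rcont_comp R (fun x => y x i 0 * expC (- L j x)) gamma t _ _ D3 (gamma_der tuv)).
  exists (\sum_i `|b i|) => z i [s + <-]; rewrite /= in_itv/= => suv.
  apply: (le_trans (Hb i s suv)); apply: (le_trans (ler_norm _)).
  exact: (@sum_ge_term R _ (fun i => `|b i|) i (fun=> normr_ge0 _)).
- move=> z i [s + <-]; rewrite /= in_itv/= => /andP[us sv]; rewrite /base.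
  by case: ifPn => fi; [have := HK i u s|have := HK i s v]; rewrite ?fi ?(negbTE fi); apply.
- move=> y B sy HB z i [s + <-]; rewrite /= in_itv/= => /andP[us sv].
  have HB' s' l : u <= s' <= v -> normc (nrm L j y l (gamma s')) <= B.
    by move=> s'uv; apply: HB; exists s' => //=; rewrite in_itv.
  have B0 : 0 <= B by apply: (le_trans (normc_ge0 (nrm L j y i (gamma u)))); apply: HB'; rewrite lexx.
  (* Taking [gamma s] itself as reference point, where the gap is 1, makes the increment bounded by
     [piece_err] the error of [conn_err]. *)
  have gg x : gap L j i x x = 1 by rewrite /gap subrr expC0.
  rewrite /base; case: ifPn => fi.
    apply: (@le_trans _ _ (K * n%:R * (G s - G u) * B)); last first.
      by rewrite ler_wpM2r// ler_wpM2l ?mulr_ge0// lerD2r G_mono.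
    have := @piece_err y B K i (gamma s) u s sy K0 HB' (lexx _) us sv.
    rewrite gg mul1r; apply=> t /andP[ut ts].
    by have := HK i t s ut ts sv; rewrite fi.
  apply: (@le_trans _ _ (K * n%:R * (G v - G s) * B)); last first.
    by rewrite ler_wpM2r// ler_wpM2l ?mulr_ge0// lerD2l lerN2 G_mono.
  have := @piece_err y B K i (gamma s) s v sy K0 HB' us sv (lexx _).
  rewrite gg mul1r normcBC; apply=> t /andP[st tv].
  by have := HK i s t us st tv; rewrite (negbTE fi).
Qed.

End Piece.
End CurvePieces.

(** * Lebesgue integrals along paths, evaluated by primitives *)

Section LebesgueFTC.
Variable R : realType.
Local Notation C := (Cx R).

(** Continuity relative to [a, b], as opposed to [cont_on]: at the ends 0 and 1, the velocity of a
    C^1 path has no more. *)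
Definition cont_in (g : R -> C) (a b : R) : Prop :=
  forall t, a <= t <= b -> forall e : R, 0 < e -> exists2 del : R, 0 < del &
    forall s, a <= s <= b -> `|s - t| < del -> normc (g s - g t) <= e.

Lemma cont_on_in g a b : cont_on g a b -> cont_in g a b.
Proof. by move=> cg t /cg H e /H[d d0 Hd]; exists d => // s _; exact: Hd. Qed.

Lemma Rintegral_derive (f F : R -> R) (a b : R) : a <= b ->
  (forall t, a <= t <= b -> is_derive t 1 F (f t)) ->
  (forall t, a <= t <= b -> forall e : R, 0 < e -> exists2 del : R, 0 < del &
    forall s, a <= s <= b -> `|s - t| < del -> `|f s - f t| <= e) ->
  \int[lebesgue_measure]_(u in `[a, b]) f u = F b - F a.
Proof.
move=> ab DF cf; have [->|] := eqVneq a b.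
  by rewrite set_itv1 Rintegral_set1 subrr.
move=> anb; have {anb} ltab : a < b by rewrite lt_neqAle anb.
have cF t : a <= t <= b -> F x @[x --> t] --> F t.
  move=> tab; have [D _] := DF _ tab.
  by apply: differentiable_continuous; apply/derivable1_diffP.
rewrite /Rintegral (@continuous_FTC2 R f F a b ltab).
- by rewrite -EFinB.
- apply/subspace_continuousP => t; rewrite /= in_itv/= => tab.
  apply/cvgrPdist_le => e e0; have [d d0 Hd] := cf _ tab _ e0.
  rewrite near_withinE; apply/nbhs_ballP; exists d => //= s.
  rewrite /ball/= distrC => st; rewrite in_itv/= => sab; rewrite distrC; exact: Hd.
- split.
  + move=> t; rewrite in_itv/= => /andP[h1 h2].
    by have [] : is_derive t 1 F (f t) by apply: DF; rewrite !ltW.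
  + by apply: cvg_at_right_filter; apply: cF; rewrite lexx.
  + by apply: cvg_at_left_filter; apply: cF; rewrite lexx andbT.
- move=> t; rewrite in_itv/= => /andP[h1 h2].
  have [D E] : is_derive t 1 F (f t) by apply: DF; rewrite !ltW.
  by rewrite derive1E.
Qed.

Lemma C_integral_derive (f F : R -> C) (a b : R) : a <= b ->
  (forall t, a <= t <= b -> rder F t (f t)) -> cont_in f a b ->
  C_integral `[a, b] f = F b - F a.
Proof.
move=> ab DF cf; rewrite /C_integral.
have IR : \int[lebesgue_measure]_(u in `[a, b]) complex.Re (f u) =
    complex.Re (F b) - complex.Re (F a).
  apply: (@Rintegral_derive (fun u => complex.Re (f u)) (fun u => complex.Re (F u)) a b ab).
    by move=> t /DF/rder_ReIm[].
  move=> t tab e e0; have [d d0 Hd] := cf _ tab _ e0.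
  exists d => // s sab st; rewrite -ReB; exact: le_trans (normr_Re_le _) (Hd _ sab st).
have II : \int[lebesgue_measure]_(u in `[a, b]) complex.Im (f u) =
    complex.Im (F b) - complex.Im (F a).
  apply: (@Rintegral_derive (fun u => complex.Im (f u)) (fun u => complex.Im (F u)) a b ab).
    by move=> t /DF/rder_ReIm[].
  move=> t tab e e0; have [d d0 Hd] := cf _ tab _ e0.
  exists d => // s sab st; rewrite -ImB; exact: le_trans (normr_Im_le _) (Hd _ sab st).
by rewrite IR II; case: (F b) (F a) => [? ?] [? ?].
Qed.

Lemma cont_inM f g a b : cont_in f a b -> cont_in g a b ->
  cont_in (fun s => f s * g s) a b.
Proof.
move=> cf cg t tab e e0; have e3 : 0 < e / 3 by rewrite divr_gt0.
have A1 : 0 < normc (f t) + 1 by rewrite ltr_wpDl ?normc_ge0.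
have A2 : 0 < normc (g t) + 1 by rewrite ltr_wpDl ?normc_ge0.
have [d1 d10 H1] := cf _ tab _ (divr_gt0 e3 A2).
have [d2 d20 H2] := cg _ tab _ (divr_gt0 e3 A1).
have [d3 d30 H3] := cf _ tab _ (@ltr01 R).
exists (Num.min d1 (Num.min d2 d3)); first by rewrite !lt_min d10 d20.
move=> s sab; rewrite !lt_min => /and3P[/(H1 _ sab) h1 /(H2 _ sab) h2 /(H3 _ sab) h3].
have -> : f s * g s - f t * g t =
  (f s - f t) * g t + (f s - f t + f t) * (g s - g t) by ring.
apply: (le_trans (normcD_le _ _)); rewrite !normcM.
have B1 : normc (f s - f t) * normc (g t) <= e / 3.
  apply: (@le_trans _ _ (normc (f s - f t) * (normc (g t) + 1))).
    by rewrite ler_wpM2l ?normc_ge0// lerDl.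
  by rewrite -ler_pdivlMr.
have B2 : normc (f s - f t + f t) * normc (g s - g t) <= e / 3.
  rewrite mulrC; apply: (@le_trans _ _ (normc (g s - g t) * (normc (f t) + 1))).
    rewrite ler_wpM2l ?normc_ge0//.
    by apply: (le_trans (normcD_le _ _)); rewrite addrC lerD2l.
  by rewrite -ler_pdivlMr.
by move: B1 B2 e0; clear; lra.
Qed.

Lemma dpath_rder (g : R -> C) t d : rder g t d -> dpath g t = d.
Proof.
move=> /rder_ReIm[[D1 E1] [D2 E2]]; rewrite /dpath !derive1E E1 E2.
by case: d E1 E2.
Qed.

Lemma dpath_proj (g : R -> C) t d : rder g t d ->
  dpath (@Defs.proj R \o g) t = d * expC (g t).
Proof. by move=> Dg; apply: dpath_rder; exact: (gder_comp (cder_expC _) Dg). Qed.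

Lemma cont_in_eq f g a b : (forall t, a <= t <= b -> f t = g t) ->
  cont_in f a b -> cont_in g a b.
Proof.
move=> fg cf t tab e e0; have [d d0 Hd] := cf _ tab _ e0.
by exists d => // s sab st; rewrite -!fg//; exact: Hd.
Qed.

(* The integral is with respect to [z = e^zeta], while [F] is a function of the
   logarithmic coordinate [zeta]: hence the factor [expC (g t)]. *)
Lemma path_integral_primitive (f F : C -> C) (g dg : R -> C) (a b : R) : a <= b ->
  (forall t, a <= t <= b -> rder g t (dg t)) -> cont_in dg a b ->
  (forall t, a <= t <= b -> cder F (g t) (expC (g t) * f (g t))) ->
  (forall t, a <= t <= b -> rcont (fun s => f (g s)) t) ->
  path_integral f g a b = F (g b) - F (g a).
Proof.
move=> ab Dg cdg DF cf; rewrite /path_integral.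
have E t : a <= t <= b -> f (g t) * dpath (@Defs.proj R \o g) t =
    dg t * (expC (g t) * f (g t)).
  by move=> /Dg D; rewrite (dpath_proj D); ring.
apply: (@C_integral_derive _ (fun t => F (g t)) a b ab).
  move=> t tab; rewrite E//; exact: (gder_comp (DF _ tab) (Dg _ tab)).
apply: (@cont_in_eq (fun t => dg t * (expC (g t) * f (g t)))).
  by move=> t tab; rewrite E.
apply: cont_inM => //; apply: cont_on_in => t tab.
apply: rcontM; last exact: cf.
exact: (rder_rcont (gder_comp (cder_expC _) (Dg _ tab))).
Qed.

End LebesgueFTC.

(** * Geometry of lines and sectors *)

Section Lines.
Variable R : realType.
Local Notation C := (Cx R).

(** This is [- i / (b - i s)], the derivative of [log (b - i s)]. *)
Definition dell (b s : R) : C :=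
  Complex (s / (b ^+ 2 + s ^+ 2)) (- (b / (b ^+ 2 + s ^+ 2))).

Lemma rder_ell (phi b s : R) : 0 < b -> rder (ell phi b) s (dell b s).
Proof.
move=> b0; have Q x : 0 < b ^+ 2 + x ^+ 2 by rewrite ltr_wpDr ?sqr_ge0// exprn_gt0.
have Qn : b ^+ 2 + s ^+ 2 != 0 by rewrite gt_eqF.
have bn : b != 0 by rewrite gt_eqF.
apply: ReIm_rder => /=.
  have -> : (fun x : R => ln (Num.sqrt (b ^+ 2 + x ^+ 2))) =
      2^-1 *: (fun x : R => ln (b ^+ 2 + x ^+ 2)).
    apply/funext => x.
    change (ln (Num.sqrt (b ^+ 2 + x ^+ 2)) = 2^-1 * ln (b ^+ 2 + x ^+ 2)).
    rewrite -[X in _ * ln X](sqr_sqrtr (ltW (Q x))).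
    by rewrite lnXn ?sqrtr_gt0// mulr2n; field.
  have D1 : is_derive s (1 : R) (fun x : R => b ^+ 2 + x ^+ 2) (2 * s).
    apply/is_deriveP => e e0; exists e => // h he.
    have -> : b ^+ 2 + (s + h) ^+ 2 - (b ^+ 2 + s ^+ 2) - h * (2 * s) = h * h by ring.
    by rewrite normrM ler_wpM2r// ltW.
  have D2 := @is_derive1_comp R (@ln R) _ s _ _ (is_derive1_ln (Q s)) D1.
  by apply: is_derive_eq; rewrite -[_ *: _]/(_ * _); field.
have -> : (fun x : R => phi - atan (x / b)) = cst phi - (fun x : R => atan (x / b)).
  by apply/funext => x.
have D1 : is_derive s (1 : R) (fun x : R => x / b) b^-1.
  have -> : (fun x : R => x / b) = b^-1 *: (id : R -> R) by apply/funext => x; rewrite mulrC.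
  by apply: is_derive_eq; rewrite -[_ *: _]/(_ * 1) mulr1.
have D2 := @is_derive1_comp R (@atan R) _ s _ _ (is_derive1_atan (s / b)) D1.
have q1 : 1 + (s / b) ^+ 2 != 0 by rewrite gt_eqF// ltr_wpDr ?sqr_ge0.
apply: is_derive_eq; rewrite sub0r; congr (- _).
by field; rewrite bn Qn.
Qed.

Lemma speed_ell (phi b s : R) : 0 < b -> normc (expC (ell phi b s) * dell b s) = 1.
Proof.
move=> b0; have := proj_ell phi s b0; rewrite /Defs.proj => ->.
have Q : 0 < b ^+ 2 + s ^+ 2 by rewrite ltr_wpDr ?sqr_ge0// exprn_gt0.
have Qn : b ^+ 2 + s ^+ 2 != 0 by rewrite gt_eqF.
rewrite -mulrA normcM normc_expC expR0 mul1r.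
have -> : Complex b (- s) * dell b s = (- 'i%C : C).
  by apply/eqP; rewrite eq_complex /=; apply/andP; split; apply/eqP; field.
by rewrite normcNE normc_i.
Qed.

Lemma ell_sector (I : set R) (a phi b s : R) : 0 < a -> I phi -> a <= b ->
  sector I a (ell phi b s).
Proof.
move=> a0 Iphi ab; have b0 := lt_le_trans a0 ab; exists phi => //.
have : range (ell phi b) (ell phi b s) by exists s.
rewrite range_ell// => -[h1 h2]; split=> //; rewrite h2 ler_wpM2r// invr_ge0.
by rewrite cos_ge0_pihalf//; case/andP: h1 => ? ?; apply/andP; split; lra.
Qed.

Lemma on_ell (phi : R) (z : C) : phi - pi / 2 < complex.Im z < phi + pi / 2 ->
  exists s, z = ell phi (umod z * cos (phi - uarg z)) s.
Proof.
move=> h; have c0 : 0 < cos (phi - uarg z).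
  by rewrite cos_gt0_pihalf//; case/andP: h => ? ?; rewrite /uarg; apply/andP; split; lra.
have B0 : 0 < umod z * cos (phi - uarg z) by rewrite mulr_gt0// expR_gt0.
have : range (ell phi (umod z * cos (phi - uarg z))) z.
  by rewrite range_ell//; split=> //; rewrite mulfK// gt_eqF.
by move=> [s _ zs]; exists s; rewrite zs.
Qed.

Lemma cos_le0_pihalf (x : R) : pi / 2 <= x <= pi + pi / 2 -> cos x <= 0.
Proof.
move=> /andP[h1 h2]; rewrite -(subrK pi x) cosDpi oppr_le0.
by apply: cos_ge0_pihalf; apply/andP; split; lra.
Qed.

(* Two boundary lines whose directions differ by less than [pi] cross; the
   parameters of the crossing point are obtained from
   [b - i s = e^(i del) (b' - i s')], where [del = phi' - phi]. *)
Lemma ell_cross (phi phi' b b' : R) : 0 < b -> 0 < b' -> phi < phi' < phi + pi ->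
  let del := phi' - phi in
  ell phi b ((b * cos del - b') / sin del) = ell phi' b' ((b - b' * cos del) / sin del).
Proof.
move=> b0 b'0 /andP[h1 h2] del.
have d0 : 0 < del by rewrite subr_gt0.
have dpi : del < pi by rewrite /del; lra.
have sd : 0 < sin del by apply: sin_gt0_pi; rewrite d0.
have sn : sin del != 0 by rewrite gt_eqF.
set s := _ / _; set z := ell phi b s.
pose u := atan (s / b).
have [u1 u2] := (atan_gtNpi2 (s / b), atan_ltpi2 (s / b)); rewrite -/u in u1 u2.
have hc := cos_atan_div s b0; have hs := sin_atan_div s b0.
have hm := umod_ell phi s b0; rewrite -/z -/u in hc hs hm.
have m0 : 0 < umod z by exact: expR_gt0.
rewrite -hm in hc hs.
(* The point [z] of the first line lies on the second because its component along e^(i phi') is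
   [b']. *)
have c2 : umod z * cos (del + u) = b'.
  rewrite cosD; have -> : umod z * (cos del * cos u - sin del * sin u) =
    cos del * (umod z * cos u) - sin del * (umod z * sin u) by ring.
  by rewrite hc hs /s; field.
have cpos : 0 < cos (del + u) by rewrite -(pmulr_rgt0 _ m0) c2.
have dlt : del + u < pi / 2.
  rewrite ltNge; apply/negP => ge_; move: cpos; apply/negP; rewrite -leNgt.
  by apply: cos_le0_pihalf; rewrite ge_ /=; lra.
have argz : uarg z = phi - u by [].
have : range (ell phi' b') z.
  rewrite range_ell//; split.
    by rewrite argz; rewrite /del in dlt; apply/andP; split; lra.
  have -> : phi' - uarg z = del + u by rewrite argz /del; ring.
  by rewrite -c2 mulfK// gt_eqF.
(* The parameter [s'] is minus the imaginary part of e^(- i phi') times the point. *)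
move=> [s' _ zs]; rewrite -zs; congr ell.
have := proj_ell phi' s' b'0; rewrite zs /z (proj_ell phi s b0).
move=> /(congr1 (fun x => expC (Complex 0 (- phi') : C) * x)); rewrite !mulrA -!expCD.
have -> : (Complex 0 (- phi') : C) + Complex 0 phi' = 0.
  by apply/eqP; rewrite eq_complex /= addNr addr0 !eqxx.
have -> : (Complex 0 (- phi') : C) + Complex 0 phi = Complex 0 (- del).
  by apply/eqP; rewrite eq_complex /= addr0 eqxx /del opprB addrC /=.
rewrite expC0 mul1r => /(congr1 (@complex.Im R)) /=.
rewrite expR0 cosN sinN !mul1r => E.
have {E} -> : s' = cos del * s + sin del * b by move: E; lra.
rewrite /s; have cs := cos2Dsin2 del.
have -> : sin del * b = b * sin del ^+ 2 / sin del by field.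
have -> : sin del ^+ 2 = 1 - cos del ^+ 2 by move: cs; lra.
by field.
Qed.

End Lines.

Section SectorGeometry.
Variable R : realType.
Local Notation C := (Cx R).

(** The difference of the two sides has derivative [tan x - tan u] up to a constant, so it is least
    at [u]. *)
Lemma ln_cos_tangent (u v : R) : - (pi / 2) < u < pi / 2 -> - (pi / 2) < v < pi / 2 ->
  ln (cos v) <= ln (cos u) - tan u * (v - u).
Proof.
move=> hu hv; pose f x := - tan u * (x - u) - ln (cos x).
have cp (x : R) : - (pi / 2) < x < pi / 2 -> 0 < cos x by exact: cos_gt0_pihalf.
have Df (x : R) : - (pi / 2) < x < pi / 2 -> is_derive x (1 : R) f (tan x - tan u).
  move=> hx; have D1 := @is_derive1_comp R (@ln R) _ x _ _ (is_derive1_ln (cp _ hx)) (is_derive_cos x).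
  have D2 : is_derive x (1 : R) (fun x : R => - tan u * (x - u)) (- tan u).
    apply/is_deriveP => e e0; exists 1 => // h _.
    have -> : - tan u * (x + h - u) - - tan u * (x - u) - h * - tan u = 0 by ring.
    by rewrite normr0 mulr_ge0// ltW.
  have -> : f = (fun x : R => - tan u * (x - u)) - (@ln R \o @cos R) by [].
  apply: is_derive_eq; rewrite /tan; have := cp _ hx => /gt_eqF/negbT c0.
  have cu : cos u != 0 by rewrite gt_eqF ?cp.
  by field; rewrite c0 cu.
have tanB (x y : R) : - (pi / 2) < x < pi / 2 -> - (pi / 2) < y < pi / 2 -> x <= y -> tan x <= tan y.
  move=> hx hy xy; rewrite -subr_ge0.
  have cx := cp _ hx; have cy := cp _ hy.
  have -> : tan y - tan x = sin (y - x) / (cos y * cos x).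
    by rewrite /tan sinB; field; rewrite !gt_eqF.
  apply: divr_ge0; last by rewrite mulr_ge0// ltW.
  by apply: sin_ge0_pi; case/andP: hx => ? ?; case/andP: hy => ? ?; apply/andP; split; lra.
have fu : f u = - ln (cos u) by rewrite /f subrr mulr0 sub0r.
suff : f u <= f v by rewrite fu /f; lra.
case/andP: (hu) => u1 u2; case/andP: (hv) => v1 v2.
have [uv|/ltW vu] := leP u v.
  have ht t : u <= t <= v -> - (pi / 2) < t < pi / 2.
    by move=> /andP[h1 h2]; rewrite (lt_le_trans u1 h1) (le_lt_trans h2 v2).
  apply: (@le_derive1 R f (fun x => tan x - tan u) u v uv) => t tuv; first exact: Df (ht _ tuv).
  by rewrite subr_ge0; apply: tanB => //; [exact: ht|case/andP: tuv].
have ht t : v <= t <= u -> - (pi / 2) < t < pi / 2.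
  by move=> /andP[h1 h2]; rewrite (lt_le_trans v1 h1) (le_lt_trans h2 u2).
rewrite -lerN2.
apply: (@le_derive1 R (fun x => - f x) (fun x => - (tan x - tan u)) v u vu) => t tuv.
  exact: is_deriveN (Df _ (ht _ tuv)).
by rewrite oppr_ge0 subr_le0; apply: tanB => //; [exact: ht|case/andP: tuv].
Qed.

Lemma sectorP (I : set R) (a : R) (z : C) : 0 < a -> sector I a z <->
  exists phi, [/\ I phi, - (pi / 2) < phi - uarg z < pi / 2 &
    ln a <= complex.Re z + ln (cos (phi - uarg z))].
Proof.
move=> a0; split=> [[phi Iphi [h1 h2]]|[phi [Iphi h1 h2]]].
  have h1' : - (pi / 2) < phi - uarg z < pi / 2.
    by case/andP: h1 => ? ?; apply/andP; split; lra.
  exists phi; split=> //; have c0 := cos_gt0_pihalf h1'.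
  rewrite -[complex.Re z](expRK) -lnM ?posrE ?expR_gt0// ler_ln ?posrE// ?mulr_gt0 ?expR_gt0//.
  by rewrite -ler_pdivrMr.
exists phi => //; have c0 := cos_gt0_pihalf h1; split.
  by case/andP: h1 => ? ?; apply/andP; split; lra.
rewrite ler_pdivrMr// -ler_ln ?posrE// ?mulr_gt0 ?expR_gt0// lnM ?posrE ?expR_gt0//.
by rewrite /umod expRK.
Qed.

(* By concavity of [ln cos], in view of [sectorP]. *)
Lemma sector_convex (I : set R) (a : R) (z w : C) (t : R) : 0 < a -> is_interval I ->
  sector I a z -> sector I a w -> 0 <= t <= 1 -> sector I a (z + t%:C%C * (w - z)).
Proof.
move=> a0 Iint /(sectorP _ _ a0)[p [Ip p1 p2]] /(sectorP _ _ a0)[q [Iq q1 q2]] /andP[t0 t1].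
apply/(sectorP _ _ a0).
have ImE : uarg (z + t%:C%C * (w - z)) = (1 - t) * uarg z + t * uarg w.
  by rewrite /uarg; case: (z) (w) => [? ?] [? ?] /=; ring.
have ReE : complex.Re (z + t%:C%C * (w - z)) = (1 - t) * complex.Re z + t * complex.Re w.
  by case: (z) (w) => [? ?] [? ?] /=; ring.
rewrite ImE ReE; exists ((1 - t) * p + t * q).
set u := p - uarg z in p1 p2; set v := q - uarg w in q1 q2.
have -> : (1 - t) * p + t * q - ((1 - t) * uarg z + t * uarg w) = (1 - t) * u + t * v.
  by rewrite /u /v; ring.
have t1' : 0 <= 1 - t by rewrite subr_ge0.
have conv (x y M : R) : x <= M -> y <= M -> (1 - t) * x + t * y <= M.
  move=> hx hy; have h3 := ler_wpM2l t1' hx; have h4 := ler_wpM2l t0 hy.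
  by move: h3 h4; clear; lra.
have conv' (x y M : R) : M <= x -> M <= y -> M <= (1 - t) * x + t * y.
  move=> hx hy; have h3 := ler_wpM2l t1' hx; have h4 := ler_wpM2l t0 hy.
  by move: h3 h4; clear; lra.
have convlt : - (pi / 2) < (1 - t) * u + t * v < pi / 2.
  case/andP: p1 => u1 u2; case/andP: q1 => v1 v2; apply/andP; split.
    apply: (@lt_le_trans _ _ (Num.min u v)); first by rewrite lt_min u1.
    by apply: conv'; rewrite ge_min lexx ?orbT.
  apply: (@le_lt_trans _ _ (Num.max u v)); last by rewrite gt_max u2.
  by apply: conv; rewrite le_max lexx ?orbT.
split=> //.
  have [pq|qp] := leP p q.
    by apply: (Iint p q) => //; apply/andP; split; [exact: conv'|exact: conv].
  by apply: (Iint q p) => //; apply/andP; split; [apply: conv'|apply: conv] => //; exact: ltW.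
set U := (1 - t) * u + t * v in convlt *.
(* Both tangent inequalities are taken at the weighted mean [U] of [u] and [v], where the linear
   terms cancel. *)
have T1 := ln_cos_tangent convlt p1; have T2 := ln_cos_tangent convlt q1.
have S1 := ler_wpM2l t1' (le_trans p2 (lerD (lexx (complex.Re z)) T1)).
have S2 := ler_wpM2l t0 (le_trans q2 (lerD (lexx (complex.Re w)) T2)).
have E : (1 - t) * (u - U) + t * (v - U) = 0 by rewrite /U; ring.
have S3 : (1 - t) * (tan U * (u - U)) + t * (tan U * (v - U)) = 0.
  by transitivity (tan U * ((1 - t) * (u - U) + t * (v - U))); [ring|rewrite E mulr0].
move: S1 S2 S3; rewrite !mulrDr !mulrN; move: (tan U * (u - U)) (tan U * (v - U)) (ln (cos U)).
by move=> X Y Z; clear; lra.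
Qed.

(* Turning the line towards [z] by at most [del] brings its distance to the
   origin up to a fixed fraction of [umod z]. *)
Lemma rotate_line (c d del phi : R) (z : C) : c <= phi <= d -> 0 < del <= pi / 4 ->
  - (pi / 2) < phi - uarg z < pi / 2 ->
  exists psi b s, [/\ c - del <= psi <= d + del, z = ell psi b s & umod z * sin del <= b].
Proof.
move=> /andP[cphi phid] /andP[d0 d4] /andP[h1 h2]; have pi0 := pi_gt0 R.
(* Within [del] of the rim of the half-plane, the direction is turned by [del] towards [z];
   otherwise it is kept. *)
have [psi [psi1 psi2]] : exists psi, c - del <= psi <= d + del /\
    - (pi / 2 - del) <= psi - uarg z <= pi / 2 - del.
  have [l1|l1] := leP (phi - uarg z) (- (pi / 2 - del)).
    by exists (phi + del); split; apply/andP; split; lra.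
  have [l2|l2] := leP (pi / 2 - del) (phi - uarg z).
    by exists (phi - del); split; apply/andP; split; lra.
  by exists phi; split; apply/andP; split; lra.
have /andP[p1 p2] := psi2.
have [|s zs] := @on_ell R psi z.
  by change (psi - pi / 2 < uarg z < psi + pi / 2); apply/andP; split; lra.
exists psi, (umod z * cos (psi - uarg z)), s; split=> //.
rewrite ler_pM2l ?expR_gt0//.
have -> : sin del = cos (pi / 2 - del).
  by rewrite cosB cos_pihalf sin_pihalf mul0r mul1r add0r.
have cosabs (x : R) : cos x = cos `|x|.
  by have [h|h] := leP 0 x; [rewrite ger0_norm|rewrite ltr0_norm// cosN].
rewrite (cosabs (psi - uarg z)).
have ax : `|psi - uarg z| <= pi / 2 - del by rewrite ler_norml p1 p2.
rewrite leNgt ltr_cos ?in_itv/= ?normr_ge0//=; first by rewrite -leNgt.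
- by apply/andP; split; lra.
- by apply: (le_trans ax); lra.
Qed.

(** A bounded nondecreasing function has small increments once it is close to its supremum, or to
    its infimum. *)
Lemma mono_bounded_tail (G : R -> R) (m : R) : (forall u v, u <= v -> 0 <= G v - G u <= m) ->
  forall e, 0 < e -> exists N, 0 <= N /\ forall u v, u <= v ->
    (N <= u \/ v <= - N) -> G v - G u <= e.
Proof.
move=> H e e0.
have mono u v : u <= v -> G u <= G v by move=> /H/andP[h _]; rewrite -subr_ge0.
have bd u v : G v - G u <= m.
  have [/H/andP[]//|/ltW/H/andP[h1 h2]] := leP u v; lra.
have [x Hx] : exists x, sup (range G) - e < G x.
  have hs : has_sup (range G).
    split; first by exists (G 0); exists 0.
    by exists (G 0 + m) => _ [x _ <-]; have := bd 0 x; lra.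
  have [_ [x _ <-] h] := sup_adherent e0 hs.
  by exists x.
have [y Hy] : exists y, G y < inf (range G) + e.
  have hi : has_inf (range G).
    split; first by exists (G 0); exists 0.
    by exists (G 0 - m) => _ [x' _ <-]; have := bd x' 0; lra.
  have [_ [y _ <-] h] := inf_adherent e0 hi.
  by exists y.
exists (Num.max 0 (Num.max x (- y))); split; first by rewrite le_max lexx.
move=> u v uv [|]; rewrite ?ge_max.
  move=> /and3P[_ xu _]; have := mono _ _ xu.
  have : G v <= sup (range G).
    apply: ub_le_sup; last by exists v.
    by exists (G 0 + m) => _ [w _ <-]; have := bd 0 w; lra.
  by lra.
rewrite lerNr ge_max => /andP[_]; rewrite ge_max lerN2 => /andP[_ vy].
have := mono _ _ vy.
have : inf (range G) <= G u.
  apply: ge_inf; last by exists u.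
  by exists (G 0 - m) => _ [w _ <-]; have := bd w 0; lra.
by lra.
Qed.

End SectorGeometry.

(** * Solutions normalized at both ends of a line *)

Section FixedParameter.
Variables (R : realType) (n : nat).
Local Notation C := (Cx R).
Variables (Sec : set C) (Lam Rm : C -> 'M[C]_n) (L : 'I_n -> C -> C).
Hypothesis Lam_diag : forall z, Sec z -> is_diag_mx (Lam z).
Hypothesis L_der : forall z i, Sec z -> cder (L i) z (expC z * Lam z i i).
Local Notation A := (odeA Lam Rm).
Local Notation sol := (sol Sec A).
Variables (Y0 Z0 : C -> 'M[C]_n).
Hypothesis Y0_sol : forall z, Sec z -> mcder Y0 z (A z *m Y0 z).
Hypothesis ZY : forall z, Sec z -> Z0 z *m Y0 z = 1%:M.
Hypothesis sol_unique : forall y, sol y -> forall z x, Sec z -> Sec x ->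
  y z = Y0 z *m (Z0 x *m y x).
Variables (c d be : R).
Hypothesis be0 : 0 < be.
Hypothesis ell_Sec : forall phi b s, c <= phi <= d -> be <= b -> Sec (ell phi b s).
Variables (K : R) (fw : 'I_n -> pred 'I_n).
Hypothesis K1 : 1 <= K.
Hypothesis K_gap : forall j i phi b s t, c <= phi <= d -> be <= b -> s <= t ->
  normc (if fw j i then gap L j i (ell phi b t) (ell phi b s)
         else gap L j i (ell phi b s) (ell phi b t)) <= K.
(* [G phi b] is a primitive of a bound for [Rm] on the line [ell phi b], so that
   [m b] bounds the L^1-norm of [Rm] on it. *)
Variables (G g : R -> R -> R -> R) (m : R -> R).
Hypothesis G_der : forall phi b (s : R), c <= phi <= d -> be <= b ->
  is_derive s 1 (G phi b) (g phi b s).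
Hypothesis g_bound : forall phi b s i l, c <= phi <= d -> be <= b ->
  normc (Rm (ell phi b s) i l) <= g phi b s.
Hypothesis G_total : forall phi b u v, c <= phi <= d -> be <= b -> u <= v ->
  G phi b v - G phi b u <= m b.
Hypothesis m_small : forall b, be <= b -> K * n%:R * m b <= 1 / (6 * K ^+ 2).
Hypothesis m_lim : forall eps, 0 < eps -> exists beta, forall b, beta <= b -> be <= b ->
  m b <= eps.

Let K0 : 0 < K := lt_le_trans ltr01 K1.

Local Notation bvp := (bvp Sec A L).
Local Notation nrm := (nrm L).

Section Column.
Variable j : 'I_n.

Definition seg (phi b u v : R) : set C := [set ell phi b s | s in `[u, v]].
Definition seg_err (phi b u v : R) : R := K * n%:R * (G phi b v - G phi b u).

Lemma conn_seg phi b u v : c <= phi <= d -> be <= b -> u <= v ->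
  conn Sec A L j (fw j) (seg phi b u v) (ell phi b u) (ell phi b v) K (seg_err phi b u v).
Proof.
move=> pJ bb uv; have b0 := lt_le_trans be0 bb.
apply: (@conn_piece R n Sec Lam Rm L Lam_diag L_der j (ell phi b) (dell b) u v
  (G phi b) (g phi b) uv) => //.
- by move=> s _; exact: rder_ell.
- by move=> s _; exact: speed_ell.
- by move=> s _; exact: ell_Sec.
- by move=> s _; exact: G_der.
- by move=> s i l _; exact: g_bound.
- by move=> i s t _ st _; exact: K_gap.
Qed.

Lemma seg_in phi b u v s : u <= s <= v -> seg phi b u v (ell phi b s).
Proof. by move=> h; exists s => //=; rewrite in_itv. Qed.

Lemma seg_err_le phi b u v : c <= phi <= d -> be <= b -> u <= v ->
  seg_err phi b u v <= K * n%:R * m b.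
Proof.
by move=> pJ bb uv; rewrite ler_wpM2l ?G_total// mulr_ge0// ltW.
Qed.

Lemma eta_half : 1 / (6 * K ^+ 2) <= 1 / 2.
Proof.
rewrite !mul1r lef_pV2 ?posrE// ?mulr_gt0 ?exprn_gt0//.
have : 1 <= K ^+ 2 by rewrite exprn_ege1.
by lra.
Qed.

Lemma eta_two (x y : R) : x <= 1 / (6 * K ^+ 2) -> y <= 1 / (6 * K ^+ 2) ->
  K * x + K * y <= 1 / 2.
Proof.
move=> hx hy; have h : K * (1 / (6 * K ^+ 2)) <= 1 / 6.
  have -> : K * (1 / (6 * K ^+ 2)) = 1 / (6 * K) by field; rewrite gt_eqF.
  by rewrite !mul1r lef_pV2 ?posrE ?mulr_gt0// ler_peMr.
have h1 := ler_wpM2l (ltW K0) hx; have h2 := ler_wpM2l (ltW K0) hy.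
by move: h h1 h2; lra.
Qed.

(** The error of three consecutive pieces, grouped as [conn_comp] produces it: three terms, each at
    most [K ^+ 2] times [1 / (6 * K ^+ 2)]. *)
Lemma eta_three (x y z : R) : x <= 1 / (6 * K ^+ 2) -> y <= 1 / (6 * K ^+ 2) ->
  z <= 1 / (6 * K ^+ 2) -> K * (K * x + K * y) + K * K * z <= 1 / 2.
Proof.
move=> hx hy hz; have KK : 0 <= K * K by rewrite mulr_ge0// ltW.
have h : K * K * (1 / (6 * K ^+ 2)) = 1 / 6 by field; rewrite gt_eqF.
have := ler_wpM2l KK hx; have := ler_wpM2l KK hy; have := ler_wpM2l KK hz.
by rewrite h mulrDr !mulrA; lra.
Qed.

Lemma seg_half phi b u v : c <= phi <= d -> be <= b -> u <= v ->
  seg_err phi b u v <= 1 / 2.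
Proof.
move=> pJ bb uv; apply: le_trans eta_half.
exact: le_trans (seg_err_le pJ bb uv) (m_small bb).
Qed.

Lemma seg_eta phi b u v : c <= phi <= d -> be <= b -> u <= v ->
  seg_err phi b u v <= 1 / (6 * K ^+ 2).
Proof. by move=> pJ bb uv; exact: le_trans (seg_err_le pJ bb uv) (m_small bb). Qed.

Definition line_bvp (phi b u v : R) : C -> 'cV[C]_n :=
  fun z => Y0 z *m bvp_coef L j (fw j) Y0 (ell phi b u) (ell phi b v).

Lemma line_bvpP phi b u v : c <= phi <= d -> be <= b -> u <= v ->
  bvp j (fw j) (ell phi b u) (ell phi b v) (line_bvp phi b u v).
Proof.
move=> pJ bb uv; apply: (bvp_exists Y0_sol ZY (conn_seg pJ bb uv)).
  exact: seg_half.
exact: ell_Sec.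
Qed.

(** One end is prolonged at a time, through the problem on [[s1, t2]]. *)
Lemma line_cauchy phi b s1 s2 t1 t2 y y' : c <= phi <= d -> be <= b ->
  t1 <= s1 -> s1 <= s2 -> s2 <= t2 ->
  bvp j (fw j) (ell phi b s1) (ell phi b s2) y ->
  bvp j (fw j) (ell phi b t1) (ell phi b t2) y' ->
  forall s i, s1 <= s <= s2 ->
  normc (nrm j y' i (ell phi b s) - nrm j y i (ell phi b s)) <=
  4 * K ^+ 3 * (seg_err phi b t1 s1 + seg_err phi b s2 t2).
Proof.
move=> pJ bb ts1 s12 st2 Hy Hy' s i /andP[ss1 ss2].
have s1t2 := le_trans s12 st2.
have Hw := line_bvpP pJ bb s1t2.
have E1 := bvp_extend_r (conn_seg pJ bb s12) (conn_seg pJ bb st2)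
  (seg_half pJ bb s12) (eta_two (seg_eta pJ bb s12) (seg_eta pJ bb st2)) Hy Hw.
have E2 := bvp_extend_l (conn_seg pJ bb ts1) (conn_seg pJ bb s1t2)
  (seg_half pJ bb s1t2) (eta_two (seg_eta pJ bb ts1) (seg_eta pJ bb s1t2)) Hw Hy'.
have in1 : seg phi b s1 s2 (ell phi b s) by apply: seg_in; rewrite ss1.
have in2 : seg phi b s1 t2 (ell phi b s) by apply: seg_in; rewrite ss1 (le_trans ss2).
apply: (le_trans (normc_dist_le _ _ (nrm j (line_bvp phi b s1 t2) i (ell phi b s)))).
have -> : 4 * K ^+ 3 * (seg_err phi b t1 s1 + seg_err phi b s2 t2) =
  4 * K ^+ 2 * K * seg_err phi b t1 s1 + 4 * K ^+ 2 * K * seg_err phi b s2 t2 by ring.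
by apply: lerD; [exact: E2|exact: E1].
Qed.

(** The two ends go to infinity independently, because the pieces cut out by a third line in
    [lines_agree_near] are not symmetric. *)
Definition line_sol phi b (y : C -> 'cV[C]_n) : Prop := sol y /\
  forall s0 eps, 0 < eps -> exists N, forall s1 s2, s1 <= - N -> N <= s2 ->
  forall v, bvp j (fw j) (ell phi b s1) (ell phi b s2) v ->
  forall i, normc (nrm j v i (ell phi b s0) - nrm j y i (ell phi b s0)) <= eps.

Lemma seg_tail phi b : c <= phi <= d -> be <= b -> forall eps, 0 < eps ->
  exists N, 0 <= N /\ forall u v, u <= v -> (N <= u \/ v <= - N) -> seg_err phi b u v <= eps.
Proof.
move=> pJ bb eps e0; have Kn : 0 < K * n%:R + 1 by rewrite ltr_wpDl// mulr_ge0// ltW.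
have [||N [N0 HN]] := @mono_bounded_tail R (G phi b) (m b) _ (eps / (K * n%:R + 1)).
- move=> u v uv; rewrite G_total// andbT.
  rewrite subr_ge0; apply: (@le_derive1 R _ (g phi b)) => // t _; first exact: G_der.
  have := g_bound t j j pJ bb; apply: le_trans; exact: normc_ge0.
- by rewrite divr_gt0.
exists N; split=> // u v uv h; have := HN u v uv h.
rewrite ler_pdivlMr// /seg_err mulrC => /(le_trans _); apply.
have : 0 <= G phi b v - G phi b u.
  rewrite subr_ge0; apply: (@le_derive1 R _ (g phi b)) => // t _; first exact: G_der.
  have := g_bound t j j pJ bb; apply: le_trans; exact: normc_ge0.
by move=> h0; rewrite mulrDl mul1r mulrC lerDl.
Qed.

Lemma line_cauchy_far phi b : c <= phi <= d -> be <= b -> forall s0 eps, 0 < eps ->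
  exists N, `|s0| <= N /\ forall s1 s2 t1 t2 v w, s1 <= - N -> N <= s2 -> t1 <= - N -> N <= t2 ->
  bvp j (fw j) (ell phi b s1) (ell phi b s2) v ->
  bvp j (fw j) (ell phi b t1) (ell phi b t2) w ->
  forall i, normc (nrm j v i (ell phi b s0) - nrm j w i (ell phi b s0)) <= eps.
Proof.
move=> pJ bb s0 eps e0.
have K3 : 0 < 4 * K ^+ 3 by rewrite mulr_gt0// exprn_gt0.
(* Two tails of at most [eps / (4 * (4 * K ^+ 3))], multiplied by the constant [4 * K ^+ 3] of
   [line_cauchy], make [eps / 2]. *)
have [N [N0 HN]] := seg_tail pJ bb (divr_gt0 e0 (mulr_gt0 (ltr0n _ 4 : 0 < 4) K3)).
pose M := Num.max N `|s0|.
have MN : N <= M by rewrite le_max lexx.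
have Ms : `|s0| <= M by rewrite le_max lexx orbT.
have M0 : 0 <= M := le_trans N0 MN.
have NM : - M <= M by rewrite (le_trans _ M0)// oppr_le0.
have s0M : - M <= s0 <= M by rewrite -ler_norml.
have Hmid := line_bvpP pJ bb NM.
have half s1 s2 v : s1 <= - M -> M <= s2 ->
    bvp j (fw j) (ell phi b s1) (ell phi b s2) v ->
    forall i, normc (nrm j v i (ell phi b s0) - nrm j (line_bvp phi b (- M) M) i (ell phi b s0)) <= eps / 2.
  move=> h1 h2 Hv i; apply: (le_trans (line_cauchy pJ bb h1 NM h2 Hmid Hv i s0M)).
  have A1 := HN s1 (- M) h1 (or_intror (_ : - M <= - N)).
  have A2 := HN M s2 h2 (or_introl MN).
  have {}A1 := A1 (_ : - M <= - N); rewrite lerN2 in A1; have {}A1 := A1 MN.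
  have := ler_wpM2l (ltW K3) (lerD A1 A2); move/le_trans; apply.
  rewrite le_eqVlt; apply/orP; left; apply/eqP; field.
  by rewrite gt_eqF.
exists M; split=> // s1 s2 t1 t2 v w h1 h2 h3 h4 Hv Hw i.
apply: (le_trans (normc_dist_le _ _ (nrm j (line_bvp phi b (- M) M) i (ell phi b s0)))).
rewrite [X in _ + X]normcBC (splitr eps).
exact: (lerD (half s1 s2 v h1 h2 Hv i) (half t1 t2 w h3 h4 Hw i)).
Qed.

(** The convergence along the symmetric pieces is recorded as well: later it presents the value at
    [ell phi b 0] as a limit of holomorphic functions of the parameter. *)
Lemma line_sol_exists phi b : c <= phi <= d -> be <= b -> exists y, line_sol phi b y /\
  forall i, cvgC (fun k => nrm j (line_bvp phi b (- k%:R) k%:R) i (ell phi b 0)) (nrm j y i (ell phi b 0)).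
Proof.
move=> pJ bb; set x0 := ell phi b 0.
have Sx0 : Sec x0 by exact: ell_Sec.
have far s0 eps : 0 < eps -> exists k : nat, forall l, (k <= l)%N -> forall s1 s2 v,
    s1 <= - k%:R -> k%:R <= s2 -> bvp j (fw j) (ell phi b s1) (ell phi b s2) v ->
    forall i, normc (nrm j v i (ell phi b s0) - nrm j (line_bvp phi b (- l%:R) l%:R) i (ell phi b s0)) <= eps.
  move=> e0; have [N [sN HN]] := line_cauchy_far pJ bb s0 e0.
  have N0 : 0 <= N := le_trans (normr_ge0 _) sN.
  exists (Num.bound N) => l kl s1 s2 v h1 h2 Hv i.
  have Nk : N <= (Num.bound N)%:R by rewrite ltW// archi_boundP.
  have Nl : N <= l%:R by apply: (le_trans Nk); rewrite ler_nat.
  have l0 : - (l%:R : R) <= l%:R by rewrite (@le_trans _ _ 0)// oppr_le0.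
  apply: (HN s1 s2 (- l%:R) l%:R) => //; last exact: line_bvpP.
  - by apply: (le_trans h1); rewrite lerN2.
  - exact: le_trans h2.
  - by rewrite lerN2.
have kk (k : nat) : - (k%:R : R) <= k%:R by rewrite (@le_trans _ _ 0)// oppr_le0.
have /choice[p Hp] (i : 'I_n) : exists l, cvgC (fun k => nrm j (line_bvp phi b (- k%:R) k%:R) i x0) l.
  apply: cauchyC_cvg => e e0; have [k Hk] := far 0 e e0.
  exists k => l kl; apply: (Hk k (leqnn k) (- l%:R) l%:R); rewrite ?lerN2 ?ler_nat//.
  exact: line_bvpP.
pose yc : 'cV[C]_n := \col_i (p i * expC (L j x0)).
pose y z := Y0 z *m (Z0 x0 *m yc).
have sy : sol y by exact: (sol_fundamental Y0_sol).
have lim_at z i : Sec z -> cvgC (fun k => nrm j (line_bvp phi b (- k%:R) k%:R) i z) (nrm j y i z).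
  move=> Sz; pose Q := Y0 z *m Z0 x0.
  (* The value at [z] depends linearly on the value at [x0], so the limit at [x0] carries over to
     all of [Sec]. *)
  have cE v : sol v -> nrm j v i z = \sum_l (Q i l * expC (L j x0) * expC (- L j z)) * nrm j v l x0.
    move=> sv; rewrite /nrm (sol_unique sv Sz Sx0) mulmxA -/Q mxE mulr_suml.
    apply: eq_bigr => l _; have e1 : expC (L j x0) * expC (- L j x0) = 1.
      by rewrite -expCD subrr expC0.
    transitivity (Q i l * v x0 l 0 * expC (- L j z) * (expC (L j x0) * expC (- L j x0))).
      by rewrite e1 mulr1.
    by ring.
  have -> : (fun k => nrm j (line_bvp phi b (- k%:R) k%:R) i z) =
     fun k => \sum_l (Q i l * expC (L j x0) * expC (- L j z)) *
        nrm j (line_bvp phi b (- k%:R) k%:R) l x0.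
    by apply/funext => k; apply: cE; exact: (line_bvpP pJ bb (kk k)).1.
  have -> : nrm j y i z = \sum_l (Q i l * expC (L j x0) * expC (- L j z)) * p l.
    rewrite /nrm /y mulmxA -/Q mxE mulr_suml; apply: eq_bigr => l _.
    have -> : yc l 0 = p l * expC (L j x0) by rewrite mxE.
    by ring.
  by apply: cvgC_sum => l; apply: cvgCZ; exact: Hp.
exists y; split; last by move=> i; exact: lim_at.
split=> // s0 eps e0; have e2 : 0 < eps / 2 by rewrite divr_gt0.
have [k Hk] := far s0 _ e2.
exists k%:R => s1 s2 h1 h2 v Hv i.
have Sz : Sec (ell phi b s0) by exact: ell_Sec.
have [k' Hk'] := lim_at _ i Sz _ e2; pose l := maxn k k'.
apply: (le_trans (normc_dist_le _ _ (nrm j (line_bvp phi b (- l%:R) l%:R) i (ell phi b s0)))).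
rewrite (splitr eps); apply: lerD; first exact: (Hk l (leq_maxl _ _) s1 s2 v h1 h2 Hv i).
exact: (Hk' l (leq_maxr _ _)).
Qed.

Lemma line_sol_near1 phi b y : c <= phi <= d -> be <= b -> line_sol phi b y ->
  forall s i, normc (nrm j y i (ell phi b s) - (i == j)%:R) <= K * n%:R * m b * (2 * K).
Proof.
move=> pJ bb [sy Hy] s i; apply/ler_addgt0Pl => e e0.
have [N HN] := Hy s e e0; pose M := Num.max N `|s|.
have sM : `|s| <= M by rewrite le_max lexx orbT.
have M0 : 0 <= M := le_trans (normr_ge0 _) sM.
have NM : - M <= M by rewrite (le_trans _ M0)// oppr_le0.
have H1 := HN (- M) M _ _ _ (line_bvpP pJ bb NM) i.
have {}H1 : normc (nrm j (line_bvp phi b (- M) M) i (ell phi b s) - nrm j y i (ell phi b s)) <= e.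
  by apply: H1; rewrite ?lerN2 le_max lexx.
have sin : seg phi b (- M) M (ell phi b s) by apply: seg_in; rewrite -ler_norml.
have H2 := bvp_near1 (conn_seg pJ bb NM) (seg_half pJ bb NM) (line_bvpP pJ bb NM) i sin.
apply: (le_trans (normc_dist_le _ _ (nrm j (line_bvp phi b (- M) M) i (ell phi b s)))).
apply: lerD; first by rewrite normcBC.
by apply: (le_trans H2); rewrite ler_wpM2r ?seg_err_le ?mulr_ge0 ?(ltW K0).
Qed.

Section Crossing.
Variables (phi b phi' b' s0 s0' : R).
Hypothesis pJ : c <= phi <= d.
Hypothesis bb : be <= b.
Hypothesis pJ' : c <= phi' <= d.
Hypothesis bb' : be <= b'.
Hypothesis cross : ell phi b s0 = ell phi' b' s0'.

Let z0 := ell phi b s0.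

(** The path arrives along the first line, changes at the crossing and leaves along the second. It
    is the intermediate stage between the two lines, whose ends are then exchanged one at a time. *)
Lemma conn_mixed s1 s2' : s1 <= s0 -> s0' <= s2' ->
  conn Sec A L j (fw j) (seg phi b s1 s0 `|` seg phi' b' s0' s2')
    (ell phi b s1) (ell phi' b' s2') (K * K)
    (K * seg_err phi b s1 s0 + K * seg_err phi' b' s0' s2').
Proof.
move=> h1 h2; have H1 := conn_seg pJ bb h1; have H2 := conn_seg pJ' bb' h2.
by rewrite cross in H1; exact: conn_comp H1 H2.
Qed.

Lemma mixed_half s1 s2' : s1 <= s0 -> s0' <= s2' ->
  K * seg_err phi b s1 s0 + K * seg_err phi' b' s0' s2' <= 1 / 2.
Proof. by move=> h1 h2; apply: eta_two; exact: seg_eta. Qed.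

Lemma swap_const (e : R) : 0 <= e ->
  4 * K ^+ 2 * K * e <= 4 * (K * K) ^+ 2 * K * e.
Proof.
move=> e0; rewrite ler_wpM2r// ler_wpM2r ?(ltW K0)// ler_pM2l//.
by rewrite -expr2 -exprM ler_weXn2l.
Qed.

(** The right end moves from the first line to the second along the third line [psi, beta].
    According to the order of [t] and [t'], the mixed path prolongs a piece of the first line, or
    conversely. The constant is that of the second case, where [K * K] belongs to the mixed path;
    [swap_const] covers the first. *)
Lemma swap_right s1 s2 s2' psi beta t t' u w : s1 <= s0 -> s0 <= s2 -> s0' <= s2' ->
  c <= psi <= d -> be <= beta ->
  ell phi b s2 = ell psi beta t -> ell phi' b' s2' = ell psi beta t' ->
  bvp j (fw j) (ell phi b s1) (ell phi b s2) u ->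
  bvp j (fw j) (ell phi b s1) (ell phi' b' s2') w ->
  forall i, normc (nrm j w i z0 - nrm j u i z0) <= 4 * (K * K) ^+ 2 * K * (K * n%:R * m beta).
Proof.
move=> h1 h2 h3 pr br E E' Hu Hw i; have s12 := le_trans h1 h2.
have HS := conn_seg pJ bb s12; have HM := conn_mixed h1 h3.
have KK : 0 <= 4 * (K * K) ^+ 2 * K by rewrite !mulr_ge0 ?sqr_ge0 ?(ltW K0).
have [tt|/ltW tt] := leP t t'.
  have HT := conn_seg pr br tt; rewrite -E -E' in HT.
  have z0S : seg phi b s1 s2 z0 by apply: seg_in; rewrite h1.
  apply: (le_trans (bvp_extend_r HS HT (seg_half pJ bb s12)
    (eta_two (seg_eta pJ bb s12) (seg_eta pr br tt)) Hu Hw i z0S)).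
  apply: (le_trans (swap_const (conn_e HT))).
  by rewrite ler_wpM2l// seg_err_le.
have HT := conn_seg pr br tt; rewrite -E -E' in HT.
have z0S : (seg phi b s1 s0 `|` seg phi' b' s0' s2') z0.
  by left; apply: seg_in; rewrite h1 lexx.
rewrite normcBC; apply: (le_trans (bvp_extend_r HM HT (mixed_half h1 h3)
  (eta_three (seg_eta pJ bb h1) (seg_eta pJ' bb' h3) (seg_eta pr br tt)) Hw Hu i z0S)).
by rewrite ler_wpM2l// seg_err_le.
Qed.

Lemma swap_left s1 s1' s2' psi beta t t' w u' : s1 <= s0 -> s1' <= s0' -> s0' <= s2' ->
  c <= psi <= d -> be <= beta ->
  ell phi b s1 = ell psi beta t -> ell phi' b' s1' = ell psi beta t' ->
  bvp j (fw j) (ell phi b s1) (ell phi' b' s2') w ->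
  bvp j (fw j) (ell phi' b' s1') (ell phi' b' s2') u' ->
  forall i, normc (nrm j w i z0 - nrm j u' i z0) <= 4 * (K * K) ^+ 2 * K * (K * n%:R * m beta).
Proof.
move=> h1 h2 h3 pr br E E' Hw Hu i; have s12 := le_trans h2 h3.
have HS := conn_seg pJ' bb' s12; have HM := conn_mixed h1 h3.
have KK : 0 <= 4 * (K * K) ^+ 2 * K by rewrite !mulr_ge0 ?sqr_ge0 ?(ltW K0).
have [tt|/ltW tt] := leP t t'.
  have HT := conn_seg pr br tt; rewrite -E -E' in HT.
  have z0S : seg phi' b' s1' s2' z0 by rewrite /z0 cross; apply: seg_in; rewrite h2.
  apply: (le_trans (bvp_extend_l HT HS (seg_half pJ' bb' s12)
    (eta_two (seg_eta pr br tt) (seg_eta pJ' bb' s12)) Hu Hw i z0S)).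
  apply: (le_trans (swap_const (conn_e HT))).
  by rewrite ler_wpM2l// seg_err_le.
have HT := conn_seg pr br tt; rewrite -E -E' in HT.
have z0S : (seg phi b s1 s0 `|` seg phi' b' s0' s2') z0.
  by left; apply: seg_in; rewrite h1 lexx.
have e3 : K * K * seg_err psi beta t' t +
    K * (K * seg_err phi b s1 s0 + K * seg_err phi' b' s0' s2') <= 1 / 2.
  by rewrite addrC; apply: eta_three; exact: seg_eta.
rewrite normcBC; apply: (le_trans (bvp_extend_l HT HM (mixed_half h1 h3) e3 Hw Hu i z0S)).
by rewrite ler_wpM2l// seg_err_le.
Qed.

End Crossing.

(** A line sufficiently far from the origin meets the given line beyond any prescribed parameter. *)
Lemma cross_param_ge (M b beta del : R) : 0 < sin del -> 0 <= b ->
  `|M| + b <= beta -> M <= (beta - b * cos del) / sin del.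
Proof.
move=> sd b0 h; rewrite ler_pdivlMr//.
have h1 : M * sin del <= `|M|.
  by apply: (le_trans (ler_norm _)); rewrite normrM ler_piMr// ger0_norm ?(ltW sd)// sin_le1.
have h2 : b * cos del <= b by rewrite ler_piMr// cos_le1.
by lra.
Qed.

(* The far ends of the two lines are joined, on either side, by a piece of a third
   line at distance [beta] from the origin, where [Rm] has L^1-norm at most [m beta]. *)
Lemma lines_agree_near phi b phi' b' y y' : c < phi -> phi < phi' -> phi' < d ->
  phi' < phi + 1 -> be <= b -> be <= b' -> line_sol phi b y -> line_sol phi' b' y' ->
  forall z, Sec z -> y z = y' z.
Proof.
move=> cphi pp phid p1 bb bb' Hy Hy'.
have pJ : c <= phi <= d by rewrite ltW// ltW// (lt_trans pp).
have pJ' : c <= phi' <= d by rewrite !ltW// (lt_trans cphi).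
have b0 : 0 < b := lt_le_trans be0 bb; have b'0 : 0 < b' := lt_le_trans be0 bb'.
have pi2 := pi_ge2 R.
have A0 : phi < phi' < phi + pi.
  by rewrite pp/= (lt_le_trans p1)// lerD2l (le_trans _ pi2)// ler1n.
have := ell_cross b0 b'0 A0; rewrite /=.
set s0 := _ / _; set s0' := _ / _ => cross.
suff key i : nrm j y i (ell phi b s0) = nrm j y' i (ell phi b s0).
  have Sx : Sec (ell phi b s0) by exact: ell_Sec.
  have yx : y (ell phi b s0) = y' (ell phi b s0).
    apply/subr0_eq; apply: (@nrm_eq0 R n L j (fun z => y z - y' z)) => i.
    by rewrite nrmB key subrr.
  by move=> z Sz; rewrite (sol_unique Hy.1 Sz Sx) (sol_unique Hy'.1 Sz Sx) yx.
apply/eqP; rewrite -subr_eq0; apply/eqP/normc_eq0/eqP.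
rewrite eq_le normc_ge0 andbT; apply/ler_addgt0Pl => e e0; rewrite addr0.
have e4 : 0 < e / 4 by rewrite divr_gt0.
have [N HN] := Hy.2 s0 _ e4; have [N' HN'] := Hy'.2 s0' _ e4.
pose M := Num.max (Num.max N N') (Num.max `|s0| `|s0'|).
have M1 : N <= M by rewrite !le_max lexx.
have M2 : N' <= M by rewrite !le_max lexx !orbT.
have M3 : `|s0| <= M by rewrite !le_max lexx !orbT.
have M4 : `|s0'| <= M by rewrite !le_max lexx !orbT.
have M0 : 0 <= M := le_trans (normr_ge0 _) M3.
pose X := 4 * (K * K) ^+ 2 * K * (K * n%:R).
have X0 : 0 <= X by rewrite !mulr_ge0 ?sqr_ge0 ?(ltW K0).
have X1 : 0 < X + 1 by rewrite ltr_wpDl.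
have [beta0 Hb] := m_lim (divr_gt0 e4 X1).
pose beta := Num.max (Num.max beta0 be) (M + b + b').
have betab : be <= beta by rewrite !le_max lexx !orbT.
have mb : X * m beta <= e / 4.
  have beta0b : beta0 <= beta by rewrite !le_max lexx.
  have h := Hb beta beta0b betab.
  have m0 : 0 <= m beta.
    have := G_total pJ betab (lexx 0); rewrite subrr; exact.
  apply: (@le_trans _ _ ((X + 1) * m beta)); first by rewrite ler_wpM2r// lerDl.
  by rewrite mulrC -ler_pdivlMr.
have bM : `|M| + b <= beta.
  rewrite ger0_norm//; apply: (@le_trans _ _ (M + b + b')); first by rewrite lerDl ltW.
  by rewrite le_max lexx orbT.
have bM' : `|M| + b' <= beta.
  rewrite ger0_norm//; apply: (@le_trans _ _ (M + b + b')); last by rewrite le_max lexx orbT.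
  by rewrite addrAC lerDl ltW.
have beta0' : 0 < beta := lt_le_trans be0 betab.
(* The third lines are turned by [tau] beyond [phi] and [phi'], inside [[c, d]]: [pr] cuts both
   lines at their right ends, [pl] at their left ends. All the angles between them stay below 2,
   hence below [pi], since [phi' < phi + 1] and [tau <= 1]. *)
pose tau := Num.min (Num.min (phi - c) (d - phi')) 1.
have tau0 : 0 < tau by rewrite !lt_min !subr_gt0 cphi phid ltr01.
have t1 : tau <= phi - c by rewrite !ge_min lexx.
have t2 : tau <= d - phi' by rewrite !ge_min lexx !orbT.
have t3 : tau <= 1 by rewrite ge_min lexx orbT.
pose pr := phi - tau; pose pl := phi' + tau.
have prJ : c <= pr <= d by rewrite /pr; case/andP: pJ => ? ?; apply/andP; split; lra.
have plJ : c <= pl <= d by rewrite /pl; case/andP: pJ' => ? ?; apply/andP; split; lra.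
have A1 : pr < phi < pr + pi by rewrite /pr; apply/andP; split; lra.
have A2 : pr < phi' < pr + pi by rewrite /pr; apply/andP; split; lra.
have A3 : phi < pl < phi + pi by rewrite /pl; apply/andP; split; lra.
have A4 : phi' < pl < phi' + pi by rewrite /pl; apply/andP; split; lra.
have sinp (x x' : R) : x < x' < x + pi -> 0 < sin (x' - x).
  by move=> /andP[? ?]; apply: sin_gt0_pi; apply/andP; split; lra.
have C1 := ell_cross beta0' b0 A1; have C2 := ell_cross beta0' b'0 A2.
have C3 := ell_cross b0 beta0' A3; have C4 := ell_cross b'0 beta0' A4.
have G1 := cross_param_ge (sinp _ _ A1) (ltW b0) bM.
have G2 := cross_param_ge (sinp _ _ A2) (ltW b'0) bM'.
have G3 := cross_param_ge (sinp _ _ A3) (ltW b0) bM.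
have G4 := cross_param_ge (sinp _ _ A4) (ltW b'0) bM'.
rewrite /= in C1 C2 C3 C4.
move: C1 G1; set s2 := (beta - b * _) / _ => C1 G1.
move: C2 G2; set s2' := (beta - b' * _) / _ => C2 G2.
move: C3 G3; set s1 := (b * _ - beta) / _ => C3 G3.
move: C4 G4; set s1' := (b' * _ - beta) / _ => C4 G4.
have {}G3 : s1 <= - M by rewrite -lerN2 opprK /s1 -mulNr opprB.
have {}G4 : s1' <= - M by rewrite -lerN2 opprK /s1' -mulNr opprB.
have /andP[l1 l2] : - M <= s0 <= M by rewrite -ler_norml.
have /andP[l3 l4] : - M <= s0' <= M by rewrite -ler_norml.
have u1 := le_trans G3 l1; have u2 := le_trans l2 G1.
have u3 := le_trans G4 l3; have u4 := le_trans l4 G2.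
have Hu := line_bvpP pJ bb (le_trans u1 u2).
have Hu' := line_bvpP pJ' bb' (le_trans u3 u4).
have Hw := bvp_exists Y0_sol ZY (conn_mixed pJ bb pJ' bb' cross u1 u4)
  (mixed_half pJ bb pJ' bb' u1 u4) (ell_Sec s1 pJ bb).
have E1 := swap_right pJ bb pJ' bb' cross u1 u2 u4 prJ betab (esym C1) (esym C2) Hu Hw i.
have E2 := swap_left pJ bb pJ' bb' cross u1 u3 u4 plJ betab C3 C4 Hw Hu' i.
have E3 := HN s1 s2 _ _ _ Hu i.
have {}E3 := E3 (le_trans G3 _) (le_trans M1 G1); rewrite lerN2 in E3; have {}E3 := E3 M1.
have E4 := HN' s1' s2' _ _ _ Hu' i.
have {}E4 := E4 (le_trans G4 _) (le_trans M2 G2); rewrite lerN2 in E4; have {}E4 := E4 M2.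
rewrite -cross in E4; rewrite mulrA -/X in E1 E2.
have {}E1 := le_trans E1 mb; have {}E2 := le_trans E2 mb.
have fin (pw pu pu' v v' : C) : normc (pw - pu) <= e / 4 -> normc (pw - pu') <= e / 4 ->
    normc (pu - v) <= e / 4 -> normc (pu' - v') <= e / 4 -> normc (v - v') <= e.
  move=> F1 F2 F3 F4.
  have -> : v - v' = (pw - pu') - (pw - pu) + ((pu' - v') - (pu - v)) by ring.
  apply: (le_trans (normcD_le _ _)); apply: (le_trans (lerD (normcB_le _ _) (normcB_le _ _))).
  have -> : e = e / 4 + e / 4 + (e / 4 + e / 4) by field.
  by apply: lerD; apply: lerD.
exact: fin E1 E2 E3 E4.
Qed.

(** Directions further apart are linked by a chain of lines turned by 1 / 2 each; [k] bounds the
    number of turns. *)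
Lemma lines_agree_lt k phi b phi' b' y y' : c < phi -> phi < phi' -> phi' < d ->
  phi' < phi + k.+1%:R / 2 -> be <= b -> be <= b' ->
  line_sol phi b y -> line_sol phi' b' y' -> forall z, Sec z -> y z = y' z.
Proof.
elim: k phi b y => [|k IH] phi b y cphi pp phid pk bb bb' Hy Hy'.
  apply: (lines_agree_near cphi pp phid _ bb bb' Hy Hy').
  by apply: (lt_le_trans pk); rewrite lerD2l ler_pdivrMr// mul1r ler_nat.
have [p1|p1] := ltP phi' (phi + 1).
  exact: (lines_agree_near cphi pp phid p1 bb bb' Hy Hy').
pose psi := phi + 1 / 2.
have h1 : phi < psi by rewrite ltrDl divr_gt0.
have h2 : psi < phi + 1 by rewrite ltrD2l mul1r invf_lt1// ltr1n.
have h3 := lt_le_trans h2 p1.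
have pJ : c <= psi <= d by rewrite !ltW ?(lt_trans h3)// (lt_trans cphi).
have [w [Hw _]] := line_sol_exists pJ (lexx be).
have E1 := lines_agree_near cphi h1 (lt_trans h3 phid) h2 bb (lexx be) Hy Hw.
have pk' : phi' < psi + k.+1%:R / 2.
  apply: (lt_le_trans pk); rewrite /psi -addrA lerD2l -mulrDl -natr1 addrC.
  by rewrite lexx.
have E2 := IH psi be w (lt_trans cphi h1) h3 phid pk' (lexx be) bb' Hw Hy'.
by move=> z Sz; rewrite E1// E2.
Qed.

Lemma lines_agree phi b phi' b' y y' : c < phi < d -> c < phi' < d -> be <= b -> be <= b' ->
  line_sol phi b y -> line_sol phi' b' y' -> forall z, Sec z -> y z = y' z.
Proof.
have lt_case p q u v w w' : c < p -> p < q -> q < d -> be <= u -> be <= v ->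
    line_sol p u w -> line_sol q v w' -> forall z, Sec z -> w z = w' z.
  move=> h1 h2 h3 h4 h5 H H'; have qp0 : 0 <= 2 * (q - p) by rewrite mulr_ge0// subr_ge0 ltW.
  apply: (@lines_agree_lt (Num.bound (2 * (q - p))) p u q v w w') => //.
  have := archi_boundP qp0; set N := Num.bound _ => hN.
  rewrite addrC -ltrBlDr ltr_pdivlMr// mulrC (lt_trans hN)// ltr_nat//.
move=> /andP[h1 h2] /andP[h3 h4] bb bb' Hy Hy' z Sz.
have [pq|qp|pq] := ltgtP phi phi'.
- exact: (lt_case _ _ _ _ _ _ h1 pq h4 bb bb' Hy Hy').
- by rewrite (lt_case _ _ _ _ _ _ h3 qp h2 bb' bb Hy' Hy).
rewrite -pq in Hy'.
(* Parallel lines do not cross, so both are compared with a line of another direction. *)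
pose psi := (phi + d) / 2.
have m1 : phi < psi by rewrite ltr_pdivlMr// mulrC mulr2n mulrDl mul1r ltrD2l.
have m2 : psi < d by rewrite ltr_pdivrMr// mulrC mulr2n mulrDl mul1r ltrD2r.
have pJ : c <= psi <= d by rewrite !ltW// (lt_trans h1).
have [w [Hw _]] := line_sol_exists pJ (lexx be).
rewrite (lt_case _ _ _ _ _ _ h1 m1 m2 bb (lexx be) Hy Hw)//.
by rewrite (lt_case _ _ _ _ _ _ h1 m1 m2 bb' (lexx be) Hy' Hw).
Qed.

Lemma line_sol_all phi b y : c < phi < d -> be <= b -> line_sol phi b y ->
  forall phi' b', c < phi' < d -> be <= b' -> line_sol phi' b' y.
Proof.
move=> pJ bb Hy phi' b' pJ' bb'; have pJc : c <= phi' <= d by case/andP: pJ' => ? ?; rewrite !ltW.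
have [w [Hw _]] := line_sol_exists pJc bb'.
have E := lines_agree pJ pJ' bb bb' Hy Hw.
split; first exact: Hy.1.
move=> s0 eps e0; have [N HN] := Hw.2 s0 _ e0; exists N => s1 s2 h1 h2 v Hv i.
have := HN s1 s2 h1 h2 v Hv i; rewrite /nrm E//; exact: ell_Sec.
Qed.

(** As the normalized solution is small at both ends, its boundary data are small whichever end [fw]
    selects; the a priori estimate does the rest. *)
Lemma line_unique phi b w : c <= phi <= d -> be <= b -> sol w ->
  (forall e, 0 < e -> exists N, forall s i, N <= `|s| -> normc (nrm j w i (ell phi b s)) <= e) ->
  forall z, Sec z -> w z = 0.
Proof.
move=> pJ bb sw Hw z Sz.
have Sx : Sec (ell phi b 0) by exact: ell_Sec.
suff w0 : w (ell phi b 0) = 0 by rewrite (sol_unique sw Sz Sx) w0 !mulmx0.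
apply: (@nrm_eq0 R n L j) => i; apply/normc_eq0/eqP; rewrite eq_le normc_ge0 andbT.
apply/ler_addgt0Pl => e e0; rewrite addr0.
have K2 : 0 < 2 * K by rewrite mulr_gt0.
have [N HN] := Hw _ (divr_gt0 e0 K2); pose M : R := `|N|.
have NM : - M <= M by apply: (@le_trans _ _ 0); rewrite ?oppr_le0 normr_ge0.
have NM' : N <= M by exact: ler_norm.
have z0 : seg phi b (- M) M (ell phi b 0) by apply: seg_in; rewrite oppr_le0 !normr_ge0.
have := conn_apriori (conn_seg pJ bb NM) (seg_half pJ bb NM) sw _ i z0.
move=> /(_ (e / (2 * K)) _)/wrap[].
  move=> i'; rewrite /base; case: ifP => _; apply: HN; rewrite ?normrN;
  by rewrite (le_trans NM')// ler_norm.
by rewrite mulrC divfK ?gt_eqF.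
Qed.

End Column.
End FixedParameter.

(** * Norms, integrals and holomorphy of matrices *)

Section NormEquivalence.
Variables (R : realType) (n : nat).
Local Notation C := (Cx R).
Variable N : 'M[C]_n -> R.
Hypothesis N_norm : is_mx_norm N.

Lemma mx_normD A B : N (A + B) <= N A + N B. Proof. by case: N_norm. Qed.
Lemma mx_normZ c A : N (c *: A) = normc c * N A. Proof. by case: N_norm. Qed.
Lemma mx_norm_eq0 A : N A = 0 -> A = 0. Proof. by case: N_norm => ? ?; apply. Qed.

Lemma mx_norm0 : N 0 = 0.
Proof. by rewrite -(scale0r (0 : 'M[C]_n)) mx_normZ /normc /= expr0n /= addr0 sqrtr0 mul0r. Qed.

Lemma mx_normN A : N (- A) = N A.
Proof. by rewrite -scaleN1r mx_normZ normcNE (normc_real 1) normr1 mul1r. Qed.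

Lemma mx_norm_ge0 A : 0 <= N A.
Proof.
have := mx_normD A (- A); rewrite subrr mx_norm0 mx_normN -mulr2n.
by rewrite pmulrn_lge0.
Qed.

Lemma mx_norm_dist A B : `|N A - N B| <= N (A - B).
Proof.
rewrite ler_norml lerBrDl; apply/andP; split.
  by have := mx_normD (B - A) A; rewrite subrK -opprB mx_normN lerBlDr addrC.
by rewrite lerBlDl; have := mx_normD (A - B) B; rewrite subrK addrC.
Qed.

Lemma mx_norm_sum (J : Type) (r : seq J) (F : J -> 'M[C]_n) :
  N (\sum_(j <- r) F j) <= \sum_(j <- r) N (F j).
Proof.
elim: r => [|j r IH]; first by rewrite !big_nil mx_norm0.
by rewrite !big_cons (le_trans (mx_normD _ _))// lerD2l.
Qed.

Lemma mx_norm_entries A : N A <= \sum_i \sum_j normc (A i j) * N (delta_mx i j).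
Proof.
rewrite {1}[A]matrix_sum_delta (le_trans (mx_norm_sum _ _))// ler_sum// => i _.
by rewrite (le_trans (mx_norm_sum _ _))// ler_sum// => j _; rewrite mx_normZ.
Qed.

(** Matrices are coded as families of real and imaginary parts, so that the product topology and
    Tychonoff's theorem provide compactness. *)
Let T := {ptws ('I_n * 'I_n * bool)%type -> R}.
Let mx (f : T) : 'M[C]_n := \matrix_(i, j) Complex (f (i, j, false)) (f (i, j, true)).

Lemma continuous_mx_norm : continuous (fun f : T => N (mx f) : R).
Proof.
move=> f; have FF : Filter (nbhs f) by exact: nbhs_filter.
apply: (proj2 (@cvgrPdist_le R R T (nbhs f) FF (fun g => N (mx g)) (N (mx f)))) => e e0.
pose S := \sum_i \sum_j 2 * N (delta_mx i j) + 1.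
have S0 : 0 < S.
  by rewrite ltr_wpDl// sumr_ge0// => i _; rewrite sumr_ge0// => j _; rewrite mulr_ge0// mx_norm_ge0.
have eS : 0 < e / S by rewrite divr_gt0.
have near1 x : \forall g \near f, `|f x - g x| <= e / S.
  have /cvgrPdist_le := @proj_continuous _ (fun=> R) x f.
  exact.
have nearall : \forall g \near f, forall x, `|f x - g x| <= e / S.
  exact: (@filter_forall T ('I_n * 'I_n * bool)%type (fun x g => `|f x - g x| <= e / S) (nbhs f) FF near1).
near=> g.
have H : forall x, `|f x - g x| <= e / S by near: g.
apply: (le_trans (mx_norm_dist _ _)); apply: (le_trans (mx_norm_entries _)).
apply: (@le_trans _ _ (\sum_i \sum_j (e / S) * (2 * N (delta_mx i j)))).
  apply: ler_sum => i _; apply: ler_sum => j _; rewrite mulrA ler_wpM2r ?mx_norm_ge0//.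
  rewrite !mxE (le_trans (normc_le_ReIm _))// ReB ImB /= mulr2n mulrDr mulr1.
  by apply: lerD; exact: H.
have -> : \sum_i \sum_j e / S * (2 * N (delta_mx i j)) = e / S * (S - 1).
  rewrite addrK mulr_sumr; apply: eq_bigr => i _; by rewrite mulr_sumr.
by rewrite mulrBr divfK ?gt_eqF// mulr1 lerBlDr lerDl ltW.
Unshelve. all: by end_near. Qed.

(** The image under [N] of a compact face of the unit cube is closed and misses 0, because the entry
    [(i0, j0)] is 1 on this face. *)
Lemma mx_norm_ge_on_face (i0 j0 : 'I_n) : exists2 e : R, 0 < e &
  forall A : 'M[C]_n, A i0 j0 = 1 -> (forall i j, normc (A i j) <= 1) -> e <= N A.
Proof.
pose F (x : 'I_n * 'I_n * bool) : set R :=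
  if x == (i0, j0, false) then [set 1] else if x == (i0, j0, true) then [set 0] else `[-1, 1]%classic.
pose D : set T := [set f | forall x, F x (f x)].
have cD : compact D.
  apply: tychonoff => x; rewrite /F; case: ifP => _; first exact: compact_set1.
  by case: ifP => _; [exact: compact_set1|exact: segment_compact].
pose I := (fun f : T => N (mx f) : R) @` D.
have cI : compact I by apply: continuous_compact => //; exact: continuous_subspaceT continuous_mx_norm.
have I0 : (~` I) 0.
  move=> [f Df] /mx_norm_eq0 /matrixP /(_ i0 j0); rewrite !mxE => /(congr1 (@complex.Re R)) /=.
  have := Df (i0, j0, false); rewrite /F eqxx /= => -> /eqP; by rewrite oner_eq0.
have oI : open (~` I) by rewrite openC; apply: compact_closed cI; exact: Rhausdorff.
have /nbhs_ballP[e /= e0 He] := open_nbhs_nbhs (conj oI I0).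
exists e => // A A1 Ab; rewrite leNgt; apply/negP => Ne.
apply: (He (N A)).
  by rewrite /ball /= sub0r normrN ger0_norm ?mx_norm_ge0.
exists (fun x => if x.2 then complex.Im (A x.1.1 x.1.2) else complex.Re (A x.1.1 x.1.2)).
  move=> [[i j] b]; rewrite /F /=.
  case: ifP => [/eqP[-> -> ->]|_]; first by rewrite A1.
  case: ifP => [/eqP[-> -> ->]|_]; first by rewrite A1.
  rewrite /= in_itv /= -ler_norml; case: b => /=; apply: le_trans (Ab i j).
    exact: normr_Im_le.
  exact: normr_Re_le.
by congr N; apply/matrixP => i j; rewrite mxE /=; case: (A i j).
Qed.

(** Division by the entry of largest modulus puts the matrix on one of the faces of the preceding
    lemma. *)
Lemma mx_norm_equiv : exists2 c : R, 0 < c & forall (A : 'M[C]_n) i j, normc (A i j) <= c * N A.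
Proof.
have /choice[e He] (x : 'I_n * 'I_n) : exists e : R, 0 < e /\
    forall A : 'M[C]_n, A x.1 x.2 = 1 -> (forall i j, normc (A i j) <= 1) -> e <= N A.
  by have [e e0 h] := mx_norm_ge_on_face x.1 x.2; exists e.
have S0 : 0 <= \sum_x (e x)^-1 by rewrite sumr_ge0// => x _; rewrite invr_ge0 ltW// (He x).1.
exists (1 + \sum_x (e x)^-1) => [|A i j]; first by rewrite ltr_pwDl.
have [x _ Hx] := @Order.TotalTheory.arg_maxP _ _ _ (i, j) xpredT (fun x : 'I_n * 'I_n => normc (A x.1 x.2)) isT.
apply: (le_trans (Hx (i, j) isT)); set M := A x.1 x.2.
have [M0|M0] := eqVneq M 0.
  rewrite M0 (normc_real 0) normr0 mulr_ge0 ?mx_norm_ge0//.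
  by rewrite addr_ge0.
have nM := normc_gt0 M0.
have nV : normc (M^-1) = (normc M)^-1.
  by apply: (mulfI (lt0r_neq0 nM)); rewrite -normcM mulfV// (normc_real 1) normr1 divff ?gt_eqF.
have : e x <= N (M^-1 *: A).
  apply: (He x).2; first by rewrite mxE mulVf.
  move=> i' j'; rewrite mxE normcM nV.
  by rewrite mulrC ler_pdivrMr// mul1r; exact: (Hx (i', j')).
rewrite mx_normZ nV ler_pdivlMl// => h.
have ex := (He x).1.
apply: (@le_trans _ _ ((e x)^-1 * N A)); first by rewrite ler_pdivlMl// mulrC.
rewrite ler_wpM2r ?mx_norm_ge0// ler_wpDl//.
by apply: (sum_ge_term (F := fun x => (e x)^-1)) => y; rewrite invr_ge0 ltW// (He y).1.
Qed.
End NormEquivalence.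

Section L1Primitive.
Variable R : realType.

(** [G] is the integral from -oo, so its increments are integrals over intervals, at most the total
    one. *)
Lemma L1_primitive (h : R -> R) (e : R) : continuous h -> (forall s, 0 <= h s) ->
  (\int[lebesgue_measure]_s (h s)%:E <= e%:E)%E ->
  exists G : R -> R, (forall s : R, is_derive s 1 G (h s)) /\
    forall u v, u <= v -> G v - G u <= e.
Proof.
move=> ch h0 he.
have mh : measurable_fun setT h by exact: continuous_measurable_fun.
have ih : lebesgue_measure.-integrable setT (EFin \o h).
  apply/integrableP; split; [exact/measurable_EFinP|]; apply: le_lt_trans (ltry e).
  by under eq_integral => s _ do rewrite /= ger0_norm//.
pose G t := \int[lebesgue_measure]_(u in `]-oo, t]) h u.
have DG (s : R) : is_derive s 1 G (h s).
  have ss : s < s + 1 by rewrite ltrDl.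
  have iS : lebesgue_measure.-integrable `]-oo, (s + 1)] (EFin \o h) by apply: integrableS ih.
  have [|D E] := continuous_FTC1 ss iS _ (ch s); first by rewrite ltNyr.
  by apply: DeriveDef; [exact: D|rewrite -derive1E; exact: E].
exists G; split=> // u v uv; rewrite -(@Rintegral_derive R h G u v)//; last first.
  move=> t _ d d0; have /cvgrPdist_le/(_ _ d0)/nbhs_ballP[r /= r0 Hr] := ch t.
  exists r => // s _ st; rewrite distrC; apply: Hr; by rewrite /ball /= distrC.
have iuv : lebesgue_measure.-integrable `[u, v] (EFin \o h) by apply: integrableS ih.
rewrite -lee_fin /Rintegral fineK; last exact: integrable_fin_num.
apply: le_trans he; apply: ge0_subset_integral => //; first exact/measurable_EFinP.
by move=> x _; rewrite lee_fin.
Qed.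
End L1Primitive.

Section MatrixHolomorphy.
Variable R : realType.
Local Notation C := (Cx R).

Lemma coord_linear n k (i : 'I_n) (j : 'I_k) :
  exists2 f : {linear 'M[C]_(n, k) -> C}, continuous f & forall M, f M = M i j.
Proof.
have @f : {linear 'M[C]_(n, k) -> C}.
  by exists (fun N : 'M[C]_(_, _) => N i j); do 2![eexists]; do ?[constructor];
     rewrite ?mxE// => ? *; rewrite ?mxE//; move=> ?; rewrite !mxE.
by exists f => //; exact: coord_continuous.
Qed.

Lemma differentiable_entry (E : normedModType C) n k (F : E -> 'M[C]_(n, k)) p i j :
  differentiable F p ->
  differentiable (fun q => F q i j) p /\ forall v, 'd (fun q => F q i j) p v = ('d F p v) i j.
Proof.
move=> DF; have [f cf fE] := coord_linear i j.
have -> : (fun q => F q i j) = f \o F by apply/funext => q /=; rewrite fE.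
have Df : differentiable f (F p) by exact: linear_differentiable.
split; first exact: differentiable_comp.
by move=> v; rewrite diff_comp//= diff_lin// fE.
Qed.

Lemma differentiable_mx (E : normedModType C) n k (F : E -> 'M[C]_(n, k)) p :
  (forall i j, differentiable (fun q => F q i j) p) -> differentiable F p.
Proof.
move=> DF; have -> : F = \sum_i \sum_j (fun q => F q i j *: delta_mx i j).
  apply/funext => q; rewrite {1}[F q]matrix_sum_delta fct_sumE.
  by apply: eq_bigr => i _; rewrite fct_sumE.
apply: differentiable_sum => i; apply: differentiable_sum => j.
exact: differentiableZl.
Qed.

Lemma cder_diff (f : C -> C) (z : C) : differentiable f z -> cder f z ('d f z 1).
Proof.
move=> Df; have D := diff_dder (1 : C) Df.
move=> e /D[del d0 Hd]; exists del => // h /Hd; rewrite !add0r scale0r addr0.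
suff -> : z + h *: (1 : C) = z + h by [].
by rewrite -[h *: _]/(h * 1) mulr1.
Qed.

Lemma mcder_derive1 n k (F : C -> 'M[C]_(n, k)) (z : C) : differentiable F z ->
  mcder F z (derive1 F z).
Proof.
move=> DF i j; rewrite derive1E deriveE//.
by have [D <-] := differentiable_entry i j DF; exact: cder_diff.
Qed.

End MatrixHolomorphy.

Section ParameterHolomorphy.
Variable R : realType.
Local Notation C := (Cx R).
Variable E : normedModType C.

Lemma differentiable_prod (I : Type) (r : seq I) (f : I -> E -> C) p :
  (forall i, differentiable (f i) p) -> differentiable (fun q => \prod_(i <- r) f i q) p.
Proof.
move=> Df; elim: r => [|i r IH].
  have -> : (fun q => \prod_(i <- [::]) f i q) = cst 1 by apply/funext => q; rewrite big_nil.
  exact: differentiable_cst.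
have -> : (fun q => \prod_(k <- i :: r) f k q) = f i * (fun q => \prod_(k <- r) f k q).
  by apply/funext => q; rewrite big_cons.
exact: differentiableM.
Qed.

Lemma differentiable_bigsum (I : Type) (r : seq I) (f : I -> E -> C) p :
  (forall i, differentiable (f i) p) -> differentiable (fun q => \sum_(i <- r) f i q) p.
Proof.
move=> Df; elim: r => [|i r IH].
  have -> : (fun q => \sum_(i <- [::]) f i q) = cst 0 by apply/funext => q; rewrite big_nil.
  exact: differentiable_cst.
have -> : (fun q => \sum_(k <- i :: r) f k q) = f i + (fun q => \sum_(k <- r) f k q).
  by apply/funext => q; rewrite big_cons.
exact: differentiableD.
Qed.

Lemma differentiable_mul (f g : E -> C) p : differentiable f p -> differentiable g p ->
  differentiable (fun q => f q * g q) p.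
Proof. by move=> Df Dg; exact: (differentiableM Df Dg). Qed.

Lemma differentiable_mulmx n k l (F : E -> 'M[C]_(n, k)) (G : E -> 'M[C]_(k, l)) p :
  (forall i j, differentiable (fun q => F q i j) p) ->
  (forall i j, differentiable (fun q => G q i j) p) ->
  forall i j, differentiable (fun q => (F q *m G q) i j) p.
Proof.
move=> DF DG i j; have -> : (fun q => (F q *m G q) i j) = fun q => \sum_l F q i l * G q l j.
  by apply/funext => q; rewrite mxE.
by apply: differentiable_bigsum => k'; exact: differentiable_mul.
Qed.

Lemma differentiable_det n (M : E -> 'M[C]_n) p :
  (forall i j, differentiable (fun q => M q i j) p) -> differentiable (fun q => \det (M q)) p.
Proof.
move=> DM; apply: differentiable_bigsum => s; apply: differentiable_mul.
  exact: differentiable_cst.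
by apply: differentiable_prod => i.
Qed.

Lemma differentiable_near (f g : E -> C) p (r : R) : 0 < r ->
  (forall q, rn (q - p) < r -> f q = g q) -> differentiable f p -> differentiable g p.
Proof.
move=> r0 fg Df; have Dc : continuous ('d f p) by exact: diff_continuous Df.
apply: (@differentiable_eps R E g p ('d f p)).
  exact: Dc.
move=> e e0; have [del d0 Hd] := diff_eps Df e0.
exists (Num.min del r); first by rewrite lt_min d0.
move=> h; rewrite lt_min => /andP[h1 h2]; rewrite -!fg ?subrr ?rn0//; first exact: Hd.
by rewrite addBl.
Qed.

(** By Cramer's rule, whose formula agrees with [invmx] only where the matrix is invertible; hence
    the ball and [differentiable_near]. *)
Lemma differentiable_invmx n (M : E -> 'M[C]_n) p (r : R) : 0 < r ->
  (forall q, rn (q - p) < r -> M q \in unitmx) ->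
  (forall i j, differentiable (fun q => M q i j) p) ->
  forall i j, differentiable (fun q => invmx (M q) i j) p.
Proof.
move=> r0 uM DM i j.
apply: (@differentiable_near (fun q => (\det (M q))^-1 * cofactor (M q) j i) _ p r r0).
  by move=> q /uM uq; rewrite /invmx uq !mxE.
apply: differentiable_mul.
  apply: differentiableV; first exact: differentiable_det.
  by have := uM p; rewrite subrr rn0 => /(_ r0); rewrite unitmxE unitfE.
apply: differentiable_mul; first exact: differentiable_cst.
by apply: differentiable_det => k l; under eq_fun => q do rewrite !mxE; exact: DM.
Qed.

End ParameterHolomorphy.

Section RayCore.
Variables (R : realType) (W : normedModType (Cx R)).
Local Notation C := (Cx R).
Local Notation E := (C * W)%type.
Variables (z0 : C) (U : set E).
Hypothesis U_open : open U.

(** Holomorphy is given on some open neighbourhood of unknown shape. This part of it is star-shaped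
    in the first variable, as [prim] and the Picard iteration require, and still contains the
    sector, which is convex. *)
Definition ray_core : set E := [set p | forall t, 0 <= t <= 1 -> U (ray z0 t p)].

Lemma ray_core_sub p : ray_core p -> U p.
Proof. by move=> /(_ 1); rewrite ray1; apply; rewrite ler01 lexx. Qed.

Lemma ray_core_ray p t : ray_core p -> 0 <= t <= 1 -> ray_core (ray z0 t p).
Proof.
move=> Hp /andP[t0 t1] s /andP[s0 s1]; rewrite ray_ray; apply: Hp.
by rewrite mulr_ge0// mulr_ile1.
Qed.

Lemma ray_core_open : open ray_core.
Proof.
rewrite openE => p Vp; rewrite /interior.
have := (compact_near_coveringP (`[0, 1]%classic : set R)).1 (@segment_compact R 0 1).
move=> /(_ E (nbhs p) (fun q t => U (ray z0 t q)) _ _)/wrap[].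
  move=> t; rewrite /= in_itv/= => t01; have [d d0 H1] := open_rn U_open (Vp t t01).
  have [eta eta0 H] := @ray_close R W z0 t p d d0.
  exists (ball t eta, [set q | rn (q - p) < eta]).
    split=> /=; first exact: nbhsx_ballx.
    exact: ((nbhs_rnP p [set q | rn (q - p) < eta]).2 (ex_intro2 _ _ eta eta0 (fun q h => h))).
  move=> [s q] [/= ts qp]; rewrite /ball /= distrC in ts.
  by apply: H1; apply: H.
move=> H; have := (nbhs_rnP p _).1 H => -[r r0 Hr].
apply/nbhs_rnP; exists r => // q qr t t01; apply: (Hr q qr); by rewrite /= in_itv.
Qed.

End RayCore.

Section Slices.
Variables (R : realType) (W : normedModType (Cx R)).
Local Notation C := (Cx R).
Local Notation E := (C * W)%type.

Lemma differentiable_slice1 (w : W) (z : C) : differentiable (fun x : C => (x, w) : E) z.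
Proof.
have L : linear (fun x : C => (x, 0) : E).
  move=> c u v; change ((c * u + v, 0) = (c * u + v, c *: 0 + 0) :> E).
  by rewrite scaler0 addr0.
pose f : {linear C -> E} := HB.pack (fun x : C => (x, 0) : E) (GRing.isLinear.Build C C E *:%R _ L).
have := @differentiable_affine R C E f (0, w) 1 z.
have -> : (fun q => f q + (0, w)) = (fun x : C => (x, w) : E).
  by apply/funext => x; congr (_, _); rewrite /= ?addr0 ?add0r.
apply=> v; rewrite mul1r rn_pair_le//= ?rn0 ?rn_ge0//.
Qed.

Lemma differentiable_slice2 (w : W) (z : C) : differentiable (fun x : W => (z, x) : E) w.
Proof.
have L : linear (fun x : W => (0, x) : E).
  move=> c u v; change ((0, c *: u + v) = (c * 0 + 0, c *: u + v) :> E).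
  by rewrite mulr0 addr0.
pose f : {linear W -> E} := HB.pack (fun x : W => (0, x) : E) (GRing.isLinear.Build C W E *:%R _ L).
have := @differentiable_affine R W E f (z, 0) 1 w.
have -> : (fun q => f q + (z, 0)) = (fun x : W => (z, x) : E).
  by apply/funext => x; congr (_, _); rewrite /= ?addr0 ?add0r.
apply=> v; rewrite mul1r rn_pair_le//= ?rn0 ?rn_ge0//.
Qed.

Lemma differentiable_snd (p : E) : differentiable (fun q : E => q.2) p.
Proof.
have L : linear (fun q : E => q.2) by [].
pose f : {linear E -> W} := HB.pack (fun q : E => q.2) (GRing.isLinear.Build C E W *:%R _ L).
have := @differentiable_affine R E W f 0 1 p.
have -> : (fun q => f q + 0) = (fun q : E => q.2) by apply/funext => q; rewrite addr0.
by apply=> v; rewrite mul1r; exact: rn_snd.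
Qed.

Lemma cder_differentiable (f : C -> C) z d : cder f z d -> differentiable f z.
Proof.
move=> Hf; have L : linear (fun h : C => h * d).
  by move=> c u v; change ((c * u + v) * d = c * (u * d) + v * d); rewrite mulrDl mulrA.
pose D : {linear C -> C} := HB.pack (fun h : C => h * d) (GRing.isLinear.Build C C C *:%R _ L).
apply: (@differentiable_eps R C f z D).
  by move=> x; apply: (@mulrr_continuous _ d).
move=> e /Hf[del d0 Hd]; exists del => // h; rewrite rnC; exact: Hd.
Qed.

Lemma differentiable_expC (X : normedModType C) (f : X -> C) p :
  differentiable f p -> differentiable (fun q => expC (f q)) p.
Proof.
move=> Df; apply: (@differentiable_comp C X C C f (@expC R)) => //.
exact: cder_differentiable (cder_expC _).
Qed.

Lemma differentiable_at_fst (f : E -> C) (z : C) (w : W) : differentiable f ((z, w) : E) ->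
  differentiable (fun x : W => f (z, x)) w.
Proof. by move=> Df; exact: (differentiable_comp (differentiable_slice2 w z) Df). Qed.

Lemma open_setI_snd (V : set E) (Om : set W) : open V -> open Om ->
  open [set p : E | V p /\ Om p.2].
Proof.
move=> oV oO; rewrite openE => p [Vp Op]; apply/nbhs_rnP.
have [d d0 Hd] := open_rn oV Vp; have [e /= e0 He] := (nbhs_rnP p.2 Om).1 (open_nbhs_nbhs (conj oO Op)).
exists (Num.min d e); first by rewrite lt_min d0.
move=> q; rewrite lt_min => /andP[h1 h2]; split; first exact: Hd.
by apply: He; apply: le_lt_trans h2; exact: (@rn_snd R C W ((q : E) - p)).
Qed.

End Slices.

Lemma rcont_real (R : realType) (f : R -> R) (t : R) : {for t, continuous f} ->
  rcont (fun s => (f s)%:C%C : Cx R) t.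
Proof.
move=> cf e e0; have /cvgrPdist_le/(_ _ e0)/nbhs_ballP[r /= r0 Hr] := cf.
exists r => // s st; rewrite subrr expr0n addr0 sqrtr_sqr distrC.
by apply: Hr; rewrite /ball /= distrC.
Qed.

Lemma cont_on_dell (R : realType) (b u v : R) : 0 < b -> cont_on (dell b) u v.
Proof.
move=> b0 t _; have Q x : 0 < b ^+ 2 + x ^+ 2 by rewrite ltr_wpDr ?sqr_ge0// exprn_gt0.
have -> : dell b = fun s => (s%:C%C + - ('i%C * b%:C%C)) * ((b ^+ 2 + s ^+ 2)^-1)%:C%C.
  by apply/funext => s; apply/eqP; rewrite eq_complex /= !(mul0r, mulr0, mul1r, subr0, addr0, add0r, oppr0) mulNr !eqxx.
apply: rcontM; first by apply: rcontD; [apply: rcont_real; exact: cvg_id|exact: rcont_cst].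
apply: rcont_real; apply: cvgV; first by rewrite gt_eqF.
by apply: cvgD; [exact: cvg_cst|apply: exprn_continuous].
Qed.

Section SmoothPaths.
Variable R : realType.
Local Notation C := (Cx R).

Lemma within_continuous_eps (f : R -> R) : {within `[0, 1]%classic, continuous f} ->
  forall t, 0 <= t <= 1 -> forall e : R, 0 < e -> exists2 del : R, 0 < del &
    forall s, 0 <= s <= 1 -> `|s - t| < del -> `|f s - f t| <= e.
Proof.
move=> /subspace_continuousP cf t t01 e e0.
have /cf/cvgrPdist_le/(_ _ e0) : `[0, 1]%classic t by rewrite /= in_itv.
rewrite near_withinE => /nbhs_ballP[r /= r0 Hr]; exists r => // s s01 st.
rewrite distrC; apply: Hr; last by rewrite /= in_itv.
by rewrite /ball /= distrC.
Qed.

Definition velocity (g : R -> C) (t : R) : C :=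
  Complex (derive1 (fun s => complex.Re (g s)) t) (derive1 (fun s => complex.Im (g s)) t).

Lemma rder_velocity (D : set C) z w (g : R -> C) : C1_path_in D z w g ->
  forall t, 0 <= t <= 1 -> rder g t (velocity g t).
Proof.
move=> [[dR _] [dI _] _ _ _] t t01; have tI : t \in `[0, 1] by rewrite in_itv.
by apply: ReIm_rder; apply: DeriveDef; rewrite ?derive1E//; [exact: dR|exact: dI].
Qed.

Lemma cont_in_velocity (D : set C) z w (g : R -> C) : C1_path_in D z w g ->
  cont_in (velocity g) 0 1.
Proof.
move=> [[_ cR] [_ cI] _ _ _] t t01 e e0; have e2 : 0 < e / 2 by rewrite divr_gt0.
have [r r0 Hr] := within_continuous_eps cR t01 e2.
have [r' r0' Hr'] := within_continuous_eps cI t01 e2.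
exists (Num.min r r'); first by rewrite lt_min r0.
move=> s s01; rewrite lt_min => /andP[h1 h2].
rewrite (le_trans (normc_le_ReIm _))// ReB ImB (splitr e).
by apply: lerD; [exact: Hr|exact: Hr'].
Qed.

(** Straight in the logarithmic coordinate, where the sector is convex: an admissible path from [zo]
    to any point, on which the asymptotics of a competing solution can be evaluated. *)
Lemma C1_segment (D : set C) (z w : C) :
  (forall t : R, 0 <= t <= 1 -> D (z + t%:C%C * (w - z))) ->
  C1_path_in D z w (fun t => z + t%:C%C * (w - z)).
Proof.
move=> HD; have DR (t : R) := rder_ReIm (rder_line z (w - z) t).
split.
- split=> [t _|]; first by have [[]] := DR t.
  have -> : derive1 (fun s => complex.Re (z + s%:C%C * (w - z))) = cst (complex.Re (w - z)).
    by apply/funext => t; rewrite derive1E; have [[_ ->]] := DR t.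
  by apply: continuous_subspaceT => x; exact: cvg_cst.
- split=> [t _|]; first by have [_ []] := DR t.
  have -> : derive1 (fun s => complex.Im (z + s%:C%C * (w - z))) = cst (complex.Im (w - z)).
    by apply/funext => t; rewrite derive1E; have [_ [_ ->]] := DR t.
  by apply: continuous_subspaceT => x; exact: cvg_cst.
- by rewrite mul0r addr0.
- by rewrite mul1r addrC subrK.
by move=> t; rewrite in_itv /=; exact: HD.
Qed.

End SmoothPaths.

(** * The family of equations *)

Section Family.
Variables (R : realType) (n m : nat).
Local Notation C := (Cx R).
Local Notation W := 'rV[Cx R]_m.
Local Notation E := (C * W)%type.
Variables (a : R) (I : set R) (Omega : set W) (N : 'M[C]_n -> R).
Variables (Lam Rm : E -> 'M[C]_n) (zo : C) (U : set E).
Hypothesis a_gt0 : 0 < a.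
Hypothesis I_itv : is_interval I.
Hypothesis Omega_open : open Omega.
Hypothesis N_norm : is_mx_norm N.
Hypothesis zo_in : sector I a zo.
Hypothesis U_open : open U.
Hypothesis U_sub : sector I a `*` Omega `<=` U.
Hypothesis Lam_diff : forall p, U p -> differentiable Lam p.
Hypothesis Rm_diff : forall p, U p -> differentiable Rm p.
Hypothesis Lam_diag : forall p, (sector I a `*` Omega) p -> is_diag_mx (Lam p).

Local Notation Sec := (sector I a).
Local Notation V := (ray_core zo U).

Definition family_coef (p : E) : 'M[C]_n := expC p.1 *: (Lam p + Rm p).
Definition exponent (i : 'I_n) : E -> C := prim zo (fun p => expC p.1 * Lam p i i).

Let V_open : open V := ray_core_open U_open.
Let V_ray p t : V p -> 0 <= t <= 1 -> V (ray zo t p) := @ray_core_ray _ _ _ _ p t.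

Lemma sector_core z w : Sec z -> Omega w -> V (z, w).
Proof.
by move=> Sz Ow t t01; apply: U_sub; split=> //=; exact: sector_convex.
Qed.

Lemma differentiable_expC_fst (p : E) : differentiable (fun q : E => expC q.1) p.
Proof. by apply: differentiable_expC; exact: differentiable_fst. Qed.

Lemma mhol_family_coef : mhol V family_coef.
Proof.
move=> i j q /ray_core_sub Uq.
have -> : (fun x => family_coef x i j) = fun x : E => expC x.1 * (Lam x i j + Rm x i j).
  by apply/funext => x; rewrite !mxE.
apply: differentiable_mul; first exact: differentiable_expC_fst.
have D1 := (differentiable_entry i j (Lam_diff Uq)).1.
have D2 := (differentiable_entry i j (Rm_diff Uq)).1.
exact: (differentiableD D1 D2).
Qed.

Lemma differentiable_exponent_coef i p : V p -> differentiable (fun q : E => expC q.1 * Lam q i i) p.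
Proof.
move=> /ray_core_sub Uq; apply: differentiable_mul; first exact: differentiable_expC_fst.
exact: (differentiable_entry i i (Lam_diff Uq)).1.
Qed.

Lemma differentiable_exponent i p : V p -> differentiable (exponent i) p.
Proof.
by move=> Vp; exact: (differentiable_prim V_open V_ray (fun q => @differentiable_exponent_coef i q) Vp).
Qed.

Lemma cder_exponent i z w : Sec z -> Omega w ->
  cder (fun x => exponent i (x, w)) z (expC z * Lam (z, w) i i).
Proof.
move=> Sz Ow; apply: (cder_prim V_open V_ray _ (sector_core Sz Ow)) => q Vq.
exact: differentiable_exponent_coef.
Qed.

Lemma exponent_base i w : exponent i (zo, w) = 0.
Proof. by rewrite /exponent /prim /= subrr mul0r. Qed.

Variables (Y0 Z0 : E -> 'M[C]_n).
Hypothesis Y0_hol : mhol V Y0.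
Hypothesis Z0_hol : mhol V Z0.
Hypothesis Z0Y0 : forall p, V p -> Z0 p *m Y0 p = 1%:M.
Hypothesis Y0_der : forall z w, V (z, w) ->
  mcder (fun x => Y0 (x, w)) z (family_coef (z, w) *m Y0 (z, w)).
Hypothesis Z0_der : forall z w, V (z, w) ->
  mcder (fun x => Z0 (x, w)) z (- (Z0 (z, w) *m family_coef (z, w))).

Local Notation slice F w := (fun z : C => F (z, w)).
Local Notation Aw w := (odeA (slice Lam w) (slice Rm w)).
Local Notation solw w := (sol Sec (Aw w)).
Local Notation Lw w := (fun i z => exponent i (z, w)).

Lemma slice_sol w z : Omega w -> Sec z -> mcder (slice Y0 w) z (Aw w z *m Y0 (z, w)).
Proof. by move=> Ow Sz; exact: (Y0_der (sector_core Sz Ow)). Qed.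

Lemma Y0Z0 w z : Omega w -> Sec z -> Y0 (z, w) *m Z0 (z, w) = 1%:M.
Proof. by move=> Ow Sz; apply: mulmx1C; apply: Z0Y0; exact: sector_core. Qed.

Lemma slice_unique w y : Omega w -> solw w y -> forall z x, Sec z -> Sec x ->
  y z = Y0 (z, w) *m (Z0 (x, w) *m y x).
Proof.
move=> Ow sy z x Sz Sx.
suff -> : Z0 (x, w) *m y x = Z0 (z, w) *m y z by rewrite mulmxA Y0Z0// mul1mx.
apply/matrixP => i j.
apply: (@cder_zero_segment R (fun u => (Z0 (u, w) *m y u) i j) z x) => t t01.
have St := sector_convex a_gt0 I_itv Sz Sx t01.
have := mcderM (Z0_der (sector_core St Ow)) (sy _ St).
by rewrite mulNmx -mulmxA addNr => /(_ i j); rewrite mxE.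
Qed.

Lemma slice_diag w z : Omega w -> Sec z -> is_diag_mx (Lam (z, w)).
Proof. by move=> Ow Sz; exact: Lam_diag. Qed.

Hypothesis Lam_L : uniform_L_condition a I Omega Lam.
Hypothesis Rm_decay : uniform_good_decay a I Omega N Rm.

Lemma path_integral_ell i j w phi b s t : Omega w -> I phi -> a <= b -> s <= t ->
  path_integral (fun z => Lam (z, w) i i - Lam (z, w) j j) (ell phi b) s t =
  (Lw w i (ell phi b t) - Lw w j (ell phi b t)) - (Lw w i (ell phi b s) - Lw w j (ell phi b s)).
Proof.
move=> Ow Iphi ab st; have b0 := lt_le_trans a_gt0 ab.
have S x : Sec (ell phi b x) by exact: ell_sector.
apply: (@path_integral_primitive R _ (fun z => Lw w i z - Lw w j z) (ell phi b) (dell b)) => //.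
- by move=> x _; exact: rder_ell.
- by apply: cont_on_in; exact: cont_on_dell.
- move=> x _; rewrite mulrBr; apply: (gderB (cder_exponent i (S x) Ow) (cder_exponent j (S x) Ow)).
move=> x _; have Ux := U_sub (conj (S x) Ow : (Sec `*` Omega) (ell phi b x, w)).
have D k := cder_fst (differentiable_entry k k (Lam_diff Ux)).1.
apply: (rcontB (cder_rcont_comp (D i) (rder_ell phi x b0)) (cder_rcont_comp (D j) (rder_ell phi x b0))).
Qed.

(** [fw j i] records which alternative of the L-condition holds for the pair [(i, j)]. Neither it
    nor [K] depends on omega: otherwise the boundary value problems would not vary
    holomorphically. *)
Lemma line_gap (c d : R) : c <= d -> `[c, d]%classic `<=` I ->
  exists (K : R) (fw : 'I_n -> pred 'I_n), 1 <= K /\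
  forall w, Omega w -> forall j i phi b s t, c <= phi <= d -> a <= b -> s <= t ->
  normc (if fw j i then gap (Lw w) j i (ell phi b t) (ell phi b s)
         else gap (Lw w) j i (ell phi b s) (ell phi b t)) <= K.
Proof.
move=> cd JI.
have /choice[k Hk] (ij : 'I_n * 'I_n) : exists k : R * bool, forall w, Omega w ->
    forall phi b s t, c <= phi <= d -> a <= b -> s <= t ->
    complex.Re (if k.2 then (Lw w ij.1 (ell phi b t) - Lw w ij.2 (ell phi b t)) - (Lw w ij.1 (ell phi b s) - Lw w ij.2 (ell phi b s))
     else (Lw w ij.1 (ell phi b s) - Lw w ij.2 (ell phi b s)) - (Lw w ij.1 (ell phi b t) - Lw w ij.2 (ell phi b t))) <= k.1.
  have Hval w phi b s t : Omega w -> c <= phi <= d -> a <= b -> s <= t ->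
      L_values a Lam ij.1 ij.2 `[c, d] w (complex.Re ((Lw w ij.1 (ell phi b t) - Lw w ij.2 (ell phi b t)) -
        (Lw w ij.1 (ell phi b s) - Lw w ij.2 (ell phi b s))))%:E.
    move=> Ow pJ ab st; exists phi, b, s, t; split=> //.
    have Iphi : I phi by apply: JI; rewrite /= in_itv.
    by rewrite (path_integral_ell ij.1 ij.2 Ow Iphi ab st).
  have Hc : closed_itv_in I `[c, d]%classic by exists c, d.
  have [K1 [K2 [[h _]|h]]] := Lam_L ij.1 ij.2 Hc.
    exists (K1, true) => w Ow phi b s t pJ ab st; rewrite -lee_fin.
    apply: le_trans h; apply: le_trans (ereal_sup_ubound _); last by exists w.
    by apply: ereal_sup_ubound; exact: Hval.
  exists (- K2, false) => w Ow phi b s t pJ ab st.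
  have reN (z u : C) : complex.Re (z - u) = - complex.Re (u - z) by rewrite !ReB opprB.
  rewrite [X in X <= _]reN lerN2 -lee_fin; apply: (le_trans h).
  apply: (@le_trans _ _ (L_inf a Lam ij.1 ij.2 `[c, d] w)).
    by apply: ereal_inf_lbound; exists w.
  by apply: ereal_inf_lbound; exact: Hval.
have S0 : 0 <= \sum_x expR (k x).1 by rewrite sumr_ge0// => x _; exact: expR_ge0.
(* One constant above the exponentials of all the bounds, and at least 1 as [conn_K] demands. *)
exists (1 + \sum_x expR (k x).1), (fun j i => (k (i, j)).2); split.
  by rewrite lerDl.
move=> w Ow j i phi b s t pJ ab st; have := Hk (i, j) w Ow phi b s t pJ ab st; rewrite /=.
have fin (u : C) : complex.Re u <= (k (i, j)).1 -> normc (expC u) <= 1 + \sum_x expR (k x).1.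
  move=> h; rewrite normc_expC; apply: (@le_trans _ _ (expR (k (i, j)).1)); first by rewrite ler_expR.
  apply: ler_wpDl => //; apply: (sum_ge_term (F := fun x => expR (k x).1)) => y; exact: expR_ge0.
by case: ifP => _; exact: fin.
Qed.

Lemma rcont_mx_norm (F : R -> 'M[C]_n) (t : R) :
  (forall i j, rcont (fun s => F s i j) t) -> {for t, continuous (fun s => N (F s))}.
Proof.
move=> cF; apply/cvgrPdist_le => e e0.
pose S := \sum_(i : 'I_n) \sum_(j : 'I_n) N (delta_mx i j) + 1.
have N0 := mx_norm_ge0 N_norm.
have S0 : 0 < S by rewrite ltr_wpDl// sumr_ge0// => i _; rewrite sumr_ge0.
have eS : 0 < e / S by rewrite divr_gt0.
have near1 (x : 'I_n * 'I_n) : \forall s \near t, normc (F t x.1 x.2 - F s x.1 x.2) <= e / S.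
  have [r r0 Hr] := cF x.1 x.2 _ eS; apply/nbhs_ballP; exists r => // s.
  by rewrite /ball /= distrC => st; rewrite normcBC; exact: Hr.
have nearall : \forall s \near t, forall x : 'I_n * 'I_n, normc (F t x.1 x.2 - F s x.1 x.2) <= e / S.
  exact: (@filter_forall R ('I_n * 'I_n)%type (fun x s => normc (F t x.1 x.2 - F s x.1 x.2) <= e / S) (nbhs t) _ near1).
near=> s.
have H : forall x : 'I_n * 'I_n, normc (F t x.1 x.2 - F s x.1 x.2) <= e / S by near: s.
apply: (le_trans (mx_norm_dist N_norm _ _)); apply: (le_trans (mx_norm_entries N_norm _)).
apply: (@le_trans _ _ (\sum_(i : 'I_n) \sum_(j : 'I_n) (e / S) * N (delta_mx i j))).
  apply: ler_sum => i _; apply: ler_sum => j _; apply: ler_wpM2r; first exact: N0.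
  by rewrite !mxE; exact: (H (i, j)).
have -> : \sum_(i : 'I_n) \sum_(j : 'I_n) e / S * N (delta_mx i j) = e / S * (S - 1).
  by rewrite addrK mulr_sumr; apply: eq_bigr => i _; rewrite mulr_sumr.
by rewrite mulrBr divfK ?gt_eqF// mulr1 lerBlDr lerDl ltW.
Unshelve. all: by end_near. Qed.

(** [m0 b] is the supremum of the L^1-norms over all parameters and directions, multiplied by [CN],
    the constant used later to pass from [N] to the entries. *)
Lemma decay_bound (c d CN : R) : c <= d -> `[c, d]%classic `<=` I -> 0 < CN ->
  exists (m0 : R -> R) (b0 : R),
  (forall eps, 0 < eps -> exists beta, forall b, beta <= b -> m0 b <= eps) /\
  forall w, Omega w -> forall phi b, c <= phi <= d -> a <= b -> b0 <= b ->
  exists G : R -> R, (forall s : R, is_derive s 1 G (CN * N (Rm (ell phi b s, w)))) /\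
    forall u v, u <= v -> G v - G u <= m0 b.
Proof.
move=> cd JI CN0; have [g _ Hg] := Rm_decay.
have HJ : closed_itv_in I `[c, d]%classic by exists c, d.
have [_ _ /fine_cvgP[[b0 [_ Hfin]] Hlim]] := Hg _ HJ.
move: Hfin Hlim; set S := (fun b : R => ereal_sup _) => Hfin Hlim.
(* [S b] is known to be finite for [b0 < b] only, a strict inequality; hence [b0 + 1]. *)
exists (fun b => CN * fine (S b)), (b0 + 1); split.
  move=> e e0; have e1 : 0 < e / CN by rewrite divr_gt0.
  have /cvgrPdist_le/(_ _ e1)[M [_ HM]] := Hlim.
  exists (M + 1) => b Mb; rewrite mulrC -ler_pdivlMr//.
  have /HM : M < b by rewrite (lt_le_trans _ Mb)// ltrDl.
  by rewrite /= sub0r normrN; apply: le_trans; exact: ler_norm.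
move=> w Ow phi b pJ ab b0b; have b_gt0 := lt_le_trans a_gt0 ab.
have fS : S b \is a fin_num by apply: Hfin; rewrite (lt_le_trans _ b0b)// ltrDl.
have Iphi : I phi by apply: JI; rewrite /= in_itv.
have cN : continuous (fun s => N (Rm (ell phi b s, w))).
  move=> s; apply: rcont_mx_norm => i j.
  have Us := U_sub (conj (ell_sector s a_gt0 Iphi ab) Ow : (Sec `*` Omega) (ell phi b s, w)).
  exact: cder_rcont_comp (cder_fst (differentiable_entry i j (Rm_diff Us)).1) (rder_ell phi s b_gt0).
have N0 := mx_norm_ge0 N_norm.
have intN : (\int[lebesgue_measure]_s (N (Rm (ell phi b s, w)))%:E <= (fine (S b))%:E)%E.
  rewrite fineK//; apply: (@le_trans _ _ (ereal_sup [set L1_norm_ell N Rm w p b | p in `[c, d]%classic])).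
    by apply: ereal_sup_ubound; exists phi => //=; rewrite in_itv.
  by apply: ereal_sup_ubound; exists w.
have [G [DG HG]] := L1_primitive cN (fun s => N0 _) intN.
exists (fun s => CN * G s); split=> [s|u v uv].
  have D := DG s; exact: (is_deriveZ CN D).
by rewrite -mulrBr ler_wpM2l ?(ltW CN0)// HG.
Qed.

(** The analytic hypotheses of the section on a fixed parameter, with [be], [K], [fw] and [mb]
    common to all omega. *)
Definition line_data (c d be K : R) (fw : 'I_n -> pred 'I_n) (mb : R -> R) : Prop :=
  [/\ a <= be, 1 <= K,
    (forall w, Omega w -> forall j i phi b s t, c <= phi <= d -> be <= b -> s <= t ->
      normc (if fw j i then gap (Lw w) j i (ell phi b t) (ell phi b s)
         else gap (Lw w) j i (ell phi b s) (ell phi b t)) <= K),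
    ((forall b, be <= b -> K * n%:R * mb b <= 1 / (6 * K ^+ 2)) /\
     forall eps, 0 < eps -> exists beta, forall b, beta <= b -> be <= b -> mb b <= eps) &
    forall w, Omega w -> exists G g : R -> R -> R -> R,
      [/\ forall phi b (s : R), c <= phi <= d -> be <= b -> is_derive s 1 (G phi b) (g phi b s),
        forall phi b s i l, c <= phi <= d -> be <= b -> normc (Rm (ell phi b s, w) i l) <= g phi b s &
        forall phi b u v, c <= phi <= d -> be <= b -> u <= v -> G phi b v - G phi b u <= mb b]].

Lemma line_data_exists (c d : R) : c <= d -> `[c, d]%classic `<=` I ->
  exists be K fw mb, line_data c d be K fw mb.
Proof.
move=> cd JI; have [K [fw [K1 Hgap]]] := line_gap cd JI.
have [CN CN0 HCN] := mx_norm_equiv N_norm.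
have [mb [b0 [Hm HG]]] := decay_bound cd JI CN0.
have K0 := lt_le_trans ltr01 K1.
have Kn : 0 < K * n%:R + 1 by rewrite ltr_wpDl// mulr_ge0// ltW.
have e0 : 0 < 1 / (6 * K ^+ 2) / (K * n%:R + 1) by rewrite !divr_gt0// mulr_gt0// exprn_gt0.
have [b1 Hb1] := Hm _ e0.
pose be := Num.max a (Num.max b0 b1).
have abe : a <= be by rewrite le_max lexx.
have b0be : b0 <= be by rewrite !le_max lexx orbT.
have b1be : b1 <= be by rewrite !le_max lexx !orbT.
exists be, K, fw, mb; split=> //.
- by move=> w Ow j i phi b s t pJ bb st; apply: Hgap => //; exact: le_trans bb.
- split=> [b bb|e /Hm[beta Hb]]; last by exists beta => b bb _; exact: Hb.
  have := Hb1 _ (le_trans b1be bb); rewrite ler_pdivlMr// mulrC.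
  have [m0|m0] := leP 0 (mb b); first by apply: le_trans; rewrite ler_wpM2r// lerDl.
  move=> _; apply: (@le_trans _ _ 0); first by rewrite mulr_ge0_le0 ?mulr_ge0 ?(ltW K0)// ltW.
  by rewrite divr_ge0// mulr_ge0// sqr_ge0.
move=> w Ow.
have /choice[G HGG] (x : R * R) : exists G : R -> R, c <= x.1 <= d -> be <= x.2 ->
   (forall s : R, is_derive s 1 G (CN * N (Rm (ell x.1 x.2 s, w)))) /\
    forall u v, u <= v -> G v - G u <= mb x.2.
  have [pJ|?] := boolP (c <= x.1 <= d); last by exists id.
  have [bb|] := leP be x.2; last by exists id.
  by have [G] := HG w Ow x.1 x.2 pJ (le_trans abe bb) (le_trans b0be bb); exists G.
exists (fun p b => G (p, b)), (fun p b s => CN * N (Rm (ell p b s, w))); split.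
- by move=> phi b s pJ bb; exact: (HGG (phi, b) pJ bb).1.
- by move=> *; exact: HCN.
- by move=> phi b u v pJ bb; exact: (HGG (phi, b) pJ bb).2.
Qed.

Section OnInterval.
Variables (c d be K : R) (fw : 'I_n -> pred 'I_n) (mb : R -> R).
Hypothesis JI : `[c, d]%classic `<=` I.
Hypothesis D : line_data c d be K fw mb.

Local Notation lsol w j := (line_sol Sec (slice Lam w) (slice Rm w) (Lw w) fw j).
Local Notation lbvp w j := (line_bvp (Lw w) (slice Y0 w) fw j).

Lemma interval_facts w j : Omega w ->
  [/\ forall phi b, c <= phi <= d -> be <= b -> exists y, lsol w j phi b y /\
        forall i, cvgC (fun k => nrm (Lw w) j (lbvp w j phi b (- k%:R) k%:R) i (ell phi b 0))
          (nrm (Lw w) j y i (ell phi b 0)),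
    forall phi b y, c < phi < d -> be <= b -> lsol w j phi b y ->
      forall phi' b', c < phi' < d -> be <= b' -> lsol w j phi' b' y,
    forall phi b y, c <= phi <= d -> be <= b -> lsol w j phi b y ->
      forall s i, normc (nrm (Lw w) j y i (ell phi b s) - (i == j)%:R) <= K * n%:R * mb b * (2 * K),
    forall phi b y, c <= phi <= d -> be <= b -> solw w y ->
      (forall e, 0 < e -> exists M, forall s i, M <= `|s| ->
         normc (nrm (Lw w) j y i (ell phi b s)) <= e) ->
      forall z, Sec z -> y z = 0 &
    forall phi b u v, c <= phi <= d -> be <= b -> u <= v ->
      bvp_matrix (fw j) (slice Y0 w) (ell phi b u) (ell phi b v) \in unitmx /\
      forall i s, u <= s <= v ->
        normc (nrm (Lw w) j (lbvp w j phi b u v) i (ell phi b s)) <= 2 * K].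
Proof.
move=> Ow; have [abe K1 Hgap [msmall mlim] /(_ w Ow)[G [g [DG gB GT]]]] := D.
have be0 := lt_le_trans a_gt0 abe.
have eS phi b s : c <= phi <= d -> be <= b -> Sec (ell phi b s).
  by move=> pJ bb; apply: ell_sector => //; [apply: JI; rewrite /= in_itv|exact: le_trans bb].
have Hd z := @slice_diag w z Ow.
have HL z i (Sz : Sec z) := cder_exponent i Sz Ow.
have HY z := @slice_sol w z Ow.
have HZ z (Sz : Sec z) := Z0Y0 (sector_core Sz Ow).
have HU := slice_unique Ow.
have Hg := Hgap w Ow.
split.
- exact: (line_sol_exists Hd HL HY HZ HU be0 eS K1 Hg DG gB GT msmall).
- exact: (line_sol_all Hd HL HY HZ HU be0 eS K1 Hg DG gB GT msmall mlim).
- exact: (line_sol_near1 Hd HL HY HZ be0 eS K1 Hg DG gB GT msmall).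
- exact: (line_unique Hd HL HU be0 eS K1 Hg DG gB GT msmall).
move=> phi b u v pJ bb uv.
have Hc := @conn_seg _ _ _ (slice Lam w) (slice Rm w) (Lw w) Hd HL c d be be0 eS K fw K1 Hg G g DG gB j phi b u v pJ bb uv.
have Hh := seg_half (n := n) K1 GT msmall pJ bb uv.
split; first exact: (bvp_matrix_unit HY HZ Hc Hh (eS phi b u pJ bb)).
have Hb := @line_bvpP _ _ _ (slice Lam w) (slice Rm w) (Lw w) Hd HL _ _ HY HZ c d be be0 eS K fw
  K1 Hg G g mb DG gB GT msmall j phi b u v pJ bb uv.
by move=> i s us; exact: (bvp_bound Hc Hh Hb i (seg_in phi b us)).
Qed.

(** The margin between [[c1, d1]] and [[c, d]] permits turning by [del]. By [rotate_line] a point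
    [z] of the sector then lies on a line at distance at least [umod z * sin del] from the origin,
    and [M] makes this distance large enough. *)
Lemma sector_decay (c1 d1 : R) : c < c1 -> c1 <= d1 -> d1 < d ->
  forall eps, 0 < eps -> exists M : R, forall w j y, Omega w ->
  (forall phi b, c < phi < d -> be <= b -> lsol w j phi b y) ->
  forall z i, sector `[c1, d1] a z -> M <= umod z ->
  normc (nrm (Lw w) j y i z - (i == j)%:R) <= eps.
Proof.
move=> cc cd dd eps e0; have [abe K1 _ [_ mlim] _] := D.
have K0 := lt_le_trans ltr01 K1; have p4 : 0 < (pi : R) / 4 by rewrite divr_gt0// pi_gt0.
pose del : R := Num.min (pi / 4) (Num.min ((c1 - c) / 2) ((d - d1) / 2)).
have del0 : 0 < del by rewrite !lt_min p4 !divr_gt0// subr_gt0.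
have del1 : del <= pi / 4 by rewrite ge_min lexx.
have del2 : del < c1 - c.
  have : del <= (c1 - c) / 2 by rewrite !ge_min lexx orbT.
  by move/le_lt_trans; apply; rewrite ltr_pdivrMr// ltr_pMr ?ltr1n// subr_gt0.
have del3 : del < d - d1.
  have : del <= (d - d1) / 2 by rewrite !ge_min lexx !orbT.
  by move/le_lt_trans; apply; rewrite ltr_pdivrMr// ltr_pMr ?ltr1n// subr_gt0.
have sd : 0 < sin del.
  apply: sin_gt0_pi; rewrite del0/= (le_lt_trans del1)// ltr_pdivrMr//.
  by rewrite ltr_pMr ?ltr1n// pi_gt0.
have Kn : 0 < K * n%:R * (2 * K) + 1 by rewrite ltr_wpDl// !mulr_ge0// ltW.
have [beta Hb] := mlim _ (divr_gt0 e0 Kn).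
exists (Num.max beta be / sin del) => w j y Ow Hy z i Sz.
rewrite ler_pdivrMr// => Mz.
have [phi [phiJ hz _]] := (sectorP `[c1, d1]%classic z a_gt0).1 Sz.
have phiJ' : c1 <= phi <= d1 by move: phiJ; rewrite /= in_itv.
have [|psi [b [s [/andP[p1 p2] zE ub]]]] := @rotate_line R c1 d1 del phi z phiJ' _ hz.
  by rewrite del0.
have bb : be <= b by apply: le_trans (le_trans Mz ub); rewrite le_max lexx orbT.
have betab : beta <= b by apply: le_trans (le_trans Mz ub); rewrite le_max lexx.
have pJ : c < psi < d.
  apply/andP; split; first by rewrite (lt_le_trans _ p1)// ltrBrDr -ltrBrDl.
  by rewrite (le_lt_trans p2)// -ltrBrDl.
have pJc : c <= psi <= d by case/andP: pJ => ? ?; rewrite !ltW.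
have [_ _ near1 _ _] := interval_facts j Ow.
rewrite zE; apply: (le_trans (near1 psi b y pJc bb (Hy psi b pJ bb) s i)).
have X0 : 0 <= K * n%:R * (2 * K) by rewrite !mulr_ge0// ltW.
have := Hb b betab bb; rewrite ler_pdivlMr// mulrDr mulr1 [mb b * _]mulrC mulrAC => h.
have [m0|m0] := leP 0 (mb b); first by apply: le_trans h; rewrite lerDl.
by apply: (@le_trans _ _ 0); [rewrite mulrAC mulr_ge0_le0// ltW|exact: ltW].
Qed.

(** The coordinates with respect to [Y0] are obtained by inverting [bvp_matrix], whose entries are
    values of [Y0] at points that do not depend on the parameter. *)
Lemma differentiable_lbvp j phi b (u v x0 : R) w i : c <= phi <= d -> be <= b -> u <= v -> Omega w ->
  differentiable (fun w => nrm (Lw w) j (lbvp w j phi b u v) i (ell phi b x0)) w.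
Proof.
move=> pJ bb uv Ow; have [abe _ _ _ _] := D.
have S x : Sec (ell phi b x).
  by apply: ell_sector => //; [apply: JI; rewrite /= in_itv|exact: le_trans bb].
have [r r0 Hr] := (nbhs_rnP w Omega).1 (open_nbhs_nbhs (conj Omega_open Ow)).
have DY x k l : differentiable (fun w => Y0 (ell phi b x, w) k l) w.
  apply: (@differentiable_at_fst R _ (fun p => Y0 p k l)); apply: Y0_hol; exact: sector_core.
have DL x k : differentiable (fun w => exponent k (ell phi b x, w)) w.
  by apply: (@differentiable_at_fst R _ (exponent k)); apply: differentiable_exponent; exact: sector_core.
rewrite /nrm /line_bvp; apply: differentiable_mul; last first.
  by apply: differentiable_expC; apply: differentiableN; exact: DL.
apply: differentiable_mulmx => [k l|]; first exact: DY.
apply: differentiable_mulmx.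
  apply: (differentiable_invmx r0).
    move=> q /Hr Oq; have [_ _ _ _ H] := interval_facts j Oq.
    exact: (H phi b u v pJ bb uv).1.
  move=> k l; have -> : (fun q => bvp_matrix (fw j) (slice Y0 q) (ell phi b u) (ell phi b v) k l) =
     fun q => Y0 (ell phi b (if fw j k then u else v), q) k l.
    by apply/funext => q; rewrite mxE /base; case: ifP.
  exact: DY.
move=> k l; have -> : (fun q => (\col_i0 ((i0 == j)%:R * expC (exponent j (base (fw j) (ell phi b u) (ell phi b v) i0, q)))) k l) =
    fun q => (k == j)%:R * expC (exponent j (ell phi b (if fw j k then u else v), q)).
  by apply/funext => q; rewrite mxE /base; case: ifP.
apply: differentiable_mul; first exact: differentiable_cst.
by apply: differentiable_expC; exact: DL.
Qed.

End OnInterval.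

(** All that is kept of the construction on one interval; [fw] and [K] disappear, so that results
    for different intervals can be compared. At [x0] the columns are limits of the symmetric
    problems, bounded by [2 * K], hence holomorphic in the parameter. *)
Lemma sector_solution (c c1 d1 d : R) : c < c1 -> c1 <= d1 -> d1 < d ->
  `[c, d]%classic `<=` I ->
  exists (y : W -> 'I_n -> C -> 'cV[C]_n) (be : R) (x0 : C),
  (a <= be /\ Sec x0) /\
  [/\ forall w j, Omega w -> solw w (y w j),
    forall eps, 0 < eps -> exists M : R, forall w j z i, Omega w ->
      sector `[c1, d1] a z -> M <= umod z ->
      normc (nrm (Lw w) j (y w j) i z - (i == j)%:R) <= eps,
    forall w j, Omega w -> forall phi v, c <= phi <= d -> solw w v ->
      (forall e, 0 < e -> exists M, forall s i, M <= `|s| ->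
         normc (nrm (Lw w) j v i (ell phi be s)) <= e) ->
      forall z, Sec z -> v z = 0 &
    forall w j i, Omega w -> differentiable (fun w => nrm (Lw w) j (y w j) i x0) w].
Proof.
move=> cc cd dd JI; have cd' : c <= d by rewrite ltW// (lt_le_trans cc)// (le_trans cd)// ltW.
have [be [K [fw [mb D]]]] := line_data_exists cd' JI.
have [abe _ _ _ _] := D.
have pJ : c < c1 < d by rewrite cc (le_lt_trans cd).
have pJc : c <= c1 <= d by case/andP: pJ => ? ?; rewrite !ltW.
pose x0 := ell c1 be 0.
have Sx0 : Sec x0 by apply: ell_sector => //; apply: JI; rewrite /= in_itv.
have /choice[y Hy] (wj : W * 'I_n) : exists y, Omega wj.1 ->
    line_sol Sec (slice Lam wj.1) (slice Rm wj.1) (Lw wj.1) fw wj.2 c1 be y /\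
        forall i, cvgC (fun k => nrm (Lw wj.1) wj.2
          (line_bvp (Lw wj.1) (slice Y0 wj.1) fw wj.2 c1 be (- k%:R) k%:R) i x0)
          (nrm (Lw wj.1) wj.2 y i x0).
  have [Ow|] := pselect (Omega wj.1); last by exists (fun=> 0).
  have [ex _ _ _ _] := interval_facts JI D wj.2 Ow.
  by have [y Hy] := ex c1 be pJc (lexx be); exists y.
exists (fun w j => y (w, j)), be, x0; split=> //; split.
- by move=> w j Ow; have [[]] := Hy (w, j) Ow.
- move=> eps e0; have [M HM] := sector_decay JI D cc cd dd e0.
  exists M => w j z i Ow; apply: HM => //.
  have [_ all _ _ _] := interval_facts JI D j Ow.
  exact: all pJ (lexx be) (Hy (w, j) Ow).1.
- move=> w j Ow phi v pJ' sv Hv; have [_ _ _ uniq _] := interval_facts JI D j Ow.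
  exact: uniq pJ' (lexx be) sv Hv.
move=> w j i Ow.
have [r r0 Hr] := (nbhs_rnP w Omega).1 (open_nbhs_nbhs (conj Omega_open Ow)).
have kk (k : nat) : - (k%:R : R) <= k%:R by rewrite (@le_trans _ _ 0)// oppr_le0.
apply: (hol_limit (f := fun k w => nrm (Lw w) j
  (line_bvp (Lw w) (slice Y0 w) fw j c1 be (- k%:R) k%:R) i x0) (M := 2 * K) r0 _ _ _).1.
- by move=> k q /Hr Oq; exact: (differentiable_lbvp JI D j 0 i pJc (lexx be) (kk k) Oq).
- move=> k q /Hr Oq; have [_ _ _ _ H] := interval_facts JI D j Oq.
  by apply: (H c1 be (- k%:R) k%:R pJc (lexx be) (kk k)).2; rewrite oppr_le0 ler0n.
by move=> q /Hr Oq; exact: (Hy (q, j) Oq).2 i.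
Qed.

Lemma path_integral_exponent i w z gamma : Omega w -> C1_path_in Sec zo z gamma ->
  path_integral (fun t => Lam (t, w) i i) gamma 0 1 = exponent i (z, w).
Proof.
move=> Ow Hg; have [_ _ g0 g1 gS] := Hg.
have S t : 0 <= t <= 1 -> Sec (gamma t) by move=> t01; apply: gS; rewrite in_itv.
have -> : exponent i (z, w) = exponent i (gamma 1, w) - exponent i (gamma 0, w).
  by rewrite g0 g1 exponent_base subr0.
apply: (@path_integral_primitive R _ (fun z => exponent i (z, w)) gamma (velocity gamma)) => //.
- exact: rder_velocity Hg.
- exact: cont_in_velocity Hg.
- by move=> t t01; apply: (cder_exponent i (S t t01) Ow).
move=> t t01; have Ux := U_sub (conj (S t t01) Ow : (Sec `*` Omega) (gamma t, w)).
have D := cder_fst (differentiable_entry i i (Lam_diff Ux)).1.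
exact: (cder_rcont_comp D (rder_velocity Hg t01)).
Qed.

(** * The fundamental matrix: invertibility, asymptotics in every sector, uniqueness *)

Section Solution.
Variables (y : W -> 'I_n -> C -> 'cV[C]_n) (be phi0 c0 d0 : R) (x0 : C).
Hypothesis I_open : open I.
Hypothesis I_phi0 : I phi0.
Hypothesis phi0_in : c0 <= phi0 <= d0.
Hypothesis a_be : a <= be.
Hypothesis x0_in : Sec x0.
Hypothesis y_sol : forall w j, Omega w -> solw w (y w j).
Hypothesis y_decay : forall eps, 0 < eps -> exists M : R, forall w j z i, Omega w ->
      sector `[phi0, phi0] a z -> M <= umod z ->
      normc (nrm (Lw w) j (y w j) i z - (i == j)%:R) <= eps.
Hypothesis y_unique : forall w j, Omega w -> forall phi v, c0 <= phi <= d0 -> solw w v ->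
      (forall e, 0 < e -> exists M, forall s i, M <= `|s| ->
         normc (nrm (Lw w) j v i (ell phi be s)) <= e) ->
      forall z, Sec z -> v z = 0.
Hypothesis y_hol : forall w j i, Omega w ->
  differentiable (fun w => nrm (Lw w) j (y w j) i x0) w.

(* [y] is only known to be holomorphic in the parameter at the point [x0]; the
   value there is transported by the fundamental solution [Y0]. *)
Definition solution (p : E) : 'M[C]_n :=
  \matrix_(i, j) (Y0 p *m (Z0 (x0, p.2) *m y p.2 j x0)) i 0.

Lemma solutionE z w i j : Omega w -> Sec z -> solution (z, w) i j = y w j z i 0.
Proof. by move=> Ow Sz; rewrite mxE /= -(slice_unique Ow (y_sol j Ow) Sz x0_in). Qed.

Lemma differentiable_solution p : V p -> Omega p.2 -> differentiable solution p.
Proof.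
move=> Vp Op; apply: differentiable_mx => i j.
have -> : (fun q => solution q i j) = fun q => (Y0 q *m (Z0 (x0, q.2) *m y q.2 j x0)) i 0.
  by apply/funext => q; rewrite mxE.
have Vx : V (x0, p.2) := sector_core x0_in Op.
have along (f : W -> C) : differentiable f p.2 -> differentiable (fun q : E => f q.2) p.
  by move=> Df; exact: (differentiable_comp (differentiable_snd p) Df).
apply: differentiable_mulmx => [k l|]; first exact: Y0_hol.
apply: differentiable_mulmx => [k l|k l].
  by apply: (along (fun w => Z0 (x0, w) k l)); apply: (@differentiable_at_fst R _ (fun p => Z0 p k l)); exact: Z0_hol.
apply: (along (fun w => y w j x0 k l)).
have -> : (fun w => y w j x0 k l) = fun w => nrm (Lw w) j (y w j) k x0 * expC (exponent j (x0, w)).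
  by apply/funext => w; rewrite /nrm -mulrA -expCD addNr expC0 mulr1 ord1.
apply: differentiable_mul; first exact: y_hol.
apply: differentiable_expC; apply: (@differentiable_at_fst R _ (exponent j)).
exact: differentiable_exponent.
Qed.

Lemma mcder_solution z w : Omega w -> Sec z ->
  mcder (slice solution w) z (Aw w z *m solution (z, w)).
Proof.
move=> Ow Sz i j; have Hs := y_sol j Ow Sz.
have := mcderM (slice_sol Ow Sz) (mcder_cst (Z0 (x0, w) *m y w j x0) z).
rewrite mulmx0 addr0 => /(_ i 0) Hd.
have -> : (Aw w z *m solution (z, w)) i j = (Aw w z *m Y0 (z, w) *m (Z0 (x0, w) *m y w j x0)) i 0.
  by rewrite -mulmxA !mxE; apply: eq_bigr => l _; rewrite !mxE.
have -> : (fun x => solution (x, w) i j) = fun x => (Y0 (x, w) *m (Z0 (x0, w) *m y w j x0)) i 0.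
  by apply/funext => x; rewrite mxE.
exact: Hd.
Qed.

(** Asymptotics for the single direction [phi0] already determine a column: on the line
    [ell phi0 be] the difference of two candidates decays at both ends. *)
Lemma solution_agree w j v : Omega w -> solw w v ->
  (forall eps, 0 < eps -> exists M : R, forall z i,
      sector `[phi0, phi0] a z -> M <= umod z ->
      normc (nrm (Lw w) j v i z - (i == j)%:R) <= eps) ->
  forall z, Sec z -> v z = y w j z.
Proof.
move=> Ow sv Hv z Sz; apply/subr0_eq.
apply: (@y_unique w j Ow phi0 (fun z => v z - y w j z) phi0_in (solB sv (y_sol j Ow)) _ z Sz).
move=> e e0; have e2 : 0 < e / 2 by rewrite divr_gt0.
have [M HM] := Hv _ e2; have [M' HM'] := y_decay e2.
exists (Num.max M M') => s i; rewrite ge_max => /andP[h1 h2].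
have be0 := lt_le_trans a_gt0 a_be.
have us : `|s| <= umod (ell phi0 be s).
  by rewrite umod_ell// -sqrtr_sqr ler_wsqrtr// lerDr sqr_ge0.
have Se : sector `[phi0, phi0] a (ell phi0 be s).
  by apply: ell_sector => //; rewrite /= in_itv /= lexx.
have A1 := HM _ i Se (le_trans h1 us); have A2 := HM' _ j _ i Ow Se (le_trans h2 us).
rewrite nrmB; apply: (le_trans (normc_dist_le _ _ ((i == j)%:R))).
by rewrite (splitr e); apply: lerD => //; rewrite normcBC.
Qed.

Lemma far_point (M : R) : exists2 z, sector `[phi0, phi0] a z & M <= umod z /\ Sec z.
Proof.
pose b := Num.max a M; have ab : a <= b by rewrite le_max lexx.
have b0 := lt_le_trans a_gt0 ab.
exists (ell phi0 b 0); first by apply: ell_sector => //; rewrite /= in_itv /= lexx.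
split; last exact: ell_sector.
by rewrite umod_ell// expr0n addr0 sqrtr_sqr ger0_norm ?(ltW b0)// le_max lexx orbT.
Qed.

(** At a far point [z1] the normalized matrix is within [1 / (2 * (n%:R + 1))] of the identity in
    each entry. For a vector of the kernel, the sum [S] of the moduli of its rescaled entries then
    satisfies [S <= S / 2]. Invertibility at [z1] is transported by [Y0] and [Z0]. *)
Lemma solution_unit z w : Omega w -> Sec z -> solution (z, w) \in unitmx.
Proof.
move=> Ow Sz; have n1 : 0 < n%:R + 1 :> R by rewrite ltr_wpDl.
have e0 : 0 < 1 / (2 * (n%:R + 1)) :> R by rewrite divr_gt0// mulr_gt0.
have [M HM] := y_decay e0; have [z1 S1 [Mz1 Sz1]] := far_point M.
have col z' i j (Sz' : Sec z') : solution (z', w) i j = y w j z' i 0 := solutionE i j Ow Sz'.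
have U1 : solution (z1, w) \in unitmx.
  apply: unitmx_inj => u Hu.
  pose c j := u j 0 * expC (exponent j (z1, w)); pose S := \sum_j normc (c j).
  have S0 : 0 <= S by apply: sumr_ge0 => j _; exact: normc_ge0.
  have c_le i : normc (c i) <= 1 / (2 * (n%:R + 1)) * S.
    have sum0 : \sum_j nrm (Lw w) j (y w j) i z1 * c j = 0.
      transitivity ((solution (z1, w) *m u) i 0); last by rewrite Hu mxE.
      rewrite [RHS]mxE; apply: eq_bigr => j _; rewrite col// /nrm /c; set p := y _ _ _ _ _; set q := u _ _.
      transitivity (p * q * (expC (- exponent j (z1, w)) * expC (exponent j (z1, w)))); last first.
        by rewrite -expCD addNr expC0 mulr1.
      by ring.
    have -> : c i = - \sum_j (nrm (Lw w) j (y w j) i z1 - (i == j)%:R) * c j.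
      under eq_bigr => j _ do rewrite mulrBl.
      rewrite sumrB sum0 sub0r opprK (bigD1 i)//= eqxx mul1r big1 ?addr0// => j ji.
      by rewrite eq_sym (negbTE ji) mul0r.
    rewrite normcNE mulr_sumr.
    apply: (@le_trans _ _ (\sum_j normc ((nrm (Lw w) j (y w j) i z1 - (i == j)%:R) * c j))).
      elim/big_ind2 : _ => // [|x x' t t' hx ht]; first by rewrite (normc_real 0) normr0.
      by apply: (le_trans (normcD_le _ _)); exact: lerD.
    by apply: ler_sum => j _; rewrite normcM ler_wpM2r ?normc_ge0// HM.
  have S_le : S <= n%:R * (1 / (2 * (n%:R + 1)) * S).
    apply: (@le_trans _ _ (\sum_(j < n) 1 / (2 * (n%:R + 1)) * S)); first exact: ler_sum.
    by rewrite sumr_const card_ord -[X in X <= _]mulr_natl.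
  have half : n%:R * (1 / (2 * (n%:R + 1))) <= 1 / 2 :> R.
    rewrite mulrA mulr1 ler_pdivrMr ?mulr_gt0//.
    have -> : 1 / 2 * (2 * (n%:R + 1)) = n%:R + 1 :> R by field.
    by rewrite lerDl.
  have S2 : S <= 1 / 2 * S by apply: (le_trans S_le); rewrite mulrA; exact: ler_wpM2r.
  have := lerD S2 S2; rewrite -mulrDl -splitr mul1r gerDl => S_le0.
  apply/matrixP => j k; rewrite ord1 mxE.
  have : normc (c j) <= 0.
    by apply: le_trans S_le0; apply: (sum_ge_term (F := fun j => normc (c j))) => k'; exact: normc_ge0.
  move=> cj; have /normc_eq0/eqP : normc (c j) = 0 by apply/eqP; rewrite eq_le cj normc_ge0.
  by rewrite mulf_eq0 (negbTE (expC_neq0 _)) orbF => /eqP.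
have -> : solution (z, w) = Y0 (z, w) *m (Z0 (z1, w) *m solution (z1, w)).
  apply/matrixP => i j; rewrite col// (slice_unique Ow (y_sol j Ow) Sz Sz1) !mxE.
  apply: eq_bigr => l _; rewrite !mxE; congr (_ * _); apply: eq_bigr => l' _.
  by rewrite col.
have ZY := Z0Y0 (sector_core Sz Ow); have ZY1 := Z0Y0 (sector_core Sz1 Ow).
rewrite unitmx_mul (mulmx1_unit ZY).2 /= unitmx_mul U1 andbT.
exact: (mulmx1_unit ZY1).1.
Qed.

Lemma derive1_solution z w : Omega w -> Sec z ->
  derive1 (slice solution w) z = Aw w z *m solution (z, w).
Proof.
move=> Ow Sz; apply/matrixP => i j.
have Dp : differentiable (slice solution w) z.
  apply: (differentiable_comp (differentiable_slice1 w z)).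
  by apply: differentiable_solution => //; exact: sector_core.
exact: cder_unique (mcder_derive1 Dp i j) (mcder_solution Ow Sz i j).
Qed.

Lemma solution_fundamental : fundamental_solution a I Omega (Lam \+ Rm) solution.
Proof.
split.
  exists [set p | V p /\ Omega p.2]; split.
  - exact: open_setI_snd.
  - by move=> [z w] [/= Sz Ow]; split=> //; exact: sector_core.
  by move=> p [Vp Op]; exact: differentiable_solution.
move=> z w Sz Ow; split; first exact: solution_unit.
rewrite /d_dz derive1_solution// /odeA -scalemxAl scalerA.
by rewrite mulVf ?scale1r//; exact: expC_neq0.
Qed.

Lemma open_margin x : I x -> exists2 del : R, 0 < del & I (x - del) /\ I (x + del).
Proof.
move=> Ix; have /nbhs_ballP[e /= e0 He] := open_nbhs_nbhs (conj I_open Ix).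
have h : `|e / 2| < e by rewrite gtr0_norm ?divr_gt0// gtr_pMr// invf_lt1 ?ltr1n.
exists (e / 2); first by rewrite divr_gt0.
by split; apply: He; rewrite /ball /= ?subKr ?opprD ?addNKr ?subrr ?normrN// addrA subrr sub0r normrN.
Qed.

Lemma sectorS (J J' : set R) z : J `<=` J' -> sector J a z -> sector J' a z.
Proof. by move=> JJ [phi Jphi h]; exists phi => //; exact: JJ. Qed.

(** The columns come from one interval about [phi0]. For a given J, new columns are built on an
    interval that contains J and [phi0] with a margin, available because I is open; [solution_agree]
    identifies them with the old ones. *)
Lemma solution_decay (J : set R) : closed_itv_in I J ->
  forall eps, 0 < eps -> exists M : R, forall w j z i, Omega w ->
      sector J a z -> M <= umod z ->
      normc (nrm (Lw w) j (y w j) i z - (i == j)%:R) <= eps.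
Proof.
move=> [e [f [ef -> JI]]] eps e0.
pose e1 := Num.min e phi0; pose f1 := Num.max f phi0.
have Ie : I e by apply: JI; rewrite /= in_itv /= lexx.
have If : I f by apply: JI; rewrite /= in_itv /= ef lexx.
have Ie1 : I e1 by rewrite /e1; case: leP.
have If1 : I f1 by rewrite /f1; case: leP.
have [d1 d10 [Ic _]] := open_margin Ie1.
have [d2 d20 [_ Id]] := open_margin If1.
have ef1 : e1 <= f1 by rewrite /e1 /f1 le_max ge_min ef.
have cI : `[e1 - d1, f1 + d2]%classic `<=` I.
  by move=> x; rewrite /= in_itv; exact: (I_itv Ic Id).
have [|| y1 [be1 [x1 [_ [s1 dec1 _ _]]]]] := @sector_solution (e1 - d1) e1 f1 (f1 + d2) _ ef1 _ cI.
- by rewrite ltrBlDr ltrDl.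
- by rewrite ltrDl.
have [M HM] := dec1 _ e0; exists M => w j z i Ow Sz Mz.
have agree : forall z, Sec z -> y1 w j z = y w j z.
  apply: (solution_agree Ow (s1 w j Ow)) => e' e'0; have [M' HM'] := dec1 _ e'0.
  exists M' => z' i' Sz' Mz'; apply: HM' => //; apply: sectorS Sz' => x.
  rewrite /= !in_itv /= => /andP[h1 h2]; apply/andP; split.
    by rewrite /e1 ge_min h1 orbT.
  by rewrite /f1 le_max h2 orbT.
have Sz1 : Sec z by exact: sectorS Sz.
have := HM w j z i Ow _ Mz; rewrite /nrm agree//; apply.
apply: sectorS Sz => x; rewrite /= !in_itv /= => /andP[h1 h2]; apply/andP; split.
  by rewrite /e1 ge_min h1.
by rewrite /f1 le_max h2.
Qed.

Lemma solution_asymptotics : has_asymptotics a I Omega N Lam zo solution.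
Proof.
move=> J HJ; have JI : J `<=` I by case: HJ => [e [f []]].
(* The error term is forced: it is the normalized solution minus the identity. *)
exists (fun p => \matrix_(i, j) (solution p i j * expC (- exponent j p) - (i == j)%:R)).
  move=> eps e0; pose S := \sum_(i : 'I_n) \sum_(j : 'I_n) N (delta_mx i j) + 1.
  have N0 := mx_norm_ge0 N_norm.
  have S0 : 0 < S by rewrite ltr_wpDl// sumr_ge0// => i _; rewrite sumr_ge0.
  have [M HM] := solution_decay HJ (divr_gt0 e0 S0); exists M => z w Sz Ow Mz.
  apply: (le_trans (mx_norm_entries N_norm _)).
  apply: (@le_trans _ _ (\sum_(i : 'I_n) \sum_(j : 'I_n) (eps / S) * N (delta_mx i j))).
    apply: ler_sum => i _; apply: ler_sum => j _; apply: ler_wpM2r; first exact: N0.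
    rewrite mxE solutionE//; last exact: sectorS Sz.
    exact: HM.
  have -> : \sum_(i : 'I_n) \sum_(j : 'I_n) eps / S * N (delta_mx i j) = eps / S * (S - 1).
    by rewrite addrK mulr_sumr; apply: eq_bigr => i _; rewrite mulr_sumr.
  by rewrite mulrBr divfK ?gt_eqF// mulr1 lerBlDr lerDl ltW// divr_gt0.
move=> z w gamma Sz Ow Hg.
apply/matrixP => i j; rewrite /exp_diag mul_mx_diag !mxE.
rewrite (path_integral_exponent j Ow Hg).
have alg (s x x' k : C) : x * x' = 1 -> s = (k + (s * x - k)) * x'.
  by move=> h; transitivity (s * (x * x')); [rewrite h mulr1|ring].
by apply: alg; rewrite -expCD addNr expC0.
Qed.

(** Each column of [Y'] is a solution, and the asymptotics on the degenerate interval [[phi0, phi0]]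
    put it under [solution_agree]. *)
Lemma solution_unique (Y' : E -> 'M[C]_n) : fundamental_solution a I Omega (Lam \+ Rm) Y' ->
  has_asymptotics a I Omega N Lam zo Y' ->
  forall p, (Sec `*` Omega) p -> Y' p = solution p.
Proof.
move=> [[U' [oU' SU' DU']] fY'] aY' [z w] [/= Sz Ow].
apply/matrixP => i j; rewrite solutionE//.
pose v (z : C) : 'cV[C]_n := \col_i Y' (z, w) i j.
suff -> : y w j z i 0 = v z i 0 by rewrite mxE.
rewrite -(solution_agree (v := v) Ow _ _ Sz)//.
  move=> x Sx k l; rewrite ord1.
  have Dp : differentiable (slice Y' w) x.
    by apply: (differentiable_comp (differentiable_slice1 w x)); apply: DU'; exact: SU'.
  have := mcder_derive1 Dp k j.
  have [_] := fY' x w Sx Ow; rewrite /d_dz => /(congr1 ( *:%R (expC x))).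
  rewrite scalerA mulfV ?scale1r ?expC_neq0// => -> Hd.
  have -> : (fun x => v x k 0) = fun x => Y' (x, w) k j by apply/funext => ?; rewrite mxE.
  have -> : (Aw w x *m v x) k 0 = (expC x *: ((Lam \+ Rm) (x, w) *m Y' (x, w))) k j.
    rewrite scalemxAl !mxE; apply: eq_bigr => l' _; rewrite [v x _ _]mxE.
    by [].
  exact: Hd.
move=> eps e0; have HJ : closed_itv_in I `[phi0, phi0]%classic.
  exists phi0, phi0; split=> // x; rewrite /= in_itv /= => /le_anti <-.
  exact: I_phi0.
have [E' Hsmall Heq] := aY' _ HJ; have [CN CN0 HCN] := mx_norm_equiv N_norm.
have [M HM] := Hsmall _ (divr_gt0 e0 CN0); exists M => x k Sx Mx.
have SSx : Sec x by apply: sectorS Sx; case: HJ => [? [? []]].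
have segm : C1_path_in Sec zo x (fun t => zo + t%:C%C * (x - zo)).
  by apply: C1_segment => t t01; exact: sector_convex.
have := Heq x w _ Sx Ow segm => /matrixP/(_ k j).
rewrite /exp_diag mul_mx_diag !mxE (path_integral_exponent j Ow segm) => Hkj.
have -> : nrm (Lw w) j v k x - (k == j)%:R = E' (x, w) k j.
  rewrite /nrm mxE Hkj -mulrA -expCD subrr expC0 mulr1.
  exact: addBl.
apply: (le_trans (HCN _ _ _)); rewrite mulrC -ler_pdivlMr//; exact: HM.
Qed.

End Solution.
End Family.

Theorem theorem2p21 (R : realType) (n m : nat) (a : R) (I : set R)
    (Omega : set 'rV[Cx R]_m) (N : 'M[Cx R]_n -> R)
    (Lam Rm : ucover R * 'rV[Cx R]_m -> 'M[Cx R]_n) (zo : ucover R)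
    (n_ge1 : (1 <= n)%N) (m_ge1 : (1 <= m)%N) (a_gt0 : 0 < a)
    (I_open : open I) (I_itv : is_interval I)
    (Omega_open : open Omega) (Omega_connected : connected Omega)
    (N_norm : is_mx_norm N)
    (Lam_hol : holomorphic_on (sector I a `*` Omega) Lam)
    (Lam_diag : forall p, (sector I a `*` Omega) p -> is_diag_mx (Lam p))
    (Lam_int : uniform_integrability a I Omega Lam)
    (Lam_L : uniform_L_condition a I Omega Lam)
    (Rm_hol : holomorphic_on (sector I a `*` Omega) Rm)
    (Rm_decay : uniform_good_decay a I Omega N Rm)
    (zo_in : sector I a zo) :
  exists Y : ucover R * 'rV[Cx R]_m -> 'M[Cx R]_n,
    [/\ fundamental_solution a I Omega (Lam \+ Rm) Y,
        has_asymptotics a I Omega N Lam zo Y &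
        forall Y' : ucover R * 'rV[Cx R]_m -> 'M[Cx R]_n,
          fundamental_solution a I Omega (Lam \+ Rm) Y' ->
          has_asymptotics a I Omega N Lam zo Y' ->
          forall p, (sector I a `*` Omega) p -> Y' p = Y p].
Proof.
have [U1 [oU1 sU1 dLam]] := Lam_hol; have [U2 [oU2 sU2 dRm]] := Rm_hol.
have oU : open (U1 `&` U2) := openI oU1 oU2.
have sU : sector I a `*` Omega `<=` U1 `&` U2 by move=> p Sp; split; [exact: sU1|exact: sU2].
have dL p : (U1 `&` U2) p -> differentiable Lam p by move=> [/dLam].
have dR p : (U1 `&` U2) p -> differentiable Rm p by move=> [_ /dRm].
have [Y0 [Z0 [Y0h Z0h ZY Y0d Z0d]]] := ode_fundamental (ray_core_open (z0 := zo) oU)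
  (fun p t => @ray_core_ray _ _ zo _ p t) (mhol_family_coef (zo := zo) dL dR).
(* Membership of [zo] in the sector supplies a direction in I to start from; the other directions
   are reached by [solution_decay]. *)
have [phi0 Iphi0 _] := zo_in.
have [del del0 [Ic Id]] := open_margin I_open Iphi0.
have JI : `[phi0 - del, phi0 + del]%classic `<=` I.
  by move=> x; rewrite /= in_itv; exact: (I_itv _ _ Ic Id).
have c_lt : phi0 - del < phi0 by rewrite ltrBlDr ltrDl.
have d_gt : phi0 < phi0 + del by rewrite ltrDl.
have phi0_in : phi0 - del <= phi0 <= phi0 + del by rewrite !ltW.
have [y [be [x0 [[abe Sx0] [ys yd yu yh]]]]] := sector_solution a_gt0 I_itv Omega_open N_norm
  zo_in oU sU dL dR Lam_diag Y0h ZY Y0d Z0d Lam_L Rm_decay c_lt (lexx phi0) d_gt JI.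
exists (solution Y0 Z0 y x0); split.
- exact: (solution_fundamental a_gt0 I_itv Omega_open zo_in oU sU dL Y0h Z0h ZY Y0d Z0d Iphi0 Sx0 ys yd yh).
- exact: (solution_asymptotics a_gt0 I_itv Omega_open N_norm zo_in oU sU dL dR Lam_diag Y0h ZY Y0d Z0d
    Lam_L Rm_decay I_open Iphi0 phi0_in abe Sx0 ys yd yu).
exact: (solution_unique a_gt0 I_itv N_norm zo_in oU sU dL ZY Z0d Iphi0 phi0_in abe Sx0 ys yd yu).
Qed.
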